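(* The stochastic convolution $Z_{\mathcal R}(t)=\int_0^t\mathcal R(t-\tau)\,dZ(\tau)$, $t\in[0,T]$, has integrable trajectories and satisfies, for every $t\in[0,T]$ and every $\xi\in\mathcal D(A^* )$, $$\langle Z_{\mathcal R}(t),\xi\rangle_H=\int_0^t\langle a(t-\tau)Z_{\mathcal R}(\tau),A^*\xi\rangle_H\,d\tau+\langle Z(t),\xi\rangle_H\quad P\text{-a.s.}$$
   Context: $H$ is a real separable Hilbert space with inner product $\langle\cdot,\cdot\rangle_H$; $A$ is a closed densely defined linear operator in $H$ with adjoint $A^*$, $a\in L^1_{\mathrm{loc}}(\mathbb R_+)$, and the equation $X(t)=\int_0^t a(t-\tau)AX(\tau)\,d\tau+X_0+Z(t)$ is well-posed with resolvent family $\{\mathcal R(t)\}_{t\ge0}$ of bounded operators, uniformly bounded on compact intervals, strongly continuous, $\mathcal R(0)=I$, satisfying $\mathcal R(t)x=x+\int_0^t a(t-\tau)A\mathcal R(\tau)x\,d\tau$ for $x\in\mathcal D(A)$. $Z$ is an $H$-valued Lévy process (independent stationary increments, continuous in probability, càdlàg, $Z(0)=0$) on a filtered probability space. The stochastic convolution $\int_0^t\mathcal R(t-\tau)\,dZ(\tau)$ is the limit in probability of $\sum_i\mathcal R(s_i)(Z(t-t_{i-1})-Z(t-t_i))$ over partitions $0=t_0<\dots<t_n=t$ with mesh $\to0$, $s_i\in[t_{i-1},t_i]$. *)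

(* Defs.v *)
From HB Require Import structures.
From mathcomp Require Import all_boot all_order all_algebra.
From mathcomp Require Import all_classical all_reals all_analysis.
Set Implicit Arguments. Unset Strict Implicit. Unset Printing Implicit Defensive.
Import Order.TTheory GRing.Theory Num.Theory.
Import numFieldNormedType.Exports.
Local Open Scope classical_set_scope.
Local Open Scope ring_scope.

Definition is_inner_product {R : realType} {H : normedModType R}
    (ip : H -> H -> R) : Prop :=
  [/\ (forall x y, ip x y = ip y x),
      (forall c x y z, ip (c *: x + y) z = c * ip x z + ip y z)
    & (forall x, ip x x = `|x| ^+ 2)].

Definition separable_space {R : realType} {H : normedModType R} : Prop :=
  exists S : set H, countable S /\ closure S = setT.

Definition borelH {R : realType} {H : normedModType R} : set (set H) :=
  <<s [set U : set H | open U] >>.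

Definition closed_densely_defined {R : realType} {H : normedModType R}
    (D : set H) (A : H -> H) : Prop :=
  [/\ D 0,
      (forall c x y, D x -> D y -> D (c *: x + y) /\ A (c *: x + y) = c *: A x + A y),
      closure D = setT
    & (forall (u : nat -> H) x y, (forall n, D (u n)) ->
         u @ \oo --> x -> (A \o u) @ \oo --> y -> D x /\ A x = y)].

(* xi is in the domain of A^* and A^* xi = eta *)
Definition adjoint_rel {R : realType} {H : normedModType R}
    (ip : H -> H -> R) (D : set H) (A : H -> H) (xi eta : H) : Prop :=
  forall x, D x -> ip (A x) xi = ip x eta.

Definition locally_integrable_Rplus {R : realType} (a : R -> R) : Prop :=
  forall T : R, 0 <= T ->
    (@lebesgue_measure R).-integrable `[0, T]%classic (fun x => (a x)%:E).

Definition resolvent_family {R : realType} {H : normedModType R}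
    (ip : H -> H -> R) (D : set H) (A : H -> H) (a : R -> R)
    (Res : R -> H -> H) : Prop :=
  [/\
      (forall t c x y, Res t (c *: x + y) = c *: Res t x + Res t y),
      (forall T : R, 0 <= T -> exists M : R, forall t x,
          0 <= t <= T -> `|Res t x| <= M * `|x|),
      (forall x, {within [set t : R | 0 <= t], continuous (fun t => Res t x)}),
      (forall x, Res 0 x = x) /\
      (forall t x, 0 <= t -> D x -> D (Res t x) /\ A (Res t x) = Res t (A x))
    & (* resolvent equation R(t)x = x + int_0^t a(t-s) A R(s) x ds, x in D(A),
         (H-valued integral, tested against every y in H) *)
      (forall t x, 0 <= t -> D x -> forall y : H,
         (@lebesgue_measure R).-integrable `[0, t]%classic
            (fun s => (a (t - s) * ip (A (Res s x)) y)%:E) /\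
         ip (Res t x) y = ip x y +
            Rintegral (@lebesgue_measure R) `[0, t]%classic
              (fun s => a (t - s) * ip (A (Res s x)) y))].

Section Prob.
Context {d : measure_display} {Omega : measurableType d} {R : realType}
  {H : normedModType R} (P : probability Omega R).

Definition Hmeasurable (X : Omega -> H) : Prop :=
  forall B, borelH B -> measurable (X @^-1` B).

Definition incr_set (Z : R -> Omega -> H) (t : nat -> R) (B : nat -> set H)
    (k : nat) : set Omega :=
  [set w | B k (Z (t k.+1) w - Z (t k) w)].

Definition independent_increments (Z : R -> Omega -> H) : Prop :=
  forall (n : nat) (t : nat -> R), 0 <= t 0%N ->
    (forall k, (k < n)%N -> t k < t k.+1) ->
    forall B : nat -> set H, (forall k, borelH (B k)) ->
    P (\bigcap_(k < n) incr_set Z t B k) =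
    (\prod_(k < n) P (incr_set Z t B k))%E.

Definition stationary_increments (Z : R -> Omega -> H) : Prop :=
  forall s t, 0 <= s -> s <= t -> forall B, borelH B ->
    P [set w | B (Z t w - Z s w)] = P [set w | B (Z (t - s) w)].

Definition continuous_in_probability (Z : R -> Omega -> H) : Prop :=
  forall t, 0 <= t -> forall eps eta : R, 0 < eps -> 0 < eta ->
    exists delta : R, 0 < delta /\ forall s, 0 <= s -> `|s - t| < delta ->
      (P [set w | (eps < `|Z s w - Z t w|)%R] < eta%:E)%E.

Definition cadlag (Z : R -> Omega -> H) : Prop :=
  forall w t, 0 <= t ->
    (fun s => Z s w) @ t^'+ --> Z t w /\
    (0 < t -> exists l : H, (fun s => Z s w) @ t^'- --> l).

Definition levy_process (Z : R -> Omega -> H) : Prop :=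
  [/\ (forall w, Z 0 w = 0) /\ (forall t, 0 <= t -> Hmeasurable (Z t)),
      independent_increments Z,
      stationary_increments Z,
      continuous_in_probability Z
    & cadlag Z].

Definition tagged_partition (t delta : R) (n : nat) (p s : nat -> R) : Prop :=
  [/\ p 0%N = 0, p n = t,
      (forall k, (k < n)%N -> p k < p k.+1),
      (forall k, (k < n)%N -> p k.+1 - p k < delta)
    & (forall k, (k < n)%N -> p k <= s k.+1 <= p k.+1)].

Definition riemann_sum (Res : R -> H -> H) (Z : R -> Omega -> H) (t : R)
    (n : nat) (p s : nat -> R) (w : Omega) : H :=
  \sum_(k < n) Res (s k.+1) (Z (t - p k) w - Z (t - p k.+1) w).

(* Y is the limit in probability of the Riemann sums, i.e.
   Y = int_0^t Res(t - tau) dZ(tau) *)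
Definition is_stoch_conv (Res : R -> H -> H) (Z : R -> Omega -> H) (t : R)
    (Y : Omega -> H) : Prop :=
  forall eps eta : R, 0 < eps -> 0 < eta ->
    exists delta : R, 0 < delta /\ forall n p s, tagged_partition t delta n p s ->
      (P [set w | (eps < `|riemann_sum Res Z t n p s w - Y w|)%R] < eta%:E)%E.

End Prob.

(* Bochner integrability of a trajectory on [0, T] (H separable, so Borel
   measurability = strong measurability) *)
Definition bochner_integrable_on {R : realType} {H : normedModType R}
    (T : R) (f : R -> H) : Prop :=
  (forall B, borelH B -> measurable (`[0, T]%classic `&` f @^-1` B)) /\
  (\int[@lebesgue_measure R]_(x in `[0%R, T]%classic) (`|f x|)%:E < +oo)%E.

(* Main.v *)
Require Import Defs.
From HB Require Import structures.
From mathcomp Require Import all_boot all_order all_algebra.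
From mathcomp Require Import all_classical all_reals all_analysis.
From mathcomp Require Import measurable_realfun.
From mathcomp Require Import ring lra zify.
Import Order.TTheory GRing.Theory Num.Theory.
Import numFieldNormedType.Exports.
Local Open Scope classical_set_scope.
Local Open Scope ring_scope.
Set Implicit Arguments. Unset Strict Implicit. Unset Printing Implicit Defensive.

(** Increments of [Z] over a partition are independent, and off a small event
    they are bounded by [2 lam], since cadlag paths are bounded.
    Kolmogorov's converse maximal inequality, applied to equidistant partitions,
    bounds the mean and second moment of the truncated increment over a step [h]
    by [C lam h] and [C lam^2 h]; stationarity then carries these bounds to
    arbitrary partitions, so sums [sum_k B_k (Z(p_(k+1)) - Z(p_k))] with
    [|B_k| <= M] have second moment at most [C (M lam)^2] on the event
    [sup |Z| <= lam].  Splitting [Z] by the projection on finitely many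
    directions, where [Res] is uniformly continuous, and its complement, which
    is uniformly small along a cadlag path by compactness, shows that Riemann
    sums are Cauchy in probability, uniformly in the endpoint.  Hence sums over
    a fixed grid have a subsequence whose limit [Y] is jointly measurable and
    a.s. the stochastic convolution for each time.  Up to moving the endpoint of
    [Z] to the grid, these sums satisfy the equation exactly, by the resolvent
    equation shifted to each grid point, and the moment bounds with Tonelli's
    theorem give integrability of the trajectories and the passage to the
    limit. *)

(** A Lévy process may have no moments, so every estimate is restricted to the event that its path
    stays bounded; but this restriction spoils the independence of the increments. The remedy is
    discretization: each increment is replaced by a nearest point of a finite net, and by 0 when it
    is too large. The replaced increments are bounded and still independent on the whole space, and
    on the bounded event they converge to the true ones, so Fatou's lemma controls the integral over
    that event by unrestricted expectations. With finitely many outcomes these are finite sums,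
    computed from the independence of events alone. A second obstacle is that [Res] is only strongly
    continuous: a small mesh does not make [Res u - Res v] small in operator norm. In one part of
    the splitting the operators are small, in the other the process is. Finally, for each time the
    convolution is determined only up to a null set, so its trajectories have no meaning until one
    limit is chosen for all times at once; this is why the Cauchy estimate must be uniform in the
    endpoint. *)

Section inner_product.
Context {R : realType} {H : normedModType R} (ip : H -> H -> R).
Hypothesis hip : is_inner_product ip.

Lemma ipC x y : ip x y = ip y x. Proof. by case: hip. Qed.

Lemma ipP c x y z : ip (c *: x + y) z = c * ip x z + ip y z.
Proof. by case: hip => _ + _; apply. Qed.

Lemma ip_norm x : ip x x = `|x| ^+ 2. Proof. by case: hip. Qed.

Lemma ipDl x y z : ip (x + y) z = ip x z + ip y z.
Proof. by rewrite -[x in LHS]scale1r ipP mul1r. Qed.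

Lemma ip0l z : ip 0 z = 0.
Proof. by apply: (@addrI _ (ip 0 z)); rewrite -ipDl !addr0. Qed.

Lemma ipZl c x z : ip (c *: x) z = c * ip x z.
Proof. by rewrite -[c *: x]addr0 ipP ip0l addr0. Qed.

Lemma ipNl x z : ip (- x) z = - ip x z.
Proof. by rewrite -scaleN1r ipZl mulN1r. Qed.

Lemma ipBl x y z : ip (x - y) z = ip x z - ip y z.
Proof. by rewrite ipDl ipNl. Qed.

Lemma ipDr x y z : ip z (x + y) = ip z x + ip z y.
Proof. by rewrite ipC ipDl !(ipC _ z). Qed.

Lemma ipZr c x z : ip z (c *: x) = c * ip z x.
Proof. by rewrite ipC ipZl (ipC _ z). Qed.

Lemma ip0r z : ip z 0 = 0.
Proof. by rewrite ipC ip0l. Qed.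

Lemma ipBr x y z : ip z (x - y) = ip z x - ip z y.
Proof. by rewrite ipC ipBl !(ipC _ z). Qed.

Lemma ip_suml I (r : seq I) (Q : pred I) (f : I -> H) z :
  ip (\sum_(i <- r | Q i) f i) z = \sum_(i <- r | Q i) ip (f i) z.
Proof. exact: (big_morph (ip ^~ z) (fun x y => ipDl x y z) (ip0l z)). Qed.

Lemma sqr_normD x y : `|x + y| ^+ 2 = `|x| ^+ 2 + 2 * ip x y + `|y| ^+ 2.
Proof. by rewrite -!ip_norm !(ipDl, ipDr) (ipC y x); ring. Qed.

Lemma sqr_normB x y : `|x - y| ^+ 2 = `|x| ^+ 2 - 2 * ip x y + `|y| ^+ 2.
Proof. by rewrite -!ip_norm !(ipBl, ipBr) (ipC y x); ring. Qed.

Lemma Cauchy_Schwarz_ip x y : `|ip x y| <= `|x| * `|y|.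
Proof.
have [->|y0] := eqVneq y 0; first by rewrite ip0r !normr0 mulr0.
have ny : 0 < `|y| by rewrite normr_gt0.
rewrite -ler_sqr ?nnegrE ?mulr_ge0// real_normK ?num_real//.
have := sqr_ge0 `|(`|y| ^+ 2) *: x - ip x y *: y|.
rewrite -(ip_norm (_ - _)) !(ipBl, ipBr, ipZl, ipZr) !ip_norm (ipC y x).
rewrite exprMn => h.
have : 0 <= `|y| ^+ 2 * (`|x| ^+ 2 * `|y| ^+ 2 - ip x y ^+ 2).
  by apply: (le_trans h); rewrite le_eqVlt; apply/orP; left; apply/eqP; ring.
by rewrite pmulr_rge0 ?exprn_gt0// subr_ge0.
Qed.

Lemma ip_continuousl y : continuous (fun x : H => ip x y).
Proof.
move=> x; apply/cvgrPdist_le => /= e e0.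
have n0 : 0 < `|y| + 1 by rewrite ltr_pwDr.
near=> z; rewrite -ipBl (le_trans (Cauchy_Schwarz_ip _ _))//.
apply: (@le_trans _ _ (`|x - z| * (`|y| + 1))); first by rewrite ler_wpM2l// lerDl.
rewrite -ler_pdivlMr//.
near: z; apply: cvgr_dist_le; [exact: cvg_id|by rewrite divr_gt0].
Unshelve. all: by end_near. Qed.

(** * Gram-Schmidt projections along a dense sequence *)

Section orthogonalization.
Variable x_ : nat -> H.

(* Gram-Schmidt; [e_ n] is 0 when [x_ n] depends linearly on its predecessors,
   since then it is normalized by [0^-1 = 0]. *)
Fixpoint ortho_proj (n : nat) : H -> H :=
  if n is m.+1 then
    let v := x_ m - ortho_proj m (x_ m) in
    let e := `|v|^-1 *: v in
    fun y => ortho_proj m y + ip y e *: e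
  else fun=> 0.

Definition ortho_vec n := let v := x_ n - ortho_proj n (x_ n) in `|v|^-1 *: v.

Local Notation e_ := ortho_vec.
Local Notation Pi := ortho_proj.

Lemma ortho_projS n y : Pi n.+1 y = Pi n y + ip y (e_ n) *: e_ n.
Proof. by []. Qed.

Lemma ortho_projE n y : Pi n y = \sum_(i < n) ip y (e_ i) *: e_ i.
Proof.
elim: n => [|n ih]; first by rewrite big_ord0.
by rewrite ortho_projS big_ord_recr /= ih.
Qed.

Lemma ortho_proj_sub n x y : Pi n (x - y) = Pi n x - Pi n y.
Proof.
rewrite !ortho_projE -sumrB; apply: eq_bigr => i _.
by rewrite ipBl scalerBl.
Qed.

Lemma ortho_proj_lin n c x y : Pi n (c *: x + y) = c *: Pi n x + Pi n y.
Proof.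
rewrite !ortho_projE scaler_sumr -big_split; apply: eq_bigr => i _ /=.
by rewrite ipP scalerDl -scalerA.
Qed.

Lemma norm_ortho_vec n : `|e_ n| = (x_ n - Pi n (x_ n) != 0)%:R.
Proof.
rewrite /ortho_vec /= normrZ normfV normr_id; case: eqVneq => [->|h] /=.
  by rewrite normr0 mulr0.
by rewrite mulVf ?normr_eq0.
Qed.

Lemma norm_ortho_vec_le1 n : `|e_ n| <= 1.
Proof. by rewrite norm_ortho_vec; case: (_ != _). Qed.

(** The coefficient at [e_ i] cancels in both cases: a nondegenerate [e_ i] has norm 1, and a
    degenerate one is 0. *)
Lemma ortho_vec_orthogonal n i : (i < n)%N -> ip (e_ n) (e_ i) = 0.
Proof.
elim/ltn_ind: n i => n ih i in_.
rewrite {1}/ortho_vec /= ipZl.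
suff -> : ip (x_ n - Pi n (x_ n)) (e_ i) = 0 by rewrite mulr0.
rewrite ipBl ortho_projE ip_suml.
rewrite (bigD1 (Ordinal in_))//= big1 ?addr0; last first.
  move=> j ji; rewrite ipZl.
  have [lt|gt|eq] := ltngtP j i.
  - by rewrite (ipC (e_ j)) ih ?mulr0.
  - by rewrite (ih j) ?mulr0.
  - by move: ji; rewrite -val_eqE /= eq eqxx.
rewrite ipZl ip_norm norm_ortho_vec.
have [/eqP h|h] := eqVneq (x_ i - Pi i (x_ i)) 0; last by rewrite expr1n mulr1 subrr.
have -> : e_ i = 0 by rewrite /ortho_vec/= (eqP h) scaler0.
by rewrite ip0r mul0r subrr.
Qed.

Lemma ip_ortho_proj_vec n i y : (i < n)%N -> ip (Pi n y) (e_ i) = ip y (e_ i).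
Proof.
move=> in_; rewrite ortho_projE ip_suml (bigD1 (Ordinal in_))//= big1 ?addr0; last first.
  move=> j ji; rewrite ipZl.
  have [lt|gt|eq] := ltngtP j i.
  - by rewrite (ipC (e_ j)) ortho_vec_orthogonal ?mulr0.
  - by rewrite ortho_vec_orthogonal ?mulr0.
  - by move: ji; rewrite -val_eqE /= eq eqxx.
rewrite ipZl ip_norm norm_ortho_vec.
have [/eqP h|h] := eqVneq (x_ i - Pi i (x_ i)) 0; last by rewrite expr1n mulr1.
have -> : e_ i = 0 by rewrite /ortho_vec/= (eqP h) scaler0.
by rewrite ip0r mul0r.
Qed.

(** Orthogonality of the residual [y - Pi n y] to [Pi n y], in the form that yields both Pythagorean
    identities below. *)
Lemma ip_ortho_proj n y : ip (Pi n y) (Pi n y) = ip y (Pi n y).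
Proof.
rewrite {2 3}ortho_projE ipC (ipC y) !ip_suml; apply: eq_bigr => i _.
by rewrite 2!(ipZl (ip y _)) 2!(ipC (e_ i)) ip_ortho_proj_vec.
Qed.

Lemma sqr_norm_ortho_proj n y :
  `|Pi n y| ^+ 2 = \sum_(i < n) ip y (e_ i) ^+ 2.
Proof.
rewrite -ip_norm ip_ortho_proj ipC ortho_projE ip_suml.
by apply: eq_bigr => i _; rewrite ipZl (ipC (e_ i)).
Qed.

Lemma sqr_norm_ortho_compl n y : `|y - Pi n y| ^+ 2 = `|y| ^+ 2 - `|Pi n y| ^+ 2.
Proof. by rewrite sqr_normB -ip_ortho_proj ip_norm; ring. Qed.

Lemma norm_ortho_compl_le n y : `|y - Pi n y| <= `|y|.
Proof.
by rewrite -ler_sqr ?nnegrE// sqr_norm_ortho_compl lerBlDr lerDl sqr_ge0.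
Qed.

Lemma norm_ortho_compl_anti m n y : (m <= n)%N -> `|y - Pi n y| <= `|y - Pi m y|.
Proof.
elim: n => [|n ih]; first by rewrite leqn0 => /eqP ->.
rewrite leq_eqVlt => /orP[/eqP ->//|/ih]; apply: le_trans.
rewrite -ler_sqr ?nnegrE// !sqr_norm_ortho_compl lerD2l lerN2.
by rewrite !sqr_norm_ortho_proj big_ord_recr /= lerDl sqr_ge0.
Qed.

Lemma ortho_proj_id n : Pi n.+1 (x_ n) = x_ n.
Proof.
rewrite ortho_projS; set v := x_ n - Pi n (x_ n).
have -> : ip (x_ n) (e_ n) *: e_ n = v; last by rewrite /v addrC subrK.
rewrite /ortho_vec /= -/v ipZr scalerA.
have xv : ip (x_ n) v = `|v| ^+ 2.
  by rewrite sqr_norm_ortho_compl /v ipBr -ip_ortho_proj !ip_norm.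
rewrite xv; have [->|v0] := eqVneq v 0; first by rewrite scaler0.
have nv : `|v| != 0 by rewrite normr_eq0.
suff -> : `|v|^-1 * `|v| ^+ 2 * `|v|^-1 = 1 by rewrite scale1r.
by field.
Qed.

Hypothesis x_dense : forall y (e : R), 0 < e -> exists n, `|y - x_ n| < e.

Lemma cvg_ortho_compl y : (fun n => `|y - Pi n y|) @ \oo --> (0 : R).
Proof.
apply/cvgr0Pnorm_lt => e e0.
have [n yn] := x_dense y e0.
near=> m; rewrite normr_id (le_lt_trans _ yn)//.
have nm : (n < m)%N by near: m; exists n.+1.
apply: le_trans (norm_ortho_compl_anti y nm) _.
(* Since [Pi n.+1] fixes [x_ n], the vectors [y] and [y - x_ n] have the same residual, and a
   residual is never longer than its vector. *)
have -> : y - Pi n.+1 y = (y - x_ n) - Pi n.+1 (y - x_ n).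
  by rewrite ortho_proj_sub ortho_proj_id opprB addrA subrK.
exact: norm_ortho_compl_le.
Unshelve. all: by end_near. Qed.

Lemma cvg_ortho_proj y : (fun n => Pi n y) @ \oo --> y.
Proof.
apply/cvgrPdist_lt => e e0.
have /cvgr0Pnorm_lt/(_ _ e0) := cvg_ortho_compl y.
by apply: filterS => n; rewrite normr_id.
Qed.

End orthogonalization.
End inner_product.

(** * Hilbert-valued walks with finitely many independent outcomes *)

Section finite_expectation.
Context {R : realType} {I : finType}.
Variable p : nat -> I -> R.
Hypothesis p_ge0 : forall k i, 0 <= p k i.
Hypothesis p_sum1 : forall k, \sum_i p k i = 1.

(* Expectation of [F] under the product of the laws [p 0], ..., [p n.-1]; the
   most recent outcome is the head of the sequence passed to [F]. *)
Fixpoint prod_expect (n : nat) (F : seq I -> R) : R :=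
  if n is m.+1 then prod_expect m (fun v => \sum_i p m i * F (i :: v))
  else F [::].

Local Notation Ex := prod_expect.

Lemma le_prod_expect n F G : (forall v, size v = n -> F v <= G v) ->
  Ex n F <= Ex n G.
Proof.
elim: n F G => [|n ih] F G FG /=; first exact: FG.
apply: ih => v vn; apply: ler_sum => i _; apply: ler_wpM2l => //.
by apply: FG; rewrite /= vn.
Qed.

Lemma eq_prod_expect n F G : (forall v, size v = n -> F v = G v) ->
  Ex n F = Ex n G.
Proof.
by move=> FG; apply/eqP; rewrite eq_le !le_prod_expect// => v /FG ->.
Qed.

Lemma prod_expect_lin n F c G : Ex n (fun v => F v + c * G v) = Ex n F + c * Ex n G.
Proof.
elim: n F G => [//|n ih] F G /=; rewrite -ih; apply: eq_prod_expect => v _.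
rewrite mulr_sumr -big_split; apply: eq_bigr => i _ /=; ring.
Qed.

Lemma prod_expect_cst n c : Ex n (fun=> c) = c.
Proof.
elim: n => [//|n ih] /=; rewrite -[RHS]ih; apply: eq_prod_expect => v _.
by rewrite -mulr_suml p_sum1 mul1r.
Qed.

Lemma prod_expect_sum J (r : seq J) n (c : J -> R) (F : J -> seq I -> R) :
  Ex n (fun u => \sum_(j <- r) c j * F j u) = \sum_(j <- r) c j * Ex n (F j).
Proof.
elim: r => [|j r ih].
  rewrite big_nil -[RHS](prod_expect_cst n); apply: eq_prod_expect => v _.
  by rewrite big_nil.
rewrite big_cons -ih addrC -prod_expect_lin; apply: eq_prod_expect => v _.
by rewrite big_cons addrC.
Qed.

Section hilbert_valued.
Context {H : normedModType R} (ip : H -> H -> R).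
Hypothesis hip : is_inner_product ip.
Implicit Type y : nat -> I -> H.

Fixpoint walk (y : nat -> I -> H) (v : seq I) : H :=
  if v is i :: u then walk y u + y (size u) i else 0.

Lemma walk_sub y (c : nat -> H) v :
  walk (fun k i => y k i - c k) v = walk y v - \sum_(k < size v) c k.
Proof.
elim: v => [|i u ih] /=; first by rewrite big_ord0 subr0.
by rewrite ih big_ord_recr /= opprD addrACA.
Qed.

Lemma expect_sqr_walkS y (x : H) k :
  \sum_i p k i * `|x + y k i| ^+ 2 =
  `|x| ^+ 2 + 2 * ip x (\sum_i p k i *: y k i) + \sum_i p k i * `|y k i| ^+ 2.
Proof.
transitivity (\sum_i (p k i * `|x| ^+ 2 + 2 * (p k i * ip x (y k i)) +
    p k i * `|y k i| ^+ 2)).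
  by apply: eq_bigr => i _; rewrite (sqr_normD hip); ring.
rewrite !big_split /= -mulr_suml p_sum1 mul1r -mulr_sumr; congr (_ + 2 * _ + _).
rewrite (ipC hip) (ip_suml hip); apply: eq_bigr => i _.
by rewrite (ipZl hip) (ipC hip).
Qed.

(** A centred step is orthogonal in mean to the past, so the cross term vanishes and variances
    add. *)
Lemma expect_sqr_centered_walk y n :
  (forall k, \sum_i p k i *: y k i = 0) ->
  Ex n (fun v => `|walk y v| ^+ 2) = \sum_(k < n) \sum_i p k i * `|y k i| ^+ 2.
Proof.
move=> y0; elim: n => [|n ih] /=; first by rewrite big_ord0 normr0 expr0n.
rewrite big_ord_recr /= -ih.
rewrite -[X in _ + X]mulr1 -[1 in X in _ + X](prod_expect_cst n 1) -prod_expect_lin.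
apply: eq_prod_expect => v vn.
by rewrite vn expect_sqr_walkS y0 (ip0r hip) mulr0 addr0 mulr1.
Qed.

Variable y : nat -> I -> H.

Definition wmean k := \sum_i p k i *: y k i.
Definition wsqr k := \sum_i p k i * `|y k i| ^+ 2.

Lemma wsqr_ge0 k : 0 <= wsqr k.
Proof. by apply: sumr_ge0 => i _; rewrite mulr_ge0. Qed.

Lemma wmean_center k : \sum_i p k i *: (y k i - wmean k) = 0.
Proof.
under eq_bigr do rewrite scalerBr.
by rewrite sumrB -scaler_suml p_sum1 scale1r subrr.
Qed.

Lemma wsqr_center k : \sum_i p k i * `|y k i - wmean k| ^+ 2 <= wsqr k.
Proof.
apply: (@le_trans _ _ (\sum_i (p k i * `|y k i| ^+ 2 -
    2 * (p k i * ip (y k i) (wmean k)) + p k i * `|wmean k| ^+ 2))).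
  rewrite le_eqVlt; apply/orP; left; apply/eqP.
  by apply: eq_bigr => i _; rewrite (sqr_normB hip); ring.
rewrite !big_split /= -mulr_suml p_sum1 mul1r sumrN -mulr_sumr.
have -> : \sum_i p k i * ip (y k i) (wmean k) = `|wmean k| ^+ 2.
  rewrite -(ip_norm hip) [in RHS]/wmean (ip_suml hip).
  by apply: eq_bigr => i _; rewrite (ipZl hip).
rewrite -/(wsqr k); have := sqr_ge0 `|wmean k|; lra.
Qed.

(** The drift is split off by [|a + m|^2 <= 2 |a|^2 + 2 |m|^2]; variances of the centred walk add,
    and the deterministic drift is bounded separately. *)
Lemma expect_sqr_walk_le n :
  Ex n (fun v => `|walk y v| ^+ 2) <=
  2 * (\sum_(k < n) wsqr k) + 2 * `|\sum_(k < n) wmean k| ^+ 2.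
Proof.
set m := \sum_(k < n) wmean k.
apply: (@le_trans _ _ (Ex n (fun v => 2 * `|m| ^+ 2 +
    2 * `|walk (fun k i => y k i - wmean k) v| ^+ 2))).
  apply: le_prod_expect => v vn; rewrite walk_sub vn -/m.
  rewrite -[X in `|X| ^+ 2 <= _](subrK m).
  set a := walk y v - m.
  have := sqr_ge0 (`|a| - `|m|); rewrite sqrrB => h.
  apply: (@le_trans _ _ ((`|a| + `|m|) ^+ 2)).
    by rewrite ler_sqr ?nnegrE ?addr_ge0// ler_normD.
  by rewrite sqrrD; lra.
rewrite prod_expect_lin prod_expect_cst addrC lerD2r ler_pM2l//.
rewrite expect_sqr_centered_walk; last by move=> k; rewrite wmean_center.
by apply: ler_sum => k _; exact: wsqr_center.
Qed.

(** * Moment bounds for a walk that is likely to stay bounded *)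

Section kolmogorov.
Variable l : R.
Hypothesis l_ge0 : 0 <= l.
Hypothesis y_le : forall k i, `|y k i| <= 2 * l.

Fixpoint walk_stays (v : seq I) : bool :=
  if v is i :: u then walk_stays u && (`|walk y v| <= l) else true.

(** The walk frozen at its first exit from the ball of radius [l]. The exiting step is kept; it adds
    at most [2 * l], whence the bound [3 * l]. *)
Fixpoint stopped_walk (v : seq I) : H :=
  if v is i :: u then if walk_stays u then walk y v else stopped_walk u else 0.

Lemma walk_stays_le v : walk_stays v -> `|walk y v| <= l.
Proof. by case: v => [|i u] /=; [rewrite normr0|case/andP]. Qed.

Lemma stopped_walk_stays v : walk_stays v -> stopped_walk v = walk y v.
Proof. by case: v => [//|i u] /= /andP[->]. Qed.

Lemma stopped_walk_le v : `|stopped_walk v| <= 3 * l.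
Proof.
elim: v => [|i u ih] /=; first by rewrite normr0 mulr_ge0.
case: ifPn => // /walk_stays_le h.
have := ler_normD (walk y u) (y (size u) i); have := y_le (size u) i; lra.
Qed.

Definition stay_prob n := Ex n (fun v => (walk_stays v)%:R).

Lemma stay_probS n : stay_prob n.+1 <= stay_prob n.
Proof.
rewrite /stay_prob /=; apply: le_prod_expect => v vn.
rewrite -[leRHS]mul1r -[X in X * _](p_sum1 n) mulr_suml; apply: ler_sum => i _.
by apply: ler_wpM2l => //; rewrite ler_nat; case: (walk_stays v) => //=; case: (_ <= l).
Qed.

(* Kolmogorov's converse maximal inequality; the drift enters through [wmean]. *)
Lemma stopped_walk_sqr_ge n :
  stay_prob n * (\sum_(k < n) wsqr k) - 2 * l * (\sum_(k < n) `|wmean k|) <=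
  Ex n (fun v => `|stopped_walk v| ^+ 2).
Proof.
elim: n => [|n ih].
  by rewrite !big_ord0 /= normr0 expr0n !mulr0 subr0.
apply: (@le_trans _ _ (Ex n (fun v => (`|stopped_walk v| ^+ 2 +
    wsqr n * (walk_stays v)%:R) + (- (2 * l * `|wmean n|)) * 1))).
  rewrite !prod_expect_lin prod_expect_cst -/(stay_prob n) !big_ord_recr /=.
  (* Staying gets less likely with time, so the earlier second moments may be weighted by the
     smaller [stay_prob n.+1]. *)
  have s1 := stay_probS n.
  have : stay_prob n.+1 * (\sum_(k < n) wsqr k + wsqr n) <=
         stay_prob n * (\sum_(k < n) wsqr k + wsqr n).
    apply: ler_wpM2r => //; apply: addr_ge0; last exact: wsqr_ge0.
    by apply: sumr_ge0 => k _; exact: wsqr_ge0.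
  lra.
(* Given the past, a walk that has stayed gains [wsqr n] in mean square, up to a cross term of size
   at most [2 * l * |wmean n|]; a stopped walk does not move. *)
apply: le_prod_expect => v vn /=; rewrite vn.
case: (boolP (walk_stays v)) => gv.
  rewrite expect_sqr_walkS stopped_walk_stays// -/(wmean n) -/(wsqr n).
  have := Cauchy_Schwarz_ip hip (walk y v) (wmean n).
  have := walk_stays_le gv => h1.
  have : `|walk y v| * `|wmean n| <= l * `|wmean n| by apply: ler_wpM2r.
  rewrite /= ler_norml => h2 /andP[h3 _]; lra.
rewrite -mulr_suml p_sum1 mul1r.
have : 0 <= l * `|wmean n| by apply: mulr_ge0.
rewrite /=; lra.
Qed.

Lemma walk_sqr_le n : stay_prob n * (\sum_(k < n) wsqr k) <=
  9 * l ^+ 2 + 2 * l * (\sum_(k < n) `|wmean k|).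
Proof.
have h1 := stopped_walk_sqr_ge n.
have : Ex n (fun v => `|stopped_walk v| ^+ 2) <= 9 * l ^+ 2.
  rewrite -[leRHS](prod_expect_cst n); apply: le_prod_expect => v _.
  have := stopped_walk_le v; rewrite -ler_sqr ?nnegrE ?mulr_ge0//; lra.
lra.
Qed.

(** While the walk stays below [l], the centred walk has norm at least [|m| - l], where [m] is the
    total drift; Chebyshev's argument then bounds the drift by the second moments. This complements
    [walk_sqr_le], which bounds the second moments by the drift. *)
Lemma walk_mean_le n : l <= `|\sum_(k < n) wmean k| ->
  stay_prob n * (`|\sum_(k < n) wmean k| - l) ^+ 2 <= \sum_(k < n) wsqr k.
Proof.
set m := \sum_(k < n) wmean k => lm.
apply: (@le_trans _ _ (Ex n (fun v => `|walk (fun k i => y k i - wmean k) v| ^+ 2))).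
  rewrite mulrC -[leLHS]add0r -[0 in leLHS](prod_expect_cst n) -prod_expect_lin.
  apply: le_prod_expect => v vn; rewrite add0r walk_sub vn -/m.
  case: (boolP (walk_stays v)) => gv; last by rewrite mulr0 sqr_ge0.
  rewrite mulr1 ler_sqr ?nnegrE ?subr_ge0// distrC.
  have := walk_stays_le gv; have := lerB_dist m (walk y v); lra.
rewrite expect_sqr_centered_walk; last by move=> k; rewrite wmean_center.
by apply: ler_sum => k _; exact: wsqr_center.
Qed.

End kolmogorov.
End hilbert_valued.
End finite_expectation.

(** The second moment [v] is at most linear in the drift [b], while [(b - l) ^+ 2] is at most a
    multiple of [v], so both are bounded. With probability [3 / 4], a drift beyond [8 * l] is
    impossible since [9 / 16 * 7 ^ 2 > 9 + 2 * 8]; then [v] is at most [4 / 3 * 25 * l ^+ 2]. *)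
Lemma iid_walk_bounds {R : realType} {I : finType} (q : I -> R)
    {H : normedModType R} (ip : H -> H -> R) (x : I -> H) (l : R) (n : nat) :
  is_inner_product ip ->
  (forall i, 0 <= q i) -> \sum_i q i = 1 -> 0 <= l ->
  (forall i, `|x i| <= 2 * l) ->
  3 / 4 <= stay_prob (fun=> q) (fun=> x) l n ->
  n%:R * `|\sum_i q i *: x i| <= 8 * l /\
  n%:R * (\sum_i q i * `|x i| ^+ 2) <= 36 * l ^+ 2.
Proof.
move=> hip q0 q1 l0 xl st.
have := walk_mean_le (p := fun=> q) (fun=> q0) (fun=> q1) hip (y := fun=> x) l0 (n := n).
have := walk_sqr_le (p := fun=> q) (fun=> q0) (fun=> q1) hip (y := fun=> x) l0 (fun=> xl) n.
rewrite /wmean /wsqr !sumr_const !card_ord.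
rewrite normrMn -!(mulr_natl `|_| n) -(mulr_natl (\sum_i _ * _) n).
set b := n%:R * `|_|; set v := n%:R * \sum__ _.
have b0 : 0 <= b by rewrite mulr_ge0.
have v0 : 0 <= v by rewrite mulr_ge0// sumr_ge0// => i _; rewrite mulr_ge0.
move: st; set P := stay_prob _ _ _ _ => st h1 h2.
have {}h1 : 3 / 4 * v <= 9 * l ^+ 2 + 2 * l * b.
  by apply: le_trans h1; apply: ler_wpM2r.
have b8 : b <= 8 * l.
  have [lb|] := leP l b; last by lra.
  have {}h2 : 3 / 4 * (b - l) ^+ 2 <= v.
    by apply: le_trans (h2 lb); apply: ler_wpM2r => //; exact: sqr_ge0.
  rewrite leNgt; apply/negP => b8.
  have [c c0 bE] : exists2 c, 0 < c & b = 8 * l + c.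
    by exists (b - 8 * l); [rewrite subr_gt0|rewrite addrC subrK].
  have lc : 0 <= l * c by rewrite mulr_ge0// ltW.
  have cc : 0 < c ^+ 2 by rewrite exprn_gt0.
  have ll := sqr_ge0 l.
  by move: h1 h2; rewrite bE => h1 h2; clear -h1 h2 lc cc ll; lra.
split => //; have lb := ler_wpM2l l0 b8; have ll := sqr_ge0 l.
by clear -h1 lb ll; lra.
Qed.

Lemma separable_dense_seq {R : realType} {H : normedModType R} :
  @separable_space R H ->
  exists x_ : nat -> H, forall y (e : R), 0 < e -> exists n, `|y - x_ n| < e.
Proof.
move=> [S [/countable_injP[f finj] Sd]].
exists (fun n => xget 0 [set z | S z /\ f z = n]) => y e e0.
have : closure S y by rewrite Sd.
move=> /(_ (ball y e) (nbhsx_ballx _ _ e0)) [z [Sz]].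
rewrite -ball_normE /= => yz; exists (f z).
have [] := @xgetPex _ 0 [set x | S x /\ f x = f z] (ex_intro _ z (conj Sz erefl)).
by set x := xget _ _ => Sx fx; rewrite (finj x z) ?inE.
Qed.

(** * Borel measurability of maps into a separable space *)

Section Hmeasurable.
Context {R : realType} {H : normedModType R}.
Context {d : measure_display} {T : measurableType d}.

Lemma borelH_open (U : set H) : open U -> borelH U.
Proof. by move=> oU; exact: sub_sigma_algebra. Qed.

Lemma Hmeasurable_comp_continuous (X : T -> H) (f : H -> R) :
  Hmeasurable X -> continuous f -> measurable_fun setT (f \o X).
Proof.
move=> mX /continuousP cf; apply: (measurability _ (RGenOpens.measurableE R)).
move=> _ [_ [a [b ->] <-]]; rewrite setTI comp_preimage.
by apply: mX; apply: borelH_open; apply: cf; exact: interval_open.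
Qed.

Lemma Hmeasurable_norm (X : T -> H) :
  Hmeasurable X -> measurable_fun setT (fun w => `|X w|).
Proof. by move=> mX; apply: (Hmeasurable_comp_continuous mX); exact: norm_continuous. Qed.

Lemma Hmeasurable_opens (X : T -> H) :
  (forall U : set H, open U -> measurable (X @^-1` U)) -> Hmeasurable X.
Proof.
move=> mX.
have : measurable_fun setT (X : T -> g_sigma_algebraType [set U : set H | open U]).
  apply: (@measurability _ _ T (g_sigma_algebraType [set U : set H | open U])
    setT X [set U : set H | open U]) => // _ [U oU <-].
  by rewrite setTI; exact: mX.
by move=> mX' B bB; rewrite -[_ @^-1` _]setTI; exact: mX'.
Qed.

Lemma borelH_preimage_continuous (g : H -> H) (B : set H) :
  continuous g -> borelH B -> borelH (g @^-1` B).
Proof.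
move=> /continuousP cg bB.
have : measurable_fun setT
    (g : g_sigma_algebraType [set U : set H | open U] ->
         g_sigma_algebraType [set U : set H | open U]).
  apply: (@measurability _ _ (g_sigma_algebraType [set U : set H | open U])
    (g_sigma_algebraType [set U : set H | open U]) setT g
    [set U : set H | open U]) => // _ [U oU <-].
  rewrite setTI.
  by apply: borelH_open; exact: cg.
by move=> mg; rewrite -[_ @^-1` _]setTI; exact: (mg measurableT B bB).
Qed.

Lemma borelHC (B : set H) : borelH B -> borelH (~` B).
Proof.
exact: (@measurableC _ (g_sigma_algebraType [set U : set H | open U])).
Qed.

Lemma borelHI (B C : set H) : borelH B -> borelH C -> borelH (B `&` C).
Proof.
exact: (@measurableI _ (g_sigma_algebraType [set U : set H | open U])).
Qed.

Lemma borelHU (B C : set H) : borelH B -> borelH C -> borelH (B `|` C).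
Proof.
exact: (@measurableU _ (g_sigma_algebraType [set U : set H | open U])).
Qed.

Lemma borelH0 : borelH (set0 : set H).
Proof.
exact: (@measurable0 _ (g_sigma_algebraType [set U : set H | open U])).
Qed.

Context (ip : H -> H -> R) (hip : is_inner_product ip).

Lemma Hmeasurable_ip (X : T -> H) y :
  Hmeasurable X -> measurable_fun setT (fun w => ip (X w) y).
Proof. 
move=> mX; apply: (@Hmeasurable_comp_continuous X (ip ^~ y) mX).
exact: (ip_continuousl hip).
Qed.

Context (x_ : nat -> H)
  (x_dense : forall y (e : R), 0 < e -> exists n, `|y - x_ n| < e).

(** The norm is the limit of the norms of the projections, and each of these depends on finitely
    many coordinates. *)
Lemma weakly_measurable_norm (X : T -> H) :
  (forall y, measurable_fun setT (fun w => ip (X w) y)) ->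
  measurable_fun setT (fun w => `|X w|).
Proof.
move=> mX.
have -> : (fun w => `|X w|) = Num.sqrt \o (fun w => `|X w| ^+ 2).
  by apply/funext => w /=; rewrite sqrtr_sqr normr_id.
apply: measurableT_comp.
  apply: continuous_measurable_fun; exact: sqrt_continuous.
apply: (@measurable_fun_cvg _ _ _ _ (fun n w => `|ortho_proj ip x_ n (X w)| ^+ 2)).
  move=> n.
  under eq_fun do rewrite (sqr_norm_ortho_proj hip).
  by apply: measurable_sum => i; exact: measurable_funX.
move=> w _; rewrite expr2; under eq_fun do rewrite expr2.
by apply: cvgM; apply: cvg_norm; exact: (cvg_ortho_proj hip).
Qed.

(** Pettis' theorem: by separability an open set is a countable union of balls centred at the
    [x_ i], and the preimage of a ball is described by a norm. *)
Lemma weakly_measurable_Hmeasurable (X : T -> H) :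
  (forall y, measurable_fun setT (fun w => ip (X w) y)) -> Hmeasurable X.
Proof.
move=> mX; apply: Hmeasurable_opens => U oU.
pose B (i k : nat) := ball (x_ i) (k.+1%:R^-1 : R).
have -> : X @^-1` U =
   \bigcup_i \bigcup_(k in [set k | B i k `<=` U]) (X @^-1` B i k).
  apply/seteqP; split => [w /= Uw|w [i _ [k /= BU Bw]]]; last exact: BU.
  have /nbhs_ballP[e /= e0 eU] := open_nbhs_nbhs (conj oU Uw).
  have [k ke] : exists k, k.+1%:R^-1 < e / 2 :> R.
    have /cvgr_lt/(_ (e / 2)) := @cvg_harmonic R.
    by case; rewrite ?divr_gt0// => N _ /(_ N (leqnn _)) h; exists N.
  have k0 : 0 < k.+1%:R^-1 :> R by rewrite invr_gt0.
  have [i xi] := x_dense (X w) k0.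
  exists i => //; exists k; last by rewrite /B -ball_normE /= distrC.
  move=> z; rewrite /B -ball_normE /= => xz; apply: eU.
  rewrite -ball_normE /=.
  rewrite (le_lt_trans (ler_distD (x_ i) _ _))// [e]splitr ltrD//.
    exact: lt_trans xi ke.
  exact: lt_trans xz ke.
apply: bigcup_measurable => i _; apply: bigcup_measurable => k _.
have -> : X @^-1` B i k = setT `&` (fun w => `|X w - x_ i|) @^-1` `]-oo, k.+1%:R^-1[.
  by apply/seteqP; split => w /=; rewrite /B -ball_normE /= in_itv /= distrC; [split|case].
apply: (weakly_measurable_norm (X := fun w => X w - x_ i)) => // y.
under eq_fun do rewrite (ipBl hip).
exact: measurable_funB.
Qed.

End Hmeasurable.

(** * From independent events to product expectations *)

Section independent_history.
Context {R : realType} {I : finType}.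
Context {d : measure_display} {Omega : measurableType d} (P : probability Omega R).
Variable kap : nat -> Omega -> I.
Hypothesis mkap : forall k i, measurable [set w | kap k w = i].

Definition out_prob k i : R := fine (P [set w | kap k w = i]).

Lemma out_probE k i : (out_prob k i)%:E = P [set w | kap k w = i].
Proof. by rewrite /out_prob fineK// fin_num_measure. Qed.

Lemma out_prob_ge0 k i : 0 <= out_prob k i.
Proof. by rewrite fine_ge0. Qed.

Lemma fun_out_indic k i : (fun w => (kap k w == i)%:R : R) = \1_[set w | kap k w = i].
Proof.
apply/funext => w; rewrite indicE.
by case: eqP => h; [rewrite mem_set|rewrite memNset].
Qed.

Lemma measurable_fun_out k i : measurable_fun setT (fun w => (kap k w == i)%:R : R).
Proof.
by rewrite fun_out_indic; exact: measurable_indic.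
Qed.

Lemma out_prob_sum1 k : \sum_i out_prob k i = 1.
Proof.
apply: EFin_inj; rewrite -sumEFin.
transitivity (\sum_i \int[P]_w ((kap k w == i)%:R%:E : \bar R))%E.
  apply: eq_bigr => i _; rewrite out_probE -[X in P X]setIT -integral_indic//.
  by apply: eq_integral => w _; rewrite -fun_out_indic.
rewrite -ge0_integral_sum//; last by move=> i; exact/measurable_EFinP/measurable_fun_out.
transitivity (\int[P]_w (cst 1%E) w)%E; last first.
  by rewrite integral_cst// mul1e; exact: probability_setT.
apply: eq_integral => w _; rewrite sumEFin (bigD1 (kap k w))//= eqxx big1 ?addr0// => i.
by rewrite eq_sym => /negbTE ->.
Qed.

Fixpoint history (n : nat) (w : Omega) : seq I :=
  if n is m.+1 then kap m w :: history m w else [::].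

Lemma size_history n w : size (history n w) = n.
Proof. by elim: n => //= n ->. Qed.

Lemma walk_history {H : normedModType R} (y : nat -> I -> H) n w :
  walk y (history n w) = \sum_(k < n) y k (kap k w).
Proof.
by elim: n => [|n ih] /=; [rewrite big_ord0|rewrite big_ord_recr /= ih size_history].
Qed.

Lemma historyS_sum n (F : seq I -> R) w :
  F (history n.+1 w) = \sum_i (kap n w == i)%:R * F (i :: history n w).
Proof.
rewrite (bigD1 (kap n w))//= eqxx mul1r big1 ?addr0// => i /negbTE.
by rewrite eq_sym => ->; rewrite mul0r.
Qed.

Lemma measurable_fun_history n (F : seq I -> R) :
  measurable_fun setT (fun w => F (history n w)).
Proof.
elim: n F => [|n ih] F; first by apply: measurable_cst (F [::]).
under eq_fun do rewrite historyS_sum.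
apply: measurable_sum => i; apply: measurable_funM; first exact: measurable_fun_out.
exact: (ih (fun v => F (i :: v))).
Qed.

Variable n : nat.
Hypothesis indep : forall v : nat -> I,
  P (\bigcap_(k < n) [set w | kap k w = v k]) =
  (\prod_(k < n) P [set w | kap k w = v k])%E.

Local Notation tail v j w := (\prod_(j <= k < n) (kap k w == v k)%:R).

Lemma measurable_fun_tail v j : measurable_fun setT (fun w => tail v j w : R).
Proof. by apply: measurable_prod => k _; exact: measurable_fun_out. Qed.

(** The statement mixes a function of the first [j] outcomes with prescribed values for the others,
    so that induction on [j] can move one outcome at a time from the first group to the second. At
    [j = 0] only the assumed independence of events remains. *)
Lemma integral_history_tail j (F : seq I -> R) (v : nat -> I) :
  (j <= n)%N -> (forall u, 0 <= F u) ->
  (\int[P]_w (F (history j w) * tail v j w)%:E =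
  (prod_expect out_prob j F * \prod_(j <= k < n) out_prob k (v k))%:E)%E.
Proof.
elim: j F v => [|j ih] F v jn F0.
  have tE w : tail v 0 w = \1_(\bigcap_(k < n) [set w | kap k w = v k]) w :> R.
    rewrite indicE big_mkord; case: (boolP (w \in _)) => [|/negP] hw.
      by apply: big1 => k _; have /= -> := set_mem hw k (ltn_ord k); rewrite eqxx.
    have [k kn vk] : exists2 k, (k < n)%N & kap k w != v k.
      apply: contrapT => h; apply: hw; apply/mem_set => k /= kn.
      by apply: contrapT => /eqP vk; apply: h; exists k.
    by rewrite (bigD1 (Ordinal kn))//= (negbTE vk) mul0r.
  under eq_integral do rewrite /= tE EFinM.
  rewrite ge0_integralZl//; last 2 first.
  - by apply/measurable_EFinP/measurable_indic; exact: bigcap_measurableType.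
  - by rewrite lee_fin.
  rewrite integral_indic//; last by apply: bigcap_measurableType.
  rewrite setIT /= EFinM; congr (_ * _)%E; rewrite [LHS]indep.
  rewrite big_mkord -prodEFin; apply: eq_bigr => k _.
  by rewrite out_probE.
(* Summing over the value [i] of outcome [j] makes it part of the prescribed tail. *)
transitivity (\sum_i \int[P]_w
    (F (i :: history j w) * tail (fun k => if k == j then i else v k) j w)%:E)%E.
  rewrite -ge0_integral_sum//; last 2 first.
  - move=> i; apply/measurable_EFinP/measurable_funM; last exact: measurable_fun_tail.
    exact: (measurable_fun_history j (fun u => F (i :: u))).
  - by move=> i w _; rewrite lee_fin mulr_ge0// prodr_ge0.
  apply: eq_integral => w _; rewrite sumEFin; congr EFin.
  rewrite historyS_sum mulr_suml; apply: eq_bigr => i _.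
  rewrite [in RHS]big_ltn// eqxx mulrA; congr (_ * _); first by rewrite mulrC.
  apply: eq_big_nat => k /andP[jk _].
  by rewrite gtn_eqF.
transitivity (\sum_i (out_prob j i * prod_expect out_prob j (fun u => F (i :: u)) *
    \prod_(j.+1 <= k < n) out_prob k (v k))%:E)%E; last first.
  rewrite sumEFin -mulr_suml; congr (_ * _)%:E; symmetry.
  exact: (prod_expect_sum out_prob_ge0 out_prob_sum1).
apply: eq_bigr => i _.
rewrite (ih (fun u => F (i :: u)) (fun k => if k == j then i else v k)) ?(ltnW jn)//.
congr EFin; rewrite big_ltn// eqxx mulrA (mulrC (out_prob j i)); congr (_ * _).
by apply: eq_big_nat => k /andP[jk _]; rewrite gtn_eqF.
Qed.

Lemma integral_history (F : seq I -> R) : (forall u, 0 <= F u) ->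
  (\int[P]_w (F (history n w))%:E = (prod_expect out_prob n F)%:E)%E.
Proof.
move=> F0; have := integral_history_tail (fun k => kap k point) (leqnn n) F0.
by rewrite big_geq// mulr1 => <-; apply: eq_integral => w _; rewrite big_geq// mulr1.
Qed.

End independent_history.

Lemma cvg_sum_seq {R : realType} {V : normedModType R} {T : Type}
    (F : set_system T) {FF : Filter F} I (s : seq I) (f : I -> T -> V) (l : I -> V) :
  (forall i, f i x @[x --> F] --> l i) ->
  \sum_(i <- s) f i x @[x --> F] --> \sum_(i <- s) l i.
Proof.
move=> fl; elim: s => [|i s ih].
  by rewrite big_nil; under eq_fun do rewrite big_nil; exact: cvg_cst.
by rewrite big_cons; under eq_fun do rewrite big_cons; exact: cvgD.
Qed.

Section measure_limits.
Context {R : realType} {d : measure_display} {T : measurableType d}.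

Lemma fatou_cvg_le (mu : {measure set T -> \bar R}) (D : set T)
    (f_ : nat -> T -> \bar R) (f : T -> \bar R) (C : \bar R) :
  measurable D -> (forall n, measurable_fun D (f_ n)) ->
  (forall n x, D x -> (0 <= f_ n x)%E) ->
  (forall x, D x -> f_ ^~ x @ \oo --> f x) ->
  (exists N, forall n, (N <= n)%N -> (\int[mu]_(x in D) f_ n x <= C)%E) ->
  (\int[mu]_(x in D) f x <= C)%E.
Proof.
move=> mD mf f0 ff [N fC].
rewrite (_ : (\int[mu]_(x in D) f x = \int[mu]_(x in D) limn_einf (f_ ^~ x))%E); last first.
  apply: eq_integral => x; rewrite inE => Dx.
  by rewrite is_cvg_limn_einfE; [exact/esym/cvg_lim/ff|apply/cvg_ex; eexists; exact: ff].
apply: (le_trans (fatou mu mD mf f0)).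
rewrite limn_einf_lim; apply: lime_le; first exact: is_cvg_einfs.
near=> n; apply: (le_trans _ (fC n _)); last by near: n; exists N.
by apply: ereal_inf_lbound; exists n => //=.
Unshelve. all: by end_near. Qed.

Lemma nondecreasing_prob_gt (P : probability T R) (E : nat -> set T) (G : set T) (c : R) :
  (forall n, measurable (E n)) -> measurable G ->
  (forall n, E n `<=` E n.+1) -> G `<=` \bigcup_n E n -> (c%:E < P G)%E ->
  exists N, forall n, (N <= n)%N -> (c%:E < P (E n))%E.
Proof.
move=> mE mG ndE GE cG.
have ndE' : nondecreasing_seq E.
  by apply/nondecreasing_seqP => n; exact/subsetPset.
have mU : measurable (\bigcup_n E n) by exact: bigcupT_measurable.
have cU : (c%:E < P (\bigcup_n E n))%E.
  by apply: (lt_le_trans cG); apply: le_measure; rewrite ?inE.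
have cvE := nondecreasing_cvg_mu (mu := P) mE mU ndE'.
have [N cN] : exists N, (c%:E < P (E N))%E.
  apply: contrapT => h; move: cU; rewrite ltNge => /negP; apply.
  rewrite -(cvg_lim (@ereal_hausdorff R) cvE); apply: lime_le.
    by apply/cvg_ex; eexists; exact: cvE.
  by apply: nearW => n /=; rewrite leNgt; apply/negP => cn; apply: h; exists n.
exists N => n Nn; apply: (lt_le_trans cN); apply: le_measure; rewrite ?inE//.
exact/subsetPset/ndE'.
Qed.

End measure_limits.

(** * Discretization of the space by finite nets *)

Section nearest_point.
Context {R : realType} {H : normedModType R} (x_ : nat -> H).

(** Including the origin ensures that a nearest net point is at distance at most [|x|] from [x],
    hence has norm at most [2 * |x|]. *)
Definition net_point (i : nat) : H := if i is k.+1 then x_ k else 0.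

(* Index of a point of 0, x_0, ..., x_(j-1) nearest to [x]. *)
Fixpoint nearest (j : nat) (x : H) : nat :=
  if j is k.+1 then
    if `|x - x_ k| < `|x - net_point (nearest k x)| then k.+1 else nearest k x
  else 0.

Local Notation dist j x := (`|x - net_point (nearest j x)|).

Lemma nearest_le j x : (nearest j x <= j)%N.
Proof.
elim: j => //= j ih; case: ifP => // _; exact: leqW.
Qed.

Lemma nearest_distS j x : dist j.+1 x <= dist j x.
Proof. by rewrite /=; case: ifPn => // /ltW. Qed.

Lemma nearest_dist_anti i j x : (i <= j)%N -> dist j x <= dist i x.
Proof.
elim: j => [|j ih]; first by rewrite leqn0 => /eqP ->.
rewrite leq_eqVlt => /orP[/eqP ->//|/ih]; apply: le_trans.
exact: nearest_distS.
Qed.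

Lemma nearest_dist_norm j x : dist j x <= `|x|.
Proof. by have := nearest_dist_anti x (leq0n j); rewrite /= subr0. Qed.

Lemma nearest_dist_le j x : dist j.+1 x <= `|x - x_ j|.
Proof. by rewrite /=; case: ifPn => //; rewrite -leNgt. Qed.

Lemma borelH_dist_lt (a b : H) : borelH [set x | `|x - a| < `|x - b|].
Proof.
apply: borelH_open.
have -> : [set x | `|x - a| < `|x - b|] = (fun x => `|x - a| - `|x - b|) @^-1` [set r | r < 0].
  by apply/seteqP; split => x /=; rewrite subr_lt0.
apply: open_comp; last exact: open_lt.
move=> x _; apply: cvgB; apply: cvg_norm; apply: cvgB; by [exact: cvg_id|exact: cvg_cst].
Qed.

Lemma borelHT : borelH (setT : set H).
Proof. by rewrite -setC0; apply: borelHC; exact: borelH0. Qed.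

Lemma borelH_nearest j i : borelH [set x | nearest j x = i].
Proof.
elim: j i => [|j ih] i /=.
  case: i => [|i].
    by rewrite (_ : mkset _ = setT); [exact: borelHT|apply/seteqP; split].
  by rewrite (_ : mkset _ = set0); [exact: borelH0|apply/seteqP; split].
have step k : borelH [set x | nearest j x = k /\
    (if `|x - x_ j| < `|x - net_point k| then j.+1 else k) = i].
  rewrite (_ : mkset _ = [set x | nearest j x = k] `&`
     ([set x | `|x - x_ j| < `|x - net_point k|] `&` [set _ | j.+1 = i] `|`
      ~` [set x | `|x - x_ j| < `|x - net_point k|] `&` [set _ | k = i])).
    have cst (Q : Prop) : borelH [set _ : H | Q].
      have [q|q] := pselect Q.
        by rewrite (_ : mkset _ = setT); [exact: borelHT|apply/seteqP; split].
      by rewrite (_ : mkset _ = set0); [exact: borelH0|apply/seteqP; split].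
    apply: borelHI; first exact: ih.
    apply: borelHU; (apply: borelHI; last exact: cst).
    - exact: borelH_dist_lt.
    - by apply: borelHC; exact: borelH_dist_lt.
  apply/seteqP; split => [x /= [nk]|x /= [nk [[->//]|[/negP/negbTE -> //]]]].
  by case: ifPn => [a <-|/negP b <-]; split => //; [left|right].
rewrite (_ : mkset _ = \bigcup_(k in setT) [set x | nearest j x = k /\
    (if `|x - x_ j| < `|x - net_point k| then j.+1 else k) = i]).
  exact: (@bigcupT_measurable _ (g_sigma_algebraType [set U : set H | open U])).
apply/seteqP; split => [x /= h|x [k _ /= [<-]]//].
by exists (nearest j x).
Qed.

Lemma borelH_nearest_dist j (e : R) : borelH [set x | dist j x <= e].
Proof.
rewrite (_ : mkset _ = \bigcup_(k in setT) ([set x | nearest j x = k] `&`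
    ~` [set x | e < `|x - net_point k|])).
  apply: (@bigcupT_measurable _ (g_sigma_algebraType [set U : set H | open U])) => k.
  apply: borelHI; [exact: borelH_nearest|apply: borelHC; apply: borelH_open].
  rewrite (_ : mkset _ = (fun x : H => `|x - net_point k|) @^-1` [set r | e < r])//.
  apply: open_comp; last exact: open_gt.
  by move=> x _; apply: cvg_norm; apply: cvgB; [exact: cvg_id|exact: cvg_cst].
apply/seteqP; split => [x /= h|x [k _ /= [-> /negP]]]; last by rewrite -leNgt.
by exists (nearest j x) => //=; split => //; apply/negP; rewrite -leNgt.
Qed.

Hypothesis x_dense : forall y (e : R), 0 < e -> exists n, `|y - x_ n| < e.

Lemma nearest_dist_lt x (e : R) : 0 < e -> exists J, forall j, (J <= j)%N -> dist j x < e.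
Proof.
move=> e0; have [n xn] := x_dense x e0; exists n.+1 => j nj.
apply: le_lt_trans (nearest_dist_anti x nj) _.
exact: le_lt_trans (nearest_dist_le n x) xn.
Qed.

Variable lam : R.
Hypothesis lam_ge0 : 0 <= lam.

(** The threshold [2 * lam] is the size of an increment of a path bounded by [lam]; anything larger
    is sent to the index of the origin. *)
Definition disc j (x : H) : 'I_j.+1 :=
  if `|x| <= 2 * lam then inord (nearest j x) else ord0.

(** The guard makes the bound hold at every index, including those that [disc] never takes; by
    [disc_valE] it does nothing on vectors of norm at most [2 * lam]. *)
Definition disc_val j (i : 'I_j.+1) : H :=
  if `|net_point i| <= 2 * (2 * lam) then net_point i else 0.

Lemma disc_val_le j i : `|@disc_val j i| <= 2 * (2 * lam).
Proof. by rewrite /disc_val; case: ifPn => // _; rewrite normr0 !mulr_ge0. Qed.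

Lemma disc_valE j x : `|x| <= 2 * lam ->
  disc_val (disc j x) = net_point (nearest j x).
Proof.
move=> xl; rewrite /disc xl /disc_val inordK; last by rewrite ltnS nearest_le.
case: ifPn => //; rewrite -ltNge => h.
have := nearest_dist_norm j x; rewrite distrC => h1.
exfalso; have := ler_normD (net_point (nearest j x) - x) x; rewrite subrK; lra.
Qed.

Lemma borelH_disc j i : borelH [set x | disc j x = i].
Proof.
have bl : borelH [set x : H | `|x| <= 2 * lam].
  rewrite (_ : mkset _ = ~` [set x : H | 2 * lam < `|x|]).
    apply: borelHC; apply: borelH_open.
    rewrite (_ : mkset _ = (fun x : H => `|x|) @^-1` [set r | 2 * lam < r])//.
    apply: open_comp; first by move=> x _; exact: norm_continuous.
    exact: open_gt.
  by apply/seteqP; split => x /=; rewrite leNgt; [move=> /negP|move=> /negP].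
rewrite (_ : mkset _ = ([set x : H | `|x| <= 2 * lam] `&` [set x | nearest j x = i]) `|`
   (~` [set x : H | `|x| <= 2 * lam] `&` [set _ | i = ord0])).
  apply: borelHU; apply: borelHI => //; [exact: borelH_nearest|exact: borelHC|].
  have [->|i0] := eqVneq i ord0.
    by rewrite (_ : mkset _ = setT); [exact: borelHT|apply/seteqP; split].
  by rewrite (_ : mkset _ = set0); [exact: borelH0|apply/seteqP; split => x //= /eqP; exact/negP].
apply/seteqP; split => x /=; rewrite /disc.
  case: ifPn => xl <-; last by right; split => //; exact/negP.
  by left; rewrite inordK// ltnS nearest_le.
move=> [[-> ni]|[/negP/negbTE -> ->//]].
by apply/val_inj; rewrite /= inordK// ltnS nearest_le.
Qed.

End nearest_point.

Section linear_maps.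
Context {R : realType} {H : normedModType R} (B : H -> H).
Hypothesis linB : forall c x y, B (c *: x + y) = c *: B x + B y.

Lemma lin_map0 : B 0 = 0.
Proof. by have := linB (-1) 0 0; rewrite scaler0 addr0 scaleN1r addNr. Qed.

Lemma lin_mapD x y : B (x + y) = B x + B y.
Proof. by have := linB 1 x y; rewrite !scale1r. Qed.

Lemma lin_mapZ c x : B (c *: x) = c *: B x.
Proof. by have := linB c x 0; rewrite lin_map0 !addr0. Qed.

Lemma lin_mapB x y : B (x - y) = B x - B y.
Proof. by rewrite -scaleN1r addrC linB scaleN1r addrC. Qed.

Lemma lin_map_sum I (s : seq I) (Q : pred I) (f : I -> H) :
  B (\sum_(i <- s | Q i) f i) = \sum_(i <- s | Q i) B (f i).
Proof. exact: (big_morph B lin_mapD lin_map0). Qed.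

End linear_maps.

(** * Second moments of sums of increments on the bounded event *)

Section second_moment.
Context {R : realType} {H : normedModType R} (ip : H -> H -> R).
Hypothesis hip : is_inner_product ip.
Context (x_ : nat -> H)
  (x_dense : forall y (e : R), 0 < e -> exists n, `|y - x_ n| < e).
Context {d : measure_display} {Omega : measurableType d} (P : probability Omega R).
Variables (X : R -> Omega -> H) (Tm lam : R) (G : set Omega).
Hypotheses (Tm_gt0 : 0 < Tm) (lam_gt0 : 0 < lam).
Hypothesis X0 : forall w, X 0 w = 0.
Hypothesis mX : forall s t, 0 <= s -> 0 <= t -> Hmeasurable (fun w => X t w - X s w).
Hypothesis indX : independent_increments P X.
Hypothesis statX : stationary_increments P X.
Hypothesis mG : measurable G.
Hypothesis PG : ((7 / 8)%:E <= P G)%E.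
Hypothesis GX : forall w, G w -> forall s, 0 <= s <= Tm -> `|X s w| <= lam.

Let lam_ge0 : 0 <= lam. Proof. exact: ltW. Qed.
Let l2_ge0 : 0 <= 2 * lam. Proof. by rewrite mulr_ge0. Qed.

Definition incr_disc (r : nat -> R) j k w : 'I_j.+1 :=
  disc x_ lam j (X (r k.+1) w - X (r k) w).

Definition disc_law h j (i : 'I_j.+1) : R := fine (P [set w | disc x_ lam j (X h w) = i]).

Definition disc_mean h j := \sum_i disc_law h i *: disc_val x_ lam (i : 'I_j.+1).
Definition disc_sqr h j := \sum_i disc_law h i * `|disc_val x_ lam (i : 'I_j.+1)| ^+ 2.

Lemma measurable_incr_disc r j : (forall k, 0 <= r k) ->
  forall k i, measurable [set w | incr_disc r j k w = i].
Proof.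
by move=> r0 k i; exact: (mX (r0 k) (r0 k.+1) (borelH_disc x_ lam i)).
Qed.

Lemma incr_disc_indep r j n : 0 <= r 0%N ->
  (forall k, (k < n)%N -> r k < r k.+1) -> forall v : nat -> 'I_j.+1,
  P (\bigcap_(k < n) [set w | incr_disc r j k w = v k]) =
  (\prod_(k < n) P [set w | incr_disc r j k w = v k])%E.
Proof.
move=> r0 rS v.
exact: (indX r0 rS (fun k => borelH_disc x_ lam (v k))).
Qed.

Lemma incr_disc_law r j k i : 0 <= r k -> r k <= r k.+1 ->
  out_prob P (incr_disc r j) k i = disc_law (r k.+1 - r k) i.
Proof.
move=> rk rkS; rewrite /out_prob /disc_law; congr fine.
exact: (statX rk rkS (borelH_disc x_ lam i)).
Qed.

Lemma incr_le s t w : G w -> 0 <= s <= Tm -> 0 <= t <= Tm ->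
  `|X t w - X s w| <= 2 * lam.
Proof.
move=> Gw sT tT; have := ler_normB (X t w) (X s w).
have := GX Gw sT; have := GX Gw tT; lra.
Qed.

(** As the net is refined, the events on which all [n] errors are at most [e] increase to [G]; since
    [P G] is at least [7 / 8], they eventually have probability above [3 / 4]. *)
Lemma disc_good r n (e : R) : 0 < e -> (forall k, 0 <= r k) ->
  (forall k, (k <= n)%N -> r k <= Tm) ->
  exists J, forall j, (J <= j)%N -> exists E, [/\ measurable E, E `<=` G,
    ((3 / 4)%:E < P E)%E & forall w, E w -> forall k, (k < n)%N ->
    `|X (r k.+1) w - X (r k) w - disc_val x_ lam (incr_disc r j k w)| <= e].
Proof.
move=> e0 r0 rT; pose Dk k w := X (r k.+1) w - X (r k) w.
pose E j := G `&` \bigcap_(k < n)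
  [set w | `|Dk k w - net_point x_ (nearest x_ j (Dk k w))| <= e].
have mE j : measurable (E j).
  apply: measurableI => //; apply: bigcap_measurableType => // k _.
  exact: (mX (r0 k) (r0 k.+1) (borelH_nearest_dist x_ j e)).
have [J hJ] : exists N, forall j, (N <= j)%N -> ((3 / 4)%:E < P (E j))%E.
  apply: (nondecreasing_prob_gt (G := G)) => //.
  - move=> j w [Gw h]; split => // k kn /=.
    by apply: le_trans (h k kn); exact: nearest_distS.
  - move=> w Gw.
    have /choice[f hf] : forall k, exists J, forall j, (J <= j)%N ->
        `|Dk k w - net_point x_ (nearest x_ j (Dk k w))| < e.
      by move=> k; exact: nearest_dist_lt.
    exists (\max_(k < n) f k)%N => //; split => // k kn /=; apply/ltW/hf.
    exact: (leq_bigmax (Ordinal kn)).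
  - by apply: lt_le_trans PG; rewrite lte_fin; lra.
exists J => j Jj; exists (E j); split => //.
- by move=> w [].
- exact: hJ.
- move=> w [Gw h] k kn.
  by rewrite disc_valE ?incr_le ?r0 ?rT// 1?ltnW//; exact: h.
Qed.

Lemma uniform_moments h n : 0 < h -> (0 < n)%N -> n%:R * h <= Tm ->
  exists J, forall j, (J <= j)%N ->
    n%:R * `|disc_mean h j| <= 16 * lam /\
    n%:R * disc_sqr h j <= 144 * lam ^+ 2.
Proof.
move=> h0 n0 nhT.
pose r k : R := k%:R * h.
have r0 k : 0 <= r k by rewrite /r mulr_ge0 ?(ltW h0).
have rT k : (k <= n)%N -> r k <= Tm.
  by move=> kn; apply: le_trans nhT; rewrite /r ler_pM2r// ler_nat.
have rS k : r k < r k.+1 by rewrite /r ltr_pM2r// ltr_nat.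
have n0' : 0 < n%:R :> R by rewrite ltr0n.
(* With this accuracy the [n] errors add up to at most [lam], so on [E] the discretized walk stays
   within [2 * lam]. *)
have e0 : 0 < lam / n%:R by rewrite divr_gt0.
have [J hJ] := disc_good e0 r0 rT.
exists J => j /hJ[E [mE EG PE hE]].
pose kap := incr_disc r j.
have mkap := @measurable_incr_disc r j r0.
have ind := @incr_disc_indep r j n (r0 0%N) (fun k _ => rS k).
have lawE : out_prob P kap = fun=> (fun i => disc_law h i).
  apply/funext => k; apply/funext => i; rewrite incr_disc_law// 1?ltW//.
  by congr (disc_law _ i); rewrite /r -mulrBl -natrB// subSnn mul1r.
have walk_le m w : E w -> (m <= n)%N ->
    `|walk (fun=> @disc_val _ _ x_ lam j) (history kap m w)| <= 2 * lam.
  move=> Ew mn; rewrite walk_history.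
  have Xr : X (r m) w = \sum_(k < m) (X (r k.+1) w - X (r k) w).
    by rewrite -(big_mkord predT (fun k => X (r k.+1) w - X (r k) w))
      telescope_sumr// /r mul0r X0 subr0.
  have -> : \sum_(k < m) disc_val x_ lam (kap k w) = X (r m) w -
      \sum_(k < m) (X (r k.+1) w - X (r k) w - disc_val x_ lam (kap k w)).
    by rewrite Xr -sumrB; apply: eq_bigr => k _; rewrite opprB addrC subrK.
  apply: (le_trans (ler_normB _ _)).
  have h1 : `|X (r m) w| <= lam by apply: GX; rewrite ?r0 ?rT//; exact: EG.
  apply: (le_trans (lerD h1 (ler_norm_sum _ _ _))).
  have : \sum_(k < m) `|X (r k.+1) w - X (r k) w - disc_val x_ lam (kap k w)| <=
      \sum_(k < m) lam / n%:R.
    by apply: ler_sum => k _; apply: hE => //; exact: leq_trans (ltn_ord k) mn.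
  rewrite sumr_const card_ord => h2; apply: (le_trans (lerD (lexx _) h2)).
  have h3 : lam / n%:R *+ m <= lam.
    rewrite -mulr_natr mulrAC ler_pdivrMr// ler_pM2l// ler_nat//.
  lra.
have stays w : E w -> forall m, (m <= n)%N ->
    walk_stays (fun=> @disc_val _ _ x_ lam j) (2 * lam) (history kap m w).
  move=> Ew; elim=> [//|m ih] mn.
  by rewrite /= (ih (ltnW mn)) /=; exact: (walk_le m.+1 w Ew mn).
(* Taking [2 * lam] as the radius turns the constants 8 and 36 into 16 and 144. *)
have := @iid_walk_bounds R _ (fun i => disc_law h i) H ip (@disc_val _ _ x_ lam j) (2 * lam) n hip.
case.
- by move=> i; rewrite fine_ge0.
- by rewrite -[RHS](out_prob_sum1 P mkap 0%N) -/kap lawE.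
- exact: l2_ge0.
- exact: disc_val_le.
- rewrite /stay_prob -lawE -lee_fin -integral_history//.
  apply: (le_trans (ltW PE)).
  rewrite -[E]setIT -integral_indic//; apply: ge0_le_integral => //.
  - exact/measurable_EFinP/measurable_indic.
  - apply/measurable_EFinP; exact: (measurable_fun_history mkap n (fun u => (walk_stays _ _ u)%:R)).
  - move=> w _; rewrite lee_fin indicE; case: (boolP (w \in E)) => // /set_mem Ew.
    by rewrite (stays w Ew n (leqnn n)).
rewrite -/(disc_mean h j) -/(disc_sqr h j) => h1 h2; split; lra.
Qed.

(** The step [h] fits [n] times into the horizon, where [n] is the integer part of [Tm / h]. As
    [n >= 1], [Tm <= 2 * n * h], so dividing the bounds of [uniform_moments] by [n] doubles their
    constants. *)
Lemma short_incr_moments h : 0 < h -> h <= Tm ->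
  exists J, forall j, (J <= j)%N ->
    `|disc_mean h j| <= 32 * lam / Tm * h /\
    disc_sqr h j <= 288 * lam ^+ 2 / Tm * h.
Proof.
move=> h0 hT; pose n := Num.truncn (Tm / h).
have q0 : 0 <= Tm / h by rewrite divr_ge0// ltW.
have /andP[nle ngt] := truncn_itv q0.
have n1 : (0 < n)%N by rewrite /n truncn_gt0 ler_pdivlMr// mul1r.
have n1' : 1 <= n%:R :> R by rewrite ler1n.
have nh : n%:R * h <= Tm by rewrite -ler_pdivlMr.
have T2 : Tm <= 2 * n%:R * h.
  rewrite -ler_pdivrMr//; apply: (le_trans (ltW ngt)); rewrite -natr1; lra.
have [J hJ] := uniform_moments h0 n1 nh.
have key (u c : R) : 0 <= u -> n%:R * u <= c -> u <= 2 * c / Tm * h.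
  move=> u0 uc; rewrite mulrAC ler_pdivlMr//.
  apply: (le_trans (ler_wpM2l u0 T2)).
  have := ler_wpM2r (ltW h0) uc; lra.
exists J => j /hJ[h1 h2]; split.
  by apply: (le_trans (key _ _ _ h1)) => //; rewrite mulrA -natrM.
apply: (le_trans (key _ _ _ h2)); last by rewrite mulrA -natrM.
by apply: sumr_ge0 => i _; rewrite mulr_ge0// fine_ge0.
Qed.

(** Mean and second moment of a truncated increment are linear in the length of its step, so their
    sums are governed by the total length, at most [Tm]; neither the number of steps nor the mesh
    enters the constant. *)
Lemma second_moment_bound (r : nat -> R) n (B : nat -> H -> H) (M : R) :
  0 <= r 0%N -> (forall k, (k < n)%N -> r k < r k.+1) -> r n <= Tm -> 0 <= M ->
  (forall k, (k < n)%N -> forall c x y, B k (c *: x + y) = c *: B k x + B k y) ->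
  (forall k, (k < n)%N -> forall x, `|B k x| <= M * `|x|) ->
  (\int[P]_(w in G) (`|\sum_(k < n) B k (X (r k.+1) w - X (r k) w)| ^+ 2)%:E <=
   (2624 * (M * lam) ^+ 2)%:E)%E.
Proof.
move=> r0 rS rn M0 linB leB.
have rmono i j : (i <= j)%N -> (j <= n)%N -> r i <= r j.
  move=> + jn; elim: j jn => [|j ih] jn; first by rewrite leqn0 => /eqP ->.
  rewrite leq_eqVlt => /orP[/eqP -> //|ij].
  exact: le_trans (ih (ltnW jn) ij) (ltW (rS _ jn)).
have rk0 k : (k <= n)%N -> 0 <= r k.
  by move=> kn; apply: le_trans r0 _; exact: rmono.
have rkT k : (k <= n)%N -> r k <= Tm.
  by move=> kn; apply: le_trans rn; exact: rmono.
(* Measurability of the outcomes is required for every [k]; freezing the index at [n] keeps all the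
   times nonnegative. *)
pose r' k := r (minn k n).
have r'E k : (k <= n)%N -> r' k = r k by move=> kn; rewrite /r' (minn_idPl kn).
have r'0 k : 0 <= r' k by apply: rk0; exact: geq_minr.
pose h k := r k.+1 - r k.
have h_gt0 k : (k < n)%N -> 0 < h k by move=> kn; rewrite subr_gt0 rS.
have [J hJ] : exists J, forall j, (J <= j)%N -> forall k, (k < n)%N ->
    `|disc_mean (h k) j| <= 32 * lam / Tm * h k /\
    disc_sqr (h k) j <= 288 * lam ^+ 2 / Tm * h k.
  have /choice[f hf] : forall k, exists J, (k < n)%N -> forall j, (J <= j)%N ->
      `|disc_mean (h k) j| <= 32 * lam / Tm * h k /\
      disc_sqr (h k) j <= 288 * lam ^+ 2 / Tm * h k.
    move=> k; have [kn|_] := ltnP k n; last by exists 0%N.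
    have hT : h k <= Tm by have := rkT _ kn; have := rk0 _ (ltnW kn); rewrite /h; lra.
    by have [J hJ] := short_incr_moments (h_gt0 _ kn) hT; exists J.
  exists (\max_(k < n) f k)%N => j Jj k kn; apply: hf => //.
  exact: leq_trans (leq_bigmax (Ordinal kn)) Jj.
pose kap j := incr_disc r' j.
have mkap j := @measurable_incr_disc r' j r'0.
have ind j : forall v : nat -> 'I_j.+1,
    P (\bigcap_(k < n) [set w | kap j k w = v k]) =
    (\prod_(k < n) P [set w | kap j k w = v k])%E.
  apply: incr_disc_indep; first exact: r'0.
  by move=> k kn; rewrite !r'E ?(ltnW kn)// rS.
pose y j k (i : 'I_j.+1) := B k (disc_val x_ lam i).
apply: (fatou_cvg_le (f_ := fun j w => (`|walk (y j) (history (kap j) n w)| ^+ 2)%:E)) => //.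
- move=> j; apply/measurable_funTS/measurable_EFinP.
  exact: (measurable_fun_history (mkap j) n (fun u => `|walk (y j) u| ^+ 2)).
- move=> w Gw; apply: cvg_EFin; first exact: nearW.
  rewrite /comp /= expr2; under eq_fun do rewrite expr2 walk_history.
  suff cv : (fun j => \sum_(k < n) y j k (kap j k w)) @ \oo -->
      \sum_(k < n) B k (X (r k.+1) w - X (r k) w).
    by apply: cvgM; exact: cvg_norm.
  apply: cvg_sum_seq => -[k kn] /=.
  apply/cvgrPdist_le => e e0; rewrite /y /kap /incr_disc !r'E// ?(ltnW kn)//.
  set Dk := X _ w - _.
  have M1 : 0 < M + 1 by rewrite ltr_wpDl.
  have eM : 0 < e / (M + 1) by rewrite divr_gt0.
  have [K hK] := nearest_dist_lt x_dense Dk eM.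
  exists K => // j /= Kj; rewrite -(lin_mapB (linB k kn)).
  apply: (le_trans (leB k kn _)); rewrite disc_valE; last first.
    by apply: incr_le => //; rewrite ?rk0 ?rkT// ltnW.
  apply: (@le_trans _ _ ((M + 1) * (e / (M + 1)))); last by rewrite mulrC divfK ?gt_eqF.
  apply: ler_pM => //; first by rewrite lerDl.
  exact/ltW/hK.
exists J => j Jj.
(* Enlarging [G] to the whole space restores the independence of the outcomes. *)
apply: (@le_trans _ _ (\int[P]_w (`|walk (y j) (history (kap j) n w)| ^+ 2)%:E)%E).
  apply: ge0_subset_integral => //.
  apply/measurable_EFinP.
  exact: (measurable_fun_history (mkap j) n (fun u => `|walk (y j) u| ^+ 2)).
rewrite (integral_history (mkap j) (ind j) (F := fun u => `|walk (y j) u| ^+ 2))//.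
rewrite lee_fin; apply: (le_trans (expect_sqr_walk_le _ _ hip _ _)).
- by move=> k i; exact: out_prob_ge0.
- by move=> k; exact: (out_prob_sum1 P (mkap j)).
have law k (i : 'I_j.+1) : (k < n)%N -> out_prob P (kap j) k i = disc_law (h k) i.
  move=> kn; rewrite /kap incr_disc_law// !r'E// ?(ltnW kn)//.
  by rewrite ltW// rS.
have meanE k : (k < n)%N -> wmean (out_prob P (kap j)) (y j) k = B k (disc_mean (h k) j).
  move=> kn; rewrite /wmean /disc_mean (lin_map_sum (linB k kn)).
  by apply: eq_bigr => i _; rewrite law// (lin_mapZ (linB k kn)).
have sqr_le k : (k < n)%N ->
    wsqr (out_prob P (kap j)) (y j) k <= M ^+ 2 * (288 * lam ^+ 2 / Tm) * h k.
  move=> kn; have [_ h2] := hJ j Jj k kn.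
  rewrite -mulrA; apply: le_trans (ler_wpM2l (sqr_ge0 M) h2).
  rewrite /wsqr /disc_sqr mulr_sumr; apply: ler_sum => i _.
  rewrite law// [leRHS]mulrCA ler_wpM2l ?fine_ge0// -exprMn.
  by rewrite ler_sqr ?nnegrE ?mulr_ge0// leB.
have sumh : \sum_(k < n) h k <= Tm.
  rewrite -(big_mkord predT h) telescope_sumr//; lra.
have s1 : \sum_(k < n) wsqr (out_prob P (kap j)) (y j) k <= M ^+ 2 * (288 * lam ^+ 2).
  apply: (@le_trans _ _ (\sum_(k < n) M ^+ 2 * (288 * lam ^+ 2 / Tm) * h k)).
    by apply: ler_sum => k _; exact: sqr_le.
  rewrite -mulr_sumr (_ : M ^+ 2 * (288 * lam ^+ 2) = M ^+ 2 * (288 * lam ^+ 2 / Tm) * Tm).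
    apply: ler_wpM2l sumh; rewrite mulr_ge0 ?sqr_ge0// divr_ge0 ?(ltW Tm_gt0)//.
    by apply: mulr_ge0; [exact: ler0n|exact: sqr_ge0].
  by field; rewrite gt_eqF.
have s2 : `|\sum_(k < n) wmean (out_prob P (kap j)) (y j) k| <= M * (32 * lam).
  apply: (le_trans (ler_norm_sum _ _ _)).
  apply: (@le_trans _ _ (\sum_(k < n) M * (32 * lam / Tm) * h k)).
    apply: ler_sum => k _; rewrite meanE//; apply: (le_trans (leB _ _ _)) => //.
    by rewrite -mulrA ler_wpM2l//; have [] := hJ j Jj k (ltn_ord k).
  rewrite -mulr_sumr (_ : M * (32 * lam) = M * (32 * lam / Tm) * Tm).
    by rewrite ler_wpM2l// mulr_ge0// divr_ge0 ?(ltW Tm_gt0)// mulr_ge0.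
  by field; rewrite gt_eqF.
have s3 : `|\sum_(k < n) wmean (out_prob P (kap j)) (y j) k| ^+ 2 <= (M * (32 * lam)) ^+ 2.
  by rewrite ler_sqr ?nnegrE ?mulr_ge0.
apply: (le_trans (lerD (ler_wpM2l _ s1) (ler_wpM2l _ s3))) => //.
(* The constant is [2624 = 2 * 288 + 2 * 32 ^ 2]. *)
rewrite le_eqVlt; apply/orP; left; apply/eqP; ring.
Qed.

End second_moment.

(** * Events that constrain a whole cadlag path *)

Section cadlag_paths.
Context {R : realType} {H : normedModType R} {d : measure_display} {Omega : measurableType d}.
Variables (Z : R -> Omega -> H) (Tm : R).
Hypothesis cZ : cadlag Z.
Hypothesis Tm_ge0 : 0 <= Tm.

(* A condition that holds near every point of the space for large [n] holds
   along a whole cadlag path for large [n], by compactness of [0, Tm]. *)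
Lemma cadlag_uniform (Q : nat -> H -> Prop) w :
  (forall l : H, exists2 e : R, 0 < e &
     exists N, forall n x, (N <= n)%N -> `|x - l| < e -> Q n x) ->
  exists N, forall n s, (N <= n)%N -> 0 <= s <= Tm -> Q n (Z s w).
Proof.
move=> locQ.
have /compact_near_coveringP cK := @segment_compact R 0 Tm.
have := cK nat \oo (fun n s => 0 <= s -> Q n (Z s w)) _.
case.
  move=> s /=; rewrite in_itv /= => /andP[s0 sT].
  have [zr zl] := cZ w s0.
  have [e1 e10 [N1 h1]] := locQ (Z s w).
  have nr : \forall s' \near s, s < s' -> `|Z s' w - Z s w| < e1.
    move/cvgrPdist_lt : zr => /(_ _ e10); rewrite near_withinE.
    by apply: filterS => s' h /h; rewrite distrC.
  (* On the left the path is close to its left limit, which may differ from [Z s w]; the local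
     condition is therefore used at both points. At [s = 0] there is nothing on the left. *)
  have [N2 nl] : exists N, \forall s' \near s, 0 <= s' -> s' < s ->
      forall n, (N <= n)%N -> Q n (Z s' w).
    have [s1|s1] := ltP 0 s; last first.
      by exists 0%N; apply: (filterE (F := nbhs s)) => s' ? ?; exfalso; lra.
    have [l zl'] := zl s1; have [e2 e20 [N2 h2]] := locQ l.
    exists N2; move/cvgrPdist_lt : zl' => /(_ _ e20); rewrite near_withinE.
    apply: filterS => s' h _ /h; rewrite distrC => h' n Nn; exact: h2 Nn h'.
  exists ([set s' | (s < s' -> `|Z s' w - Z s w| < e1) /\
     (0 <= s' -> s' < s -> forall n, (N2 <= n)%N -> Q n (Z s' w))],
     [set n | (maxn N1 N2 <= n)%N]) => /=.
    by split; [exact: filterI|exists (maxn N1 N2)].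
  move=> [s' n] /= [[hr hl]]; rewrite geq_max => /andP[n1 n2] s'0.
  have [ss'|s's|<-] := ltgtP s s'.
  - exact: h1 n1 (hr ss').
  - exact: hl.
  - by apply: h1 => //; rewrite subrr normr0.
move=> N _ hN; exists N => n s Nn /andP[s0 sT]; apply: (hN n Nn) => //=.
by rewrite in_itv /= s0.
Qed.

Hypothesis mZ : forall t, 0 <= t -> Hmeasurable (Z t).

Definition path_event (f : H -> R) : set Omega :=
  [set w | forall s, 0 <= s <= Tm -> f (Z s w) <= 0].

(** By right continuity the condition need only be checked at rational times and at [Tm]. The
    endpoint is separate because the path may jump there, beyond the control of earlier times. *)
Lemma measurable_path_event (f : H -> R) : continuous f -> measurable (path_event f).
Proof.
move=> cf.
have mf t : 0 <= t -> measurable [set w | f (Z t w) <= 0].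
  move=> t0; have mfZ := Hmeasurable_comp_continuous (mZ t0) cf.
  rewrite (_ : mkset _ = setT `&` (f \o Z t) @^-1` `]-oo, 0]).
    exact: mfZ.
  by apply/seteqP; split => x /=; rewrite in_itv /=; [split|case].
pose E (q : rat) : set Omega :=
  if (0 : R) <= ratr q <= Tm then [set w | f (Z (ratr q) w) <= 0] else setT.
rewrite (_ : path_event f = [set w | f (Z Tm w) <= 0] `&` \bigcap_q E q).
  apply: measurableI; first exact: mf.
  rewrite -[X in measurable X]setCK setC_bigcap; apply: measurableC.
  apply: bigcupT_measurable_rat => q; apply: measurableC; rewrite /E.
  by case: ifPn => // /andP[q0 _]; exact: mf.
apply/seteqP; split => [w hw|w [hT hE] s /andP[s0 sT]].
  split; first by apply: hw; rewrite Tm_ge0 lexx.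
  by move=> q _; rewrite /E; case: ifPn => // hq; exact: hw.
have [->//|sT'] := eqVneq s Tm.
have {}sT' : s < Tm by rewrite lt_neqAle sT'.
rewrite leNgt; apply/negP => fs.
have [zr _] := cZ w s0.
have := cvg_comp _ _ zr (cf (Z s w)).
move=> /cvgr_gt/(_ _ fs); rewrite near_withinE => /nbhs_ballP[e /= e0 he].
have sm : s < Num.min Tm (s + e) by rewrite lt_min sT' ltrDl e0.
have [q] := rat_in_itvoo sm; rewrite in_itv /= lt_min => /andP[sq /andP[qT qe]].
have := hE q Logic.I; rewrite /E (le_trans s0 (ltW sq)) (ltW qT) /= leNgt => /negP; apply.
apply: he => //; rewrite -ball_normE /= distrC ger0_norm ?subr_ge0 ?(ltW sq)//.
by rewrite ltrBlDl.
Qed.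

(** A Dini argument: the events increase with [n], and compactness places every path in one of them,
    so their probabilities tend to 1. *)
Lemma path_event_prob (P : probability Omega R) (F : nat -> H -> R) (c : R) :
  (forall n, continuous (F n)) -> (forall n x, F n.+1 x <= F n x) ->
  (forall l : H, exists2 e : R, 0 < e &
     exists N, forall n x, (N <= n)%N -> `|x - l| < e -> F n x <= 0) ->
  c < 1 -> exists N, forall n, (N <= n)%N -> (c%:E < P (path_event (F n)))%E.
Proof.
move=> cF decF locF c1.
apply: (nondecreasing_prob_gt (G := setT)) => //.
- by move=> n; exact: measurable_path_event.
- by move=> n w hw s sT; apply: le_trans (decF _ _) _; exact: hw.
- move=> w _; have [N hN] := cadlag_uniform w locF.
  by exists N => // s sT; exact: hN.
- by rewrite probability_setT lte_fin.
Qed.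

Lemma path_bounded_prob (P : probability Omega R) (c : R) : c < 1 ->
  exists N, forall n, (N <= n)%N -> (c%:E < P (path_event (fun x => (`|x| - n%:R)%R)))%E.
Proof.
apply: path_event_prob.
- by move=> n x; apply: cvgB; [exact: norm_continuous|exact: cvg_cst].
- by move=> n x; rewrite lerD2l lerN2 ler_nat.
- move=> l; exists 1 => //; exists (Num.truncn (`|l| + 1)).+1 => n x ln xl.
  rewrite subr_le0.
  have : `|l| + 1 <= n%:R.
    by apply: (le_trans (ltW (truncnS_gt _))); rewrite ler_nat.
  have := ler_normD (x - l) l; rewrite subrK; lra.
Qed.

Context (ip : H -> H -> R) (hip : is_inner_product ip) (x_ : nat -> H)
  (x_dense : forall y (e : R), 0 < e -> exists n, `|y - x_ n| < e).

Lemma ortho_proj_continuous n : continuous (ortho_proj ip x_ n).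
Proof.
rewrite (_ : ortho_proj ip x_ n = fun y =>
    \sum_(i < n) ip y (ortho_vec ip x_ i) *: ortho_vec ip x_ i).
  move=> y; apply: cvg_sum_seq => i; apply: cvgZr_tmp.
  exact: (ip_continuousl hip).
by apply/funext => y; rewrite (ortho_projE ip).
Qed.

Lemma path_compl_prob (P : probability Omega R) (lam c : R) : 0 < lam -> c < 1 ->
  exists N, forall n, (N <= n)%N ->
    (c%:E < P (path_event (fun x => (`|x - ortho_proj ip x_ n x| - lam)%R)))%E.
Proof.
move=> l0; apply: path_event_prob.
- move=> n x; apply: cvgB; last exact: cvg_cst.
  by apply: cvg_norm; apply: cvgB; [exact: cvg_id|exact: ortho_proj_continuous].
- by move=> n x; rewrite lerD2r; exact: (norm_ortho_compl_anti hip).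
- move=> l; exists (lam / 2); first by rewrite divr_gt0.
  have /cvgr0Pnorm_lt/(_ (lam / 2)) := cvg_ortho_compl hip x_dense l.
  case; first by rewrite divr_gt0.
  move=> N _ hN; exists N => n x Nn xl; rewrite subr_le0.
  have := hN n Nn; rewrite /= normr_id => h1.
  have h2 := norm_ortho_compl_le hip x_ n (x - l).
  (* Residuals depend linearly on the vector and do not increase norms, so smallness at [l] extends
     to a ball around [l]. *)
  have -> : x - ortho_proj ip x_ n x =
    (x - l - ortho_proj ip x_ n (x - l)) + (l - ortho_proj ip x_ n l).
    rewrite (ortho_proj_sub hip) opprB addrACA subrK; congr (x + _).
    by rewrite addrAC subrr add0r.
  apply: (le_trans (ler_normD _ _)); lra.
Qed.

End cadlag_paths.

(** * Comparing sums over a common refinement *)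

Section refinement.
Context {R : realType} {H : normedModType R}.

Fixpoint step_sum (B : R -> H -> H) (z : R -> H) (x : R) (l : seq R) : H :=
  if l is y :: l' then B x (z y - z x) + step_sum B z y l' else 0.

Fixpoint is_step (B : R -> H -> H) (x : R) (l : seq R) : Prop :=
  if l is y :: l' then (forall u, x <= u < y -> B u =1 B x) /\ is_step B y l' else True.

Section step_sum_refine.
Variables (B : R -> H -> H) (z : R -> H).
Hypothesis linB : forall u c x y, B u (c *: x + y) = c *: B u x + B u y.

Lemma path_lt_mem (x y : R) l : path <%R x l -> y \in l -> x < y.
Proof. by rewrite lt_path_sortedE => /andP[/allP + _]; apply. Qed.

Lemma path_lt_last_nil (x : R) l : path <%R x l -> last x l = x -> l = [::].
Proof.
case: l => // y l xl lx; have := path_lt_mem xl (mem_last y l : last x (y :: l) \in y :: l).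
by rewrite lx ltxx.
Qed.

(** The induction runs over the finer list, so it must start at a point [u] that may lie inside a
    coarse cell; [y] is the end of that cell, up to which [B] is constant. The increments within the
    cell telescope. *)
Lemma step_sum_refine_aux l u y l' : path <%R u l -> u < y -> path <%R y l' ->
  {subset y :: l' <= l} -> last u l = last y l' ->
  (forall v, u <= v < y -> B v =1 B u) -> is_step B y l' ->
  step_sum B z u l = B u (z y - z u) + step_sum B z y l'.
Proof.
elim: l u y l' => [u y l' _ _ _ /(_ y (mem_head _ _))//|v l ih u y l' /=].
move=> /andP[uv vl] uy yl' sub lst Buy stepB.
have vy : v <= y.
  have := sub y (mem_head _ _); rewrite inE => /orP[/eqP->//|yl].
  exact: ltW (path_lt_mem vl yl).
have sub' a : a \in y :: l' -> v < a -> a \in l.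
  by move=> /sub; rewrite inE => /orP[/eqP ->|//]; rewrite ltxx.
have [vyE|vy'] := eqVneq v y.
  subst v; congr (_ + _); case: l' yl' sub sub' lst stepB => [|y2 l2] /= yl' sub sub' lst stepB.
    by rewrite (path_lt_last_nil vl lst).
  case/andP: yl' => yy2 y2l2; case: stepB => s1 s2.
  apply: ih => // a ain; apply: sub'; first by rewrite inE ain orbT.
  apply: (@path_lt_mem y a (y2 :: l2)) => //=; by rewrite yy2.
have {}vy' : v < y by rewrite lt_neqAle vy'.
rewrite (ih v y l') //; last 2 first.
- move=> a ain; apply: sub' => //; move: ain; rewrite inE => /orP[/eqP ->//|al].
  exact: lt_trans vy' (path_lt_mem yl' al).
- move=> w /andP[vw wy] x; rewrite Buy ?(le_trans (ltW uv) vw)//.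
  by rewrite Buy// (ltW uv) vy'.
rewrite addrA; congr (_ + _); rewrite (Buy v) ?(ltW uv)// -(lin_mapD (linB u)).
by rewrite addrC subrKA.
Qed.

Lemma step_sum_refine x l l' : path <%R x l -> path <%R x l' ->
  {subset l' <= l} -> last x l = last x l' -> is_step B x l' ->
  step_sum B z x l = step_sum B z x l'.
Proof.
case: l' => [|y l'] xl /=; first by move=> _ _ /(path_lt_last_nil xl) ->.
move=> /andP[xy yl'] sub lst [s1 s2]; exact: step_sum_refine_aux.
Qed.

Lemma step_sum_map (r : nat -> R) m n :
  step_sum B z (r m) [seq r k | k <- iota m.+1 n] =
  \sum_(m <= k < m + n) B (r k) (z (r k.+1) - z (r k)).
Proof.
elim: n m => [|n ih] m; first by rewrite addn0 big_geq.
by rewrite /= ih addSnnS [RHS]big_ltn// addnS ltnS leq_addr.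
Qed.

End step_sum_refine.

Section partitions.

(** Here [r] runs forward through the times of the integrator, while the tag [c k] is an argument of
    the operator family and so lies in the cell reflected at [t]. *)
Definition tagged_subdivision (t delta : R) (n : nat) (r c : nat -> R) :=
  [/\ r 0%N = 0, r n = t, (forall k, (k < n)%N -> r k < r k.+1),
      (forall k, (k < n)%N -> r k.+1 - r k < delta)
    & (forall k, (k < n)%N -> t - r k.+1 <= c k <= t - r k)].

Definition tagged_sum (F : R -> H -> H) (z : R -> H) n (r c : nat -> R) :=
  \sum_(k < n) F (c k) (z (r k.+1) - z (r k)).

Lemma incr_mono (r : nat -> R) n : (forall k, (k < n)%N -> r k < r k.+1) ->
  forall i j, (i <= j)%N -> (j <= n)%N -> r i <= r j.
Proof.
move=> rS i j + jn; elim: j jn => [|j ih] jn; first by rewrite leqn0 => /eqP ->.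
rewrite leq_eqVlt => /orP[/eqP -> //|ij].
exact: le_trans (ih (ltnW jn) ij) (ltW (rS _ jn)).
Qed.

Lemma incr_locate (r : nat -> R) n u : r 0%N <= u -> u < r n ->
  exists2 k, (k < n)%N & r k <= u < r k.+1.
Proof.
move=> r0u; elim: n => [|n ih]; first by rewrite ltNge r0u.
move=> urS; have [/ih[k kn h]|rnu] := ltP u (r n); last by exists n; rewrite ?rnu.
by exists k => //; exact: leqW.
Qed.

Lemma step_fun_exists (r c : nat -> R) n : (forall k, (k < n)%N -> r k < r k.+1) ->
  exists f : R -> R, forall k u, (k < n)%N -> r k <= u < r k.+1 -> f u = c k.
Proof.
move=> rS.
have /choice[f hf] : forall u, exists v, forall k, (k < n)%N -> r k <= u < r k.+1 -> v = c k.
  move=> u; have [[k kn /andP[ku uk]]|h] := pselect (exists2 k, (k < n)%N & r k <= u < r k.+1).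
    exists (c k) => i in_ /andP[iu ui]; congr c; apply/eqP; rewrite eqn_leq; apply/andP; split.
      rewrite leqNgt; apply/negP => ik; have := incr_mono rS ik (ltnW kn); lra.
    rewrite leqNgt; apply/negP => ik; have := incr_mono rS ik (ltnW in_); lra.
  by exists 0 => k kn hk; exfalso; apply: h; exists k.
by exists f => k u kn hk; exact: hf.
Qed.

Lemma path_map_iota (r : nat -> R) m n :
  (forall k, (m <= k < m + n)%N -> r k < r k.+1) -> path <%R (r m) [seq r k | k <- iota m.+1 n].
Proof.
elim: n m => //= n ih m rS; apply/andP; split; first by apply: rS; lia.
by apply: ih => k km; apply: rS; lia.
Qed.

Lemma last_map_iota (r : nat -> R) m n : last (r m) [seq r k | k <- iota m.+1 n] = r (m + n)%N.
Proof. by elim: n m => [|n ih] m /=; rewrite ?addn0// ih addSnnS. Qed.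

Lemma is_step_map_iota (B : R -> H -> H) (r : nat -> R) m n :
  (forall k u, (m <= k < m + n)%N -> r k <= u < r k.+1 -> B u =1 B (r k)) ->
  is_step B (r m) [seq r k | k <- iota m.+1 n].
Proof.
elim: n m => //= n ih m hB; split.
  by move=> u; apply: hB; lia.
by apply: ih => k u km; apply: hB; lia.
Qed.

(** A refined cell inherits the tag of the coarse cell around it. Its distance to
    [t - nth 0 (0 :: l) j] is then at most the coarse mesh, a reference value that does not depend
    on the original subdivision. *)
Lemma tagged_sum_refine (F : R -> H -> H) t delta n r c l :
  (forall u a x y, F u (a *: x + y) = a *: F u x + F u y) ->
  tagged_subdivision t delta n r c ->
  path <%R 0 l -> last 0 l = t -> {subset [seq r k | k <- iota 1 n] <= l} ->
  exists b : nat -> R, (forall z, tagged_sum F z n r c =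
      \sum_(j < size l) F (b j) (z (nth 0 (0 :: l) j.+1) - z (nth 0 (0 :: l) j))) /\
    (forall j, (j < size l)%N -> `|b j - (t - nth 0 (0 :: l) j)| <= delta /\ 0 <= b j <= t).
Proof.
move=> linF [r0 rn rS rd rc] pl lt sub.
have [f hf] := step_fun_exists c rS.
pose B u := F (f u).
exists (fun j => f (nth 0 (0 :: l) j)); split.
  move=> z; transitivity (step_sum B z 0 l).
    rewrite -[X in step_sum _ _ X _]r0 (@step_sum_refine B z _ (r 0%N) l [seq r k | k <- iota 1 n]).
    - rewrite step_sum_map add0n big_mkord; apply: eq_bigr => k _.
      by rewrite /B (hf k)// lexx rS.
    - by move=> u a x y; exact: linF.
    - by rewrite r0.
    - by apply: path_map_iota => k /andP[_]; exact: rS.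
    - exact: sub.
    - by rewrite last_map_iota r0 lt rn.
    - apply: is_step_map_iota => k u /andP[_ kn] ku x; rewrite /B (hf k)// (hf k)//.
      by rewrite lexx rS.
  rewrite -[X in _ = X](big_mkord predT (fun j => F (f (nth 0 (0 :: l) j))
    (z (nth 0 (0 :: l) j.+1) - z (nth 0 (0 :: l) j)))).
  have -> : step_sum B z 0 l = step_sum B z (nth 0 (0 :: l) 0)
      [seq nth 0 (0 :: l) k | k <- iota 1 (size l)].
    by congr step_sum; rewrite (iotaDl 1 0) -map_comp -[LHS](mkseq_nth 0 l).
  by rewrite step_sum_map.
move=> j jl; set q := nth 0 (0 :: l) j.
have q0 : 0 <= q.
  rewrite /q; case: j jl @q => [//|j] jl /=; apply: ltW (path_lt_mem pl _).
  by apply: mem_nth; exact: ltnW.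
have qt : q < t.
  rewrite -lt /q (last_nth 0); apply: (sorted_ltn_nth lt_trans 0 (s := 0 :: l)) => //=.
  - by rewrite inE ltnS ltnW.
  - by rewrite inE.
have [k kn /andP[kq qk]] : exists2 k, (k < n)%N & r k <= q < r k.+1.
  by apply: incr_locate; rewrite ?r0 ?rn.
rewrite (hf k) ?kq//; have := rd k kn; have /andP[c1 c2] := rc k kn => rdk.
have rk0 : 0 <= r k by rewrite -r0; apply: (incr_mono rS) => //; exact: ltnW.
have rkt : r k.+1 <= t by rewrite -rn; apply: (incr_mono rS).
split; last by apply/andP; split; lra.
by rewrite ler_norml; apply/andP; split; lra.
Qed.

(* Both sums are rewritten over the sorted union of the two subdivisions. *)
Lemma tagged_sum_merge (F : R -> H -> H) t delta n r c n' r' c' :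
  (forall u a x y, F u (a *: x + y) = a *: F u x + F u y) ->
  tagged_subdivision t delta n r c -> tagged_subdivision t delta n' r' c' ->
  exists m (q b b' : nat -> R), [/\ q 0%N = 0, q m = t, (forall k, (k < m)%N -> q k < q k.+1),
    (forall z : R -> H, tagged_sum F z n r c - tagged_sum F z n' r' c' =
      \sum_(j < m) (F (b j) (z (q j.+1) - z (q j)) - F (b' j) (z (q j.+1) - z (q j))))
    & forall j, (j < m)%N -> [/\ 0 <= b j <= t, 0 <= b' j <= t & `|b j - b' j| <= 2 * delta] ].
Proof.
move=> linF ts ts'.
have [r0 rn rS _ _] := ts; have [r'0 r'n r'S _ _] := ts'.
pose l1 := [seq r k | k <- iota 1 n]; pose l2 := [seq r' k | k <- iota 1 n'].
pose l := sort <=%R (undup (l1 ++ l2)).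
have meml x : (x \in l) = (x \in l1) || (x \in l2).
  by rewrite mem_sort mem_undup mem_cat.
have p1 : path <%R 0 l1 by rewrite -r0; apply: path_map_iota => k /andP[_]; exact: rS.
have p2 : path <%R 0 l2 by rewrite -r'0; apply: path_map_iota => k /andP[_]; exact: r'S.
have pl : path <%R 0 l.
  rewrite lt_path_sortedE; apply/andP; split.
    by apply/allP => x; rewrite meml => /orP[|]; exact: path_lt_mem.
  by rewrite lt_sorted_uniq_le sort_uniq undup_uniq /= sort_le_sorted.
have le_last (s : seq R) : path <%R 0 s -> forall x, x \in s -> x <= last 0 s.
  move=> ps x xs; rewrite (last_nth 0) -(nth_index 0 xs).
  case: s ps xs => // y s ps xs /=.
  apply: (sorted_leq_nth le_trans lexx 0 (s := y :: s)); rewrite ?inE ?index_mem//.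
  - exact: (sub_sorted (@ltW _ _) (path_sorted ps)).
  - by have := xs; rewrite -index_mem.
  - by have := xs; rewrite -index_mem.
have e1 : last 0 l1 = t by rewrite -r0 last_map_iota.
have e2 : last 0 l2 = t by rewrite -r'0 last_map_iota.
have lt : last 0 l = t.
  have lle : forall y, y \in l -> y <= t.
    by move=> y; rewrite meml => /orP[yl|yl]; [rewrite -e1|rewrite -e2]; exact: le_last.
  (* If [n = 0] then [t = 0], and the positive points of [l] are at most [t], so [l] is empty. *)
  case: (posnP n) => [n0|n0].
    have t0 : t = 0 by rewrite -rn n0 r0.
    case El : l => [|x l'] /=; first by rewrite t0.
    have lx : last x l' \in l by rewrite El mem_last.
    by have := lle _ lx; have := path_lt_mem pl lx; rewrite t0; lra.
  have tl : t \in l.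
    rewrite meml; apply/orP; left; apply/mapP; exists n; last by rewrite rn.
    by rewrite mem_iota n0 add1n ltnS leqnn.
  apply/eqP; rewrite eq_le (le_last _ pl _ tl) andbT; apply: lle.
  by clear -tl; case: l tl => // x l' _ /=; exact: mem_last.
have [b [bE bP]] := tagged_sum_refine (l := l) linF ts pl lt
  (fun x xl => etrans (meml x) (introT orP (or_introl xl))).
have [b' [b'E b'P]] := tagged_sum_refine (l := l) linF ts' pl lt
  (fun x xl => etrans (meml x) (introT orP (or_intror xl))).
exists (size l), (nth 0 (0 :: l)), b, b'; split => //.
- by rewrite -lt (last_nth 0).
- move=> k kl; apply: (sorted_ltn_nth lt_trans 0 (s := 0 :: l)) => //.
  by rewrite inE /= ltnS ltnW.
- by move=> z; rewrite bE b'E -sumrB.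
- move=> j jl; have [h1 ->] := bP j jl; have [h2 ->] := b'P j jl; split => //.
  have := ler_distD (t - nth 0 (0 :: l) j) (b j) (b' j).
  rewrite (distrC (t - _) (b' j)); lra.
Qed.

End partitions.
End refinement.

Section Hmeasurable_algebra.
Context {R : realType} {H : normedModType R} (ip : H -> H -> R).
Hypothesis hip : is_inner_product ip.
Context (x_ : nat -> H)
  (x_dense : forall y (e : R), 0 < e -> exists n, `|y - x_ n| < e).
Context {d : measure_display} {T : measurableType d}.

Lemma Hmeasurable_sub (X Y : T -> H) :
  Hmeasurable X -> Hmeasurable Y -> Hmeasurable (fun w => X w - Y w).
Proof.
move=> mX mY; apply: (weakly_measurable_Hmeasurable hip x_dense) => y.
under eq_fun do rewrite (ipBl hip).
by apply: measurable_funB; [exact: (Hmeasurable_ip hip y mX)|exact: (Hmeasurable_ip hip y mY)].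
Qed.

Lemma Hmeasurable_sum n (X : nat -> T -> H) :
  (forall k, (k < n)%N -> Hmeasurable (X k)) ->
  Hmeasurable (fun w => \sum_(k < n) X k w).
Proof.
move=> mX; apply: (weakly_measurable_Hmeasurable hip x_dense) => y.
under eq_fun do rewrite (ip_suml hip).
by apply: measurable_sum => k; exact: (Hmeasurable_ip hip y (mX k (ltn_ord k))).
Qed.

Lemma Hmeasurable_comp (g : H -> H) (X : T -> H) :
  continuous g -> Hmeasurable X -> Hmeasurable (g \o X).
Proof. by move=> cg mX B bB; exact: (mX _ (borelH_preimage_continuous cg bB)). Qed.

End Hmeasurable_algebra.

Lemma lin_bounded_continuous {R : realType} {H : normedModType R} (B : H -> H) (M : R) :
  (forall c x y, B (c *: x + y) = c *: B x + B y) ->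
  (forall x, `|B x| <= M * `|x|) -> continuous B.
Proof.
move=> linB leB x; apply/cvgrPdist_le => e e0.
have n0 : 0 < `|M| + 1 by rewrite ltr_pwDr.
near=> y; rewrite -(lin_mapB linB); apply: (le_trans (leB _)).
apply: (@le_trans _ _ ((`|M| + 1) * `|x - y|)).
  by apply: ler_wpM2r => //; have := ler_norm M; lra.
rewrite mulrC -ler_pdivlMr//.
near: y; apply: cvgr_dist_le; [exact: cvg_id|by rewrite divr_gt0].
Unshelve. all: by end_near. Qed.

Section chebyshev.
Context {R : realType} {d : measure_display} {T : measurableType d}.

Lemma echebyshev_on (mu : {measure set T -> \bar R}) (G : set T) (f : T -> \bar R) (C a : R) :
  measurable G -> measurable_fun setT f -> (forall w, (0 <= f w)%E) -> 0 < a ->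
  (\int[mu]_(w in G) f w <= C%:E)%E ->
  measurable (G `&` [set w | (a%:E < f w)%E]) /\
  (mu (G `&` [set w | (a%:E < f w)%E]) <= (C / a)%:E)%E.
Proof.
move=> mG mf f0 a0 fC.
have mGA : measurable (G `&` [set w | (a%:E < f w)%E]).
  apply: measurableI => //; rewrite -[X in measurable X]setTI.
  exact: emeasurable_fun_o_infty.
split => //; rewrite EFinM lee_pdivlMr// muleC.
apply: le_trans fC; rewrite -integral_cst//.
apply: (@le_trans _ _ (\int[mu]_(w in G `&` [set w | (a%:E < f w)%E]) f w)%E).
  apply: ge0_le_integral => //.
  - by move=> w _; rewrite lee_fin ltW.
  - exact: measurable_funTS.
  - by move=> w [_ /= /ltW].
by apply: ge0_subset_integral => //; exact: measurable_funTS.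
Qed.

Lemma chebyshev_on (mu : {measure set T -> \bar R}) (G : set T) (f : T -> R) (C a : R) :
  measurable G -> measurable_fun setT f -> (forall w, 0 <= f w) -> 0 < a ->
  (\int[mu]_(w in G) (f w)%:E <= C%:E)%E ->
  (mu (G `&` [set w | (a < f w)%R]) <= (C / a)%:E)%E.
Proof.
move=> mG mf f0 a0 fC.
have [_] := echebyshev_on mG (f := EFin \o f) ((measurable_EFinP _ _).2 mf) f0 a0 fC.
by [].
Qed.

End chebyshev.

Section composed_process.
Context {R : realType} {H : normedModType R}.
Context {d : measure_display} {Omega : measurableType d} (P : probability Omega R).
Variables (Z : R -> Omega -> H) (Q : H -> H).
Hypotheses (cQ : continuous Q) (subQ : forall x y, Q (x - y) = Q x - Q y).

Lemma independent_increments_comp :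
  independent_increments P Z -> independent_increments P (fun t w => Q (Z t w)).
Proof.
move=> ind n t t0 tS B bB.
have := ind n t t0 tS (fun k => Q @^-1` B k) (fun k => borelH_preimage_continuous cQ (bB k)).
have E k : incr_set Z t (fun k => Q @^-1` B k) k = incr_set (fun t w => Q (Z t w)) t B k.
  by rewrite /incr_set; apply/seteqP; split => w /=; rewrite subQ.
by under eq_bigcapr do rewrite E; under eq_bigr do rewrite E.
Qed.

Lemma stationary_increments_comp :
  stationary_increments P Z -> stationary_increments P (fun t w => Q (Z t w)).
Proof.
move=> stat s t s0 st B bB.
have := stat s t s0 st _ (borelH_preimage_continuous cQ bB).
rewrite (_ : [set w | (Q @^-1` B) (Z t w - Z s w)] = [set w | B (Q (Z t w) - Q (Z s w))])//.
by apply/seteqP; split => w /=; rewrite subQ.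
Qed.

End composed_process.

Section strong_continuity.
Context {R : realType} {H : normedModType R}.

(** Clamping the argument at 0 extends a function on the half-line continuously to the whole line,
    where compactness and measurability arguments apply directly. *)
Lemma continuous_max0 (f : R -> H) : {within [set t : R | 0 <= t], continuous f} ->
  continuous (fun u : R => f (Num.max u (0 : R))).
Proof.
move=> /subspace_continuousP cf u.
have m0 v : 0 <= Num.max v 0 :> R by rewrite le_max lexx orbT.
apply/cvgrPdist_lt => e e0.
have /cvgrPdist_lt/(_ _ e0) := cf (Num.max u 0) (m0 u).
rewrite near_withinE => /nbhs_ballP[r /= r0 hr].
apply/nbhs_ballP; exists r => //= v; rewrite /ball_ /= => uv.
apply: hr; last exact: m0.
rewrite /ball_ /=; apply: le_lt_trans uv.
have [u0|u0] := leP u 0; have [v0|v0] := leP v 0.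
- by rewrite subrr normr0.
- by rewrite sub0r normrN gtr0_norm// distrC ger0_norm; lra.
- by rewrite subr0 gtr0_norm// ger0_norm; lra.
- by [].
Qed.

Lemma unif_continuous_segment (g : R -> H) (a b e : R) : continuous g -> 0 < e ->
  exists2 del, 0 < del & forall u v, a <= u <= b -> `|u - v| <= del -> `|g u - g v| <= e.
Proof.
move=> cg e0; have /compact_near_coveringP cK := @segment_compact R a b.
have := cK R (0 : R)^'+ (fun del u => forall v, `|u - v| <= del -> `|g u - g v| <= e) _.
have e2 : 0 < e / 2 by rewrite divr_gt0.
case.
  move=> u _; have /cvgrPdist_lt/(_ _ e2)/nbhs_ballP[r /= r0 hr] := cg u.
  have r2 : 0 < r / 2 by rewrite divr_gt0.
  exists (ball u (r / 2), [set del | del < r / 2]) => /=.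
    split; first exact: nbhsx_ballx.
    exact: nbhs_right_lt.
  move=> [u' del] /= []; rewrite -ball_normE /= => uu' dr v u'v.
  have h1 := hr u'; have h2 := hr v.
  rewrite -ball_normE /= in h1 h2.
  have {}h1 : `|g u - g u'| < e / 2 by apply: h1; lra.
  have {}h2 : `|g u - g v| < e / 2.
    apply: h2; have := ler_distD u' u v; lra.
  have := ler_distD (g u) (g u') (g v); rewrite (distrC (g u') (g u)); lra.
move=> del /= del0 hdel; exists (del / 2); first by rewrite divr_gt0.
move=> u v uab uv; apply: (hdel (del / 2)) => //=.
- rewrite sub0r normrN gtr0_norm ?divr_gt0//; lra.
- by rewrite divr_gt0.
Qed.

End strong_continuity.

Lemma subr_swap {V : zmodType} (x y a b : V) : x - y - (a - b) = x - a - (y - b).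
Proof. by rewrite !opprB addrACA [RHS]addrACA (addrC (- y)). Qed.

Lemma small_square {R : realType} (K : R) : 0 <= K ->
  exists2 x : R, 0 < x & K * x ^+ 2 <= 1.
Proof.
move=> K0; have K1 : 0 < 1 + K by lra.
exists (1 + K)^-1; first by rewrite invr_gt0.
rewrite exprVn -ler_pdivlMr ?invr_gt0 ?exprn_gt0// invrK mul1r expr2.
have := mulr_ge0 K0 K0; lra.
Qed.

Lemma exists_min_upto {R : realType} (Q : nat -> R -> Prop) :
  (forall i a b, Q i a -> b <= a -> Q i b) ->
  (forall i, exists2 a, 0 < a & Q i a) ->
  forall n, exists2 a, 0 < a & forall i, (i < n)%N -> Q i a.
Proof.
move=> Qle Qex; elim=> [|n [a a0 ha]]; first by exists 1.
have [b b0 hb] := Qex n; exists (Num.min a b); first by rewrite lt_min a0.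
move=> i; rewrite ltnS leq_eqVlt => /orP[/eqP ->|/ha].
  by apply: Qle hb _; rewrite ge_min lexx orbT.
by move=> h; apply: Qle h _; rewrite ge_min lexx.
Qed.

(** * The uniform Cauchy estimate for Riemann sums *)

Section uniform_cauchy.
Context {R : realType} {H : normedModType R} (ip : H -> H -> R).
Hypothesis hip : is_inner_product ip.
Context (x_ : nat -> H)
  (x_dense : forall y (e : R), 0 < e -> exists n, `|y - x_ n| < e).
Context {d : measure_display} {Omega : measurableType d} (P : probability Omega R).
Variables (Z : R -> Omega -> H) (Res : R -> H -> H) (T M : R).
Hypothesis levyZ : levy_process P Z.
Hypothesis T_ge0 : 0 <= T.
Hypothesis M_ge0 : 0 <= M.
Hypothesis linRes : forall t c x y, Res t (c *: x + y) = c *: Res t x + Res t y.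
Hypothesis leRes : forall t x, 0 <= t <= T -> `|Res t x| <= M * `|x|.
Hypothesis cRes : forall x, {within [set t : R | 0 <= t], continuous (fun t => Res t x)}.

Local Notation Pi := (ortho_proj ip x_).
Local Notation Tm := (T + 1).

Let Tm_gt0 : 0 < Tm. Proof. by have := T_ge0; lra. Qed.

Lemma levy_incr_measurable s t : 0 <= s -> 0 <= t -> Hmeasurable (fun w => Z t w - Z s w).
Proof.
move=> s0 t0; case: levyZ => -[_ mZ] _ _ _ _.
by apply: (Hmeasurable_sub hip x_dense); exact: mZ.
Qed.

Lemma levy_second_moment (lam : R) (r : nat -> R) n (B : nat -> H -> H) (K : R) :
  let G := path_event Z Tm (fun x => `|x| - lam) in
  0 < lam -> ((7 / 8)%:E <= P G)%E ->
  0 <= r 0%N -> (forall k, (k < n)%N -> r k < r k.+1) -> r n <= Tm -> 0 <= K ->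
  (forall k, (k < n)%N -> forall c x y, B k (c *: x + y) = c *: B k x + B k y) ->
  (forall k, (k < n)%N -> forall x, `|B k x| <= K * `|x|) ->
  (\int[P]_(w in G) (`|\sum_(k < n) B k (Z (r k.+1) w - Z (r k) w)| ^+ 2)%:E <=
   (2624 * (K * lam) ^+ 2)%:E)%E.
Proof.
move=> G l0 PG r0 rS rn K0 linB leB; case: levyZ => -[Z0 mZ] ind stat _ cZ.
have mG : measurable G.
  apply: measurable_path_event => //; first exact: ltW.
  by move=> x; apply: cvgB; [exact: norm_continuous|exact: cvg_cst].
have GX w : G w -> forall s, 0 <= s <= Tm -> `|Z s w| <= lam.
  by move=> Gw s sT; have := Gw s sT; rewrite subr_le0.
exact: (second_moment_bound hip x_dense Tm_gt0 l0 Z0 levy_incr_measurable ind stat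
  mG PG GX r0 rS rn K0 linB leB).
Qed.

(** The residual process again starts at 0 and has independent stationary increments. Its bound
    [lam] can be taken small, and smallness of the paths becomes smallness of second moments. *)
Lemma compl_second_moment (lam : R) N (r : nat -> R) n (B : nat -> H -> H) (K : R) :
  let G := path_event Z Tm (fun x => `|x - Pi N x| - lam) in
  0 < lam -> ((7 / 8)%:E <= P G)%E ->
  0 <= r 0%N -> (forall k, (k < n)%N -> r k < r k.+1) -> r n <= Tm -> 0 <= K ->
  (forall k, (k < n)%N -> forall c x y, B k (c *: x + y) = c *: B k x + B k y) ->
  (forall k, (k < n)%N -> forall x, `|B k x| <= K * `|x|) ->
  (\int[P]_(w in G) (`|\sum_(k < n) B k ((Z (r k.+1) w - Pi N (Z (r k.+1) w)) -
       (Z (r k) w - Pi N (Z (r k) w)))| ^+ 2)%:E <=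
   (2624 * (K * lam) ^+ 2)%:E)%E.
Proof.
move=> G l0 PG r0 rS rn K0 linB leB; case: levyZ => -[Z0 mZ] ind stat _ cZ.
pose Q x := x - Pi N x.
have cQ : continuous Q.
  by move=> x; apply: cvgB; [exact: cvg_id|exact: (ortho_proj_continuous hip)].
have subQ x y : Q (x - y) = Q x - Q y.
  by rewrite /Q (ortho_proj_sub hip) subr_swap.
have mQ s t : 0 <= s -> 0 <= t -> Hmeasurable (fun w => Q (Z t w) - Q (Z s w)).
  move=> s0 t0; apply: (Hmeasurable_sub hip x_dense); apply: Hmeasurable_comp => //; exact: mZ.
have QZ0 w : Q (Z 0 w) = 0.
  by rewrite Z0 /Q (ortho_projE ip) big1 ?subr0// => i _; rewrite (ip0l hip) scale0r.
have mG : measurable G.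
  apply: measurable_path_event => //; first exact: ltW.
  by move=> x; apply: cvgB; [apply: cvg_norm; exact: cQ|exact: cvg_cst].
have GX w : G w -> forall s, 0 <= s <= Tm -> `|Q (Z s w)| <= lam.
  by move=> Gw s sT; have := Gw s sT; rewrite subr_le0.
exact: (second_moment_bound hip x_dense Tm_gt0 l0 QZ0 mQ
  (independent_increments_comp cQ subQ ind) (stationary_increments_comp cQ subQ stat)
  mG PG GX r0 rS rn K0 linB leB).
Qed.

Lemma resolvent_unif_cont x (e : R) : 0 < e ->
  exists2 del, 0 < del & forall u v, 0 <= u <= T -> 0 <= v <= T ->
    `|u - v| <= del -> `|Res u x - Res v x| <= e.
Proof.
move=> e0; have [del del0 h] := unif_continuous_segment 0 T (continuous_max0 (cRes (x:=x))) e0.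
exists del => // u v uT vT uv.
have := h u v uT uv; case/andP: uT => u0 _; case/andP: vT => v0 _.
by rewrite !max_l.
Qed.

(** On the common refinement the difference is a sum with operators [C j = Res (b j) - Res (b' j)].
    These are bounded by [th] on the range of [Pi N], and only by [2 * M] on its complement, where
    the process is bounded by [lam]. The choices are made in the order [Lam], [lam], [N], [th],
    [del]: the last depends on the finitely many directions kept. *)
Lemma tagged_sum_cauchy (eps eta : R) : 0 < eps -> 0 < eta ->
  exists2 delta, 0 < delta & forall t n r c n' r' c', 0 <= t <= T ->
    tagged_subdivision t delta n r c -> tagged_subdivision t delta n' r' c' ->
    exists E, [/\ measurable E, (P E <= eta%:E)%E & forall w, ~ E w ->
      `|tagged_sum Res (Z ^~ w) n r c - tagged_sum Res (Z ^~ w) n' r' c'| <= eps].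
Proof.
move=> eps0 eta0.
have [Z0mZ ind stat contP cZ] := levyZ; have [Z0 mZ] := Z0mZ.
have eps2 : 0 < (eps / 2) ^+ 2 by rewrite exprn_gt0 ?divr_gt0.
have eta4 : 0 < eta / 4 by rewrite divr_gt0.
(* [7 / 8] is what the moment bounds require; [1 - eta / 4] makes each complement one of four
   exceptional events of probability at most [eta / 4]. *)
have [cc cc1 [cc2 cc3]] : exists2 cc : R, cc < 1 & 7 / 8 <= cc /\ 1 - eta / 4 <= cc.
  exists (Num.max (7 / 8) (1 - eta / 4)); first by rewrite gt_max; apply/andP; split; lra.
  by rewrite !le_max !lexx orbT.
have prC (E : set Omega) : measurable E -> (cc%:E < P E)%E -> (P (~` E) <= (eta / 4)%:E)%E.
  move=> mE; rewrite probability_setC// -(fineK (fin_num_measure P E mE)) lte_fin => h.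
  by rewrite -EFinB lee_fin; lra.
have [N1 hN1] := path_bounded_prob cZ (ltW Tm_gt0) mZ P cc1.
pose Lam : R := N1.+1%:R.
have Lam0 : 0 < Lam by rewrite ltr0n.
pose G1 := path_event Z Tm (fun x => `|x| - Lam).
have PG1 : (cc%:E < P G1)%E by exact: hN1.
(* This is Chebyshev's bound at level [eps / 2] for the complement part; the choice of [th] below is
   its counterpart for the projected part. *)
have [lam lam0 hlam] := @small_square R (2624 * (2 * M) ^+ 2 / (eps / 2) ^+ 2 / (eta / 4))
  (divr_ge0 (divr_ge0 (mulr_ge0 (ler0n _ _) (sqr_ge0 _)) (ltW eps2)) (ltW eta4)).
have [N hN] := path_compl_prob cZ (ltW Tm_gt0) mZ hip x_dense P lam0 cc1.
pose G2 := path_event Z Tm (fun x => `|x - Pi N x| - lam).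
have PG2 : (cc%:E < P G2)%E by exact: hN.
have [th th0 hth] := @small_square R (2624 * Lam ^+ 2 / (eps / 2) ^+ 2 / (eta / 4))
  (divr_ge0 (divr_ge0 (mulr_ge0 (ler0n _ _) (sqr_ge0 _)) (ltW eps2)) (ltW eta4)).
(* The [N] coordinates of a projected vector contribute this much each, hence at most [th] in total;
   [N.+1] avoids division by zero. *)
have thN : 0 < th / N.+1%:R by rewrite divr_gt0.
have [del del0 hdel] : exists2 del, 0 < del & forall i, (i < N)%N ->
    forall u v, 0 <= u <= T -> 0 <= v <= T -> `|u - v| <= del ->
    `|Res u (ortho_vec ip x_ i) - Res v (ortho_vec ip x_ i)| <= th / N.+1%:R.
  apply: exists_min_upto.
    by move=> i a b h ba u v uT vT uv; apply: h => //; exact: le_trans ba.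
  by move=> i; exact: resolvent_unif_cont.
(* The two tags of a merged cell differ by at most twice the mesh. *)
exists (del / 2); first by rewrite divr_gt0.
move=> t n r c n' r' c' /andP[t0 tT] ts ts'.
have [m [q [b [b' [q0 qm qS sumE bP]]]]] := tagged_sum_merge linRes ts ts'.
have qmT : q m <= Tm by rewrite qm; lra.
have q_ge0 k : (k <= m)%N -> 0 <= q k.
  by move=> km; rewrite -q0; exact: (incr_mono qS).
pose C j x := Res (b j) x - Res (b' j) x.
have linC j a x y : C j (a *: x + y) = a *: C j x + C j y.
  by rewrite /C !linRes scalerBr opprD addrACA.
have leC j : (j < m)%N -> forall x, `|C j x| <= (2 * M) * `|x|.
  move=> jm x; have [/andP[b0 bt] /andP[b'0 b't] _] := bP j jm.
  apply: (le_trans (ler_normB _ _)).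
  have h1 : `|Res (b j) x| <= M * `|x| by apply: leRes; rewrite b0 (le_trans bt).
  have h2 : `|Res (b' j) x| <= M * `|x| by apply: leRes; rewrite b'0 (le_trans b't).
  by lra.
have leCP j : (j < m)%N -> forall x, `|C j (Pi N x)| <= th * `|x|.
  move=> jm x; have [/andP[b0 bt] /andP[b'0 b't] bb'] := bP j jm.
  rewrite (ortho_projE ip) (lin_map_sum (linC j)).
  apply: (le_trans (ler_norm_sum _ _ _)).
  apply: (@le_trans _ _ (\sum_(i < N) `|x| * (th / N.+1%:R))).
    apply: ler_sum => i _; rewrite (lin_mapZ (linC j)) normrZ; apply: ler_pM => //.
      apply: (le_trans (Cauchy_Schwarz_ip hip _ _)).
      by rewrite -[leRHS]mulr1 ler_wpM2l// (norm_ortho_vec_le1 ip).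
    apply: hdel => //; rewrite ?b0 ?b'0 ?(le_trans bt tT) ?(le_trans b't tT)//.
    by apply: (le_trans bb'); lra.
  rewrite sumr_const card_ord -mulrnAr [leRHS]mulrC ler_wpM2l//.
  rewrite -mulr_natr mulrAC ler_pdivrMr// ler_pM2l// ler_nat//.
pose S1 w := \sum_(j < m) C j (Pi N (Z (q j.+1) w - Z (q j) w)).
pose S2 w := \sum_(j < m) C j ((Z (q j.+1) w - Pi N (Z (q j.+1) w)) -
       (Z (q j) w - Pi N (Z (q j) w))).
have linCP j a x y : C j (Pi N (a *: x + y)) = a *: C j (Pi N x) + C j (Pi N y).
  by rewrite (ortho_proj_lin hip) linC.
have mP : continuous (Pi N) by exact: (ortho_proj_continuous hip).
have mS1 : measurable_fun setT (fun w => `|S1 w| ^+ 2).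
  apply: measurable_funX; apply: Hmeasurable_norm.
  apply: (Hmeasurable_sum hip x_dense
    (X := fun j w => C j (Pi N (Z (q j.+1) w - Z (q j) w)))) => j jm.
  apply: (Hmeasurable_comp (g := fun x => C j (Pi N x))).
    exact: (lin_bounded_continuous (linCP j) (leCP j jm)).
  by apply: levy_incr_measurable; apply: q_ge0 => //; exact: ltnW.
have mS2 : measurable_fun setT (fun w => `|S2 w| ^+ 2).
  apply: measurable_funX; apply: Hmeasurable_norm.
  apply: (Hmeasurable_sum hip x_dense (X := fun j w => C j ((Z (q j.+1) w - Pi N (Z (q j.+1) w)) -
       (Z (q j) w - Pi N (Z (q j) w))))) => j jm.
  apply: Hmeasurable_comp; first exact: (lin_bounded_continuous (linC j) (leC j jm)).
  apply: (Hmeasurable_sub hip x_dense); apply: (Hmeasurable_sub hip x_dense).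
  - by apply: mZ; exact: q_ge0.
  - by apply: Hmeasurable_comp => //; apply: mZ; exact: q_ge0.
  - by apply: mZ; apply: q_ge0; exact: ltnW.
  - by apply: Hmeasurable_comp => //; apply: mZ; apply: q_ge0; exact: ltnW.
have mG1 : measurable G1.
  apply: measurable_path_event => //; first exact: ltW.
  by move=> x; apply: cvgB; [exact: norm_continuous|exact: cvg_cst].
have mG2 : measurable G2.
  apply: measurable_path_event => //; first exact: ltW.
  move=> x; apply: cvgB; last exact: cvg_cst.
  by apply: cvg_norm; apply: cvgB; [exact: cvg_id|exact: mP].
have cc78 (E : set Omega) : (cc%:E < P E)%E -> ((7 / 8)%:E <= P E)%E.
  by move=> h; apply: le_trans (ltW h); rewrite lee_fin.
have i1 : (\int[P]_(w in G1) (`|S1 w| ^+ 2)%:E <= (2624 * (th * Lam) ^+ 2)%:E)%E.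
  apply: (levy_second_moment (B := fun j x => C j (Pi N x)) Lam0 (cc78 _ PG1)) => //.
  - by rewrite q0.
  - exact: ltW.
have i2 : (\int[P]_(w in G2) (`|S2 w| ^+ 2)%:E <= (2624 * (2 * M * lam) ^+ 2)%:E)%E.
  apply: (compl_second_moment (B := C) lam0 (cc78 _ PG2)) => //.
  - by rewrite q0.
  - by rewrite mulr_ge0.
have p1 := chebyshev_on mG1 mS1 (fun w => sqr_ge0 `|S1 w|) eps2 i1.
have p2 := chebyshev_on mG2 mS2 (fun w => sqr_ge0 `|S2 w|) eps2 i2.
have bnd (K x : R) : K * x ^+ 2 / (eps / 2) ^+ 2 / (eta / 4) <= 1 ->
    K * x ^+ 2 / (eps / 2) ^+ 2 <= eta / 4.
  by rewrite ler_pdivrMr// mul1r.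
have b1 : 2624 * (th * Lam) ^+ 2 / (eps / 2) ^+ 2 <= eta / 4.
  apply: bnd; apply: le_trans hth; rewrite le_eqVlt; apply/orP; left; apply/eqP.
  by rewrite exprMn; ring.
have b2 : 2624 * (2 * M * lam) ^+ 2 / (eps / 2) ^+ 2 <= eta / 4.
  apply: bnd; apply: le_trans hlam; rewrite le_eqVlt; apply/orP; left; apply/eqP.
  by rewrite [in LHS]exprMn; ring.
pose A1 := G1 `&` [set w | (eps / 2) ^+ 2 < `|S1 w| ^+ 2].
pose A2 := G2 `&` [set w | (eps / 2) ^+ 2 < `|S2 w| ^+ 2].
have mA (f : Omega -> R) (a : R) : measurable_fun setT f -> measurable [set w | a < f w].
  move=> mf; rewrite (_ : mkset _ = setT `&` f @^-1` `]a, +oo[); first exact: mf.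
  by apply/seteqP; split => w /=; rewrite in_itv /= andbT; [split|case].
have mA1 : measurable A1 by apply: measurableI => //; exact: mA.
have mA2 : measurable A2 by apply: measurableI => //; exact: mA.
exists ((~` G1 `|` ~` G2) `|` (A1 `|` A2)); split.
- by do 2!apply: measurableU => //; exact: measurableC.
- have mC1 := measurableC mG1; have mC2 := measurableC mG2.
  have mU (E F : set Omega) : measurable E -> measurable F ->
    (P (E `|` F) <= P E + P F)%E by exact: measureU2.
  apply: le_trans; first by apply: mU; exact: measurableU.
  apply: le_trans; first by apply: leeD; exact: mU.
  apply: (@le_trans _ _ (((eta / 4)%:E + (eta / 4)%:E) + ((eta / 4)%:E + (eta / 4)%:E))%E).
    apply: leeD; apply: leeD.
    + exact: prC.
    + exact: prC.
    + by apply: (le_trans p1); rewrite lee_fin.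
    + by apply: (le_trans p2); rewrite lee_fin.
  by rewrite -!EFinD lee_fin; lra.
- move=> w nE; have {nE}[g1 g2 a1 a2] : [/\ G1 w, G2 w, ~ A1 w & ~ A2 w].
    by split; apply: contrapT => h; apply: nE; [left; left|left; right|right; left|right; right];
      move: h => //; rewrite notK.
  have s1 : `|S1 w| <= eps / 2.
    rewrite -ler_sqr ?nnegrE ?divr_ge0 ?(ltW eps0)//.
    by rewrite leNgt; apply/negP => h; apply: a1.
  have s2 : `|S2 w| <= eps / 2.
    rewrite -ler_sqr ?nnegrE ?divr_ge0 ?(ltW eps0)//.
    by rewrite leNgt; apply/negP => h; apply: a2.
  rewrite sumE.
  have -> : \sum_(j < m) (Res (b j) (Z (q j.+1) w - Z (q j) w) -
      Res (b' j) (Z (q j.+1) w - Z (q j) w)) = S1 w + S2 w.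
    rewrite -big_split; apply: eq_bigr => j _ /=.
    rewrite -(lin_mapD (linC j)) -/(C j _); congr (C j _).
    by rewrite (ortho_proj_sub hip) -subr_swap [RHS]addrC subrK.
  by apply: (le_trans (ler_normD _ _)); lra.
Qed.

End uniform_cauchy.

(** The partition [p] measures time backwards from [t], so the index is reversed. The cell from
    [p k] to [p k.+1] has tag [s k.+1], which becomes [s (n - k)] after reversal. *)
Lemma riemann_sum_tagged {d : measure_display} {Omega : measurableType d} {R : realType}
    {H : normedModType R} (Res : R -> H -> H) (Z : R -> Omega -> H) t delta n p s :
  tagged_partition t delta n p s ->
  tagged_subdivision t delta n (fun k => t - p (n - k)%N) (fun k => s (n - k)%N) /\
  forall w, riemann_sum Res Z t n p s w =
    tagged_sum Res (Z ^~ w) n (fun k => t - p (n - k)%N) (fun k => s (n - k)%N).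
Proof.
move=> [p0 pn pS pd ps]; split.
  have e k : (k < n)%N -> (n - k = (n - k.+1).+1)%N by lia.
  split.
  - by rewrite subn0 pn subrr.
  - by rewrite subnn p0 subr0.
  - by move=> k kn; rewrite (e k kn) ltrD2l ltrN2; apply: pS; lia.
  - move=> k kn; rewrite (e k kn); have := pd (n - k.+1)%N ltac:(lia); lra.
  - move=> k kn; rewrite (e k kn); have := ps (n - k.+1)%N ltac:(lia); lra.
move=> w; rewrite /riemann_sum /tagged_sum (reindex_inj rev_ord_inj) /=.
apply: eq_bigr => k _; have kn := ltn_ord k.
by have -> : ((n - k.+1).+1 = n - k)%N by lia.
Qed.

Lemma tagged_subdivision_weaken {R : realType} (t d1 d2 : R) n r c : d1 <= d2 ->
  tagged_subdivision t d1 n r c -> tagged_subdivision t d2 n r c.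
Proof.
move=> d12 [h1 h2 h3 h4 h5]; split => // k kn; exact: lt_le_trans (h4 k kn) d12.
Qed.

(** * Approximation by sums over a fixed grid *)

Section approximation.
Context {R : realType} {H : normedModType R} (ip : H -> H -> R).
Hypothesis hip : is_inner_product ip.
Context (x_ : nat -> H)
  (x_dense : forall y (e : R), 0 < e -> exists n, `|y - x_ n| < e).
Context {d : measure_display} {Omega : measurableType d} (P : probability Omega R).
Variables (Z : R -> Omega -> H) (Res : R -> H -> H) (T M : R).
Hypothesis levyZ : levy_process P Z.
Hypothesis T_ge0 : 0 <= T.
Hypothesis M_ge0 : 0 <= M.
Hypothesis linRes : forall t c x y, Res t (c *: x + y) = c *: Res t x + Res t y.
Hypothesis leRes : forall t x, 0 <= t <= T -> `|Res t x| <= M * `|x|.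
Hypothesis cRes : forall x, {within [set t : R | 0 <= t], continuous (fun t => Res t x)}.

Local Notation Tm := (T + 1).
Let Tm_gt0 : 0 < Tm. Proof. by have := T_ge0; lra. Qed.

(** The horizon [T + 1] in place of [T] keeps the mesh positive when [T = 0]. *)
Definition mesh m : R := Tm / m.+1%:R.
Definition grid m k : R := k%:R * mesh m.

Lemma mesh_gt0 m : 0 < mesh m. Proof. by rewrite divr_gt0. Qed.

Lemma grid0 m : grid m 0 = 0. Proof. by rewrite /grid mul0r. Qed.

Lemma gridS m k : grid m k.+1 = grid m k + mesh m.
Proof. by rewrite /grid -natr1 mulrDl mul1r. Qed.

Lemma gridm m : grid m m.+1 = Tm.
Proof. by rewrite /grid /mesh mulrC divfK// pnatr_eq0. Qed.

Lemma grid_ge0 m k : 0 <= grid m k.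
Proof. by rewrite mulr_ge0// ltW// mesh_gt0. Qed.

Lemma grid_lt m i j : (grid m i < grid m j) = (i < j)%N.
Proof. by rewrite /grid ltr_pM2r ?mesh_gt0// ltr_nat. Qed.

Lemma grid_le m i j : (grid m i <= grid m j) = (i <= j)%N.
Proof. by rewrite /grid ler_pM2r ?mesh_gt0// ler_nat. Qed.

(* Increments of [Z] over the whole grid cells that start before [t]; the last
   cell may overshoot [t], which keeps the dependence on [t] deterministic. *)
Definition conv_approx m t w : H :=
  \sum_(k < m.+1) (if grid m k < t then
     Res (t - grid m k) (Z (grid m k.+1) w - Z (grid m k) w) else 0).

Lemma grid_ceil m t : 0 < t <= T ->
  exists2 K, (K < m.+1)%N & grid m K < t <= grid m K.+1.
Proof.
move=> /andP[t0 tT].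
have : exists K, t <= grid m K by exists m.+1; rewrite gridm; lra.
move=> /ex_minnP[[|K]]; first by rewrite grid0; lra.
move=> tK minK; exists K.
  have : (K.+1 <= m.+1)%N by apply: minK; rewrite gridm; lra.
  by [].
rewrite tK andbT ltNge; apply/negP => /minK; lia.
Qed.

Lemma conv_approx_trunc m K t w : (K < m.+1)%N -> grid m K < t <= grid m K.+1 ->
  conv_approx m t w =
  \sum_(k < K.+1) Res (t - grid m k) (Z (grid m k.+1) w - Z (grid m k) w).
Proof.
move=> Km /andP[Kt tK].
rewrite /conv_approx (big_ord_widen m.+1 (fun k => Res (t - grid m k)
  (Z (grid m k.+1) w - Z (grid m k) w)))// [RHS]big_mkcond /=.
apply: eq_bigr => k _; congr (if _ then _ else _).
rewrite ltnS; apply/idP/idP => [h|h].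
  by rewrite -ltnS -(grid_lt m); exact: lt_le_trans h tK.
by apply: le_lt_trans Kt; rewrite grid_le.
Qed.

(** Cutting the last cell at [t] gives a genuine subdivision of [[0, t]]; linearity of [Res]
    isolates the overshoot as a single increment of [Z] over a time at most the mesh. *)
Lemma conv_approx_tagged m t : 0 <= t <= T ->
  exists n r c u v, [/\ tagged_subdivision t (2 * mesh m) n r c, 0 <= u <= T,
    t <= v <= t + mesh m & forall w, conv_approx m t w =
      tagged_sum Res (Z ^~ w) n r c + Res u (Z v w - Z t w)].
Proof.
move=> /andP[t0 tT]; have h0 := mesh_gt0 m.
have [tz|tnz] := eqVneq t 0.
  exists 0%N, (fun=> 0), (fun=> 0), 0, t; split => //.
  - by rewrite lexx T_ge0.
  - by rewrite lexx lerDl ltW.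
  move=> w; rewrite /tagged_sum big_ord0 subrr (lin_map0 (linRes 0)) addr0.
  by apply: big1 => k _; rewrite tz ltNge grid_ge0.
have {tnz}t1 : 0 < t by rewrite lt_neqAle eq_sym tnz.
have [K Km /andP[Kt tK]] : exists2 K, (K < m.+1)%N & grid m K < t <= grid m K.+1.
  by apply: grid_ceil; rewrite t1.
(* The cells have length at most [mesh m]; the factor 2 in the statement provides the strict
   inequality. *)
pose r k := if (k <= K)%N then grid m k else t.
exists K.+1, r, (fun k => t - grid m k), (t - grid m K), (grid m K.+1); split.
- rewrite /r; split => [|||k kn|k kn].
  + by rewrite leq0n grid0.
  + by rewrite ltnn.
  + move=> k; rewrite ltnS => kK; rewrite kK; case: ifPn => [_|].
      by rewrite grid_lt.
    by rewrite -ltnNge ltnS => Kk; apply: le_lt_trans Kt; rewrite grid_le.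
  + have kK : (k <= K)%N by [].
    rewrite kK; case: ifPn => [_|]; first by rewrite gridS; lra.
    rewrite -ltnNge ltnS => Kk; have -> : k = K by lia.
    by move: tK; rewrite gridS; lra.
  + have kK : (k <= K)%N by [].
    rewrite kK lexx andbT lerD2l lerN2; case: ifPn => [_|].
      by rewrite grid_le.
    by rewrite -ltnNge ltnS => Kk; apply: le_trans (ltW Kt); rewrite grid_le; lia.
- by have := grid_ge0 m K; lra.
- by rewrite tK gridS; lra.
- move=> w; rewrite (conv_approx_trunc w Km) ?Kt//.
  have rK1 : r K.+1 = t by rewrite /r ltnn.
  have rK : r K = grid m K by rewrite /r leqnn.
  rewrite /tagged_sum !big_ord_recr /= rK1 rK -addrA; congr (_ + _).
    by apply: eq_bigr => k _; rewrite /r ltn_ord ltnW.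
  by rewrite -(lin_mapD (linRes _)); congr (Res _ _); rewrite [RHS]addrC addrA subrK.
Qed.

Lemma conv_approx_second_moment (lam : R) m t :
  let G := path_event Z Tm (fun x => `|x| - lam) in
  0 < lam -> ((7 / 8)%:E <= P G)%E -> t <= T ->
  (\int[P]_(w in G) (`|conv_approx m t w| ^+ 2)%:E <=
   (2624 * (M * lam) ^+ 2)%:E)%E.
Proof.
move=> G l0 PG tT.
pose B k x := if grid m k < t then Res (t - grid m k) x else 0.
have -> : (\int[P]_(w in G) (`|conv_approx m t w| ^+ 2)%:E =
  \int[P]_(w in G) (`|\sum_(k < m.+1) B k (Z (grid m k.+1) w - Z (grid m k) w)| ^+ 2)%:E)%E.
  by apply: eq_integral => w _.
apply: (levy_second_moment hip x_dense levyZ) => //.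
- by rewrite grid0.
- by move=> k _; rewrite grid_lt.
- by rewrite gridm.
- move=> k _ c x y; rewrite /B; case: ifP => _; first exact: linRes.
  by rewrite scaler0 addr0.
- move=> k _ x; rewrite /B; case: ifPn => kt; last by rewrite normr0 mulr_ge0.
  by apply: leRes; have := grid_ge0 m k; lra.
Qed.

(** Stationarity reduces every increment to one starting at time 0, so continuity in probability at
    0 suffices and is uniform in [s]. *)
Lemma levy_unif_cont_prob (eps eta : R) : 0 < eps -> 0 < eta ->
  exists2 delta, 0 < delta & forall s t, 0 <= s -> s <= t <= s + delta ->
    (P [set w | (eps < `|Z t w - Z s w|)%R] <= eta%:E)%E.
Proof.
move=> eps0 eta0; have [[Z0 mZ] ind stat contP cZ] := levyZ.
have [del [del0 h]] := contP 0 (lexx 0) eps eta eps0 eta0.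
exists (del / 2); first by rewrite divr_gt0.
move=> s t s0 /andP[st ts].
pose B := [set x : H | eps < `|x|].
have bB : borelH B.
  apply: borelH_open; rewrite (_ : B = (fun x : H => `|x|) @^-1` [set r | eps < r])//.
  by apply: open_comp; [move=> x _; exact: norm_continuous|exact: open_gt].
rewrite (stat s t s0 st B bB).
apply: le_trans (ltW (h (t - s) _ _)).
- by rewrite (_ : [set w | B (Z (t - s) w)] = [set w | eps < `|Z (t - s) w - Z 0 w|])//;
    apply/seteqP; split => w /=; rewrite Z0 subr0.
- by rewrite subr_ge0.
- by rewrite subr0 ger0_norm ?subr_ge0//; lra.
Qed.

Lemma measurable_gt_norm (X : Omega -> H) (e : R) :
  Hmeasurable X -> measurable [set w | e < `|X w|].
Proof.
move=> mX; rewrite (_ : mkset _ = setT `&` (fun w => `|X w|) @^-1` `]e, +oo[).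
  exact: (Hmeasurable_norm mX).
by apply/seteqP; split => w /=; rewrite in_itv /= andbT; [split|case].
Qed.

Lemma conv_approx_close (eps eta : R) : 0 < eps -> 0 < eta ->
  exists2 delta, 0 < delta & forall m t n r c, 2 * mesh m <= delta -> 0 <= t <= T ->
    tagged_subdivision t delta n r c ->
    exists E, [/\ measurable E, (P E <= eta%:E)%E & forall w, ~ E w ->
      `|tagged_sum Res (Z ^~ w) n r c - conv_approx m t w| <= eps].
Proof.
move=> eps0 eta0.
have e2 : 0 < eps / 2 by rewrite divr_gt0.
have n2 : 0 < eta / 2 by rewrite divr_gt0.
have M1 : 0 < M + 1 by rewrite ltr_wpDl.
have eM : 0 < eps / 2 / (M + 1) by rewrite divr_gt0.
have [d1 d10 h1] := tagged_sum_cauchy hip x_dense levyZ T_ge0 M_ge0 linRes leRes cRes e2 n2.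
have [d2 d20 h2] := levy_unif_cont_prob eM n2.
exists (Num.min d1 d2); first by rewrite lt_min d10.
move=> m t n r c; rewrite le_min => /andP[md1 md2] tT ts.
have [n' [r' [c' [u [v [ts' uT tv WE]]]]]] := conv_approx_tagged m tT.
have d12 : Num.min d1 d2 <= d1 by rewrite ge_min lexx.
have [E1 [mE1 PE1 hE1]] := h1 t n r c n' r' c' tT (tagged_subdivision_weaken d12 ts)
  (tagged_subdivision_weaken md1 ts').
have t0 : 0 <= t by case/andP: tT.
have PE2 : (P [set w | (eps / 2 / (M + 1) < `|Z v w - Z t w|)%R] <= (eta / 2)%:E)%E.
  by apply: h2 => //; have := mesh_gt0 m; lra.
have mE2 : measurable [set w | eps / 2 / (M + 1) < `|Z v w - Z t w|].
  apply: measurable_gt_norm; apply: (levy_incr_measurable hip x_dense levyZ) => //.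
  by case/andP: tv => + _; exact: le_trans.
exists (E1 `|` [set w | eps / 2 / (M + 1) < `|Z v w - Z t w|]); split.
- exact: measurableU.
- apply: le_trans; first by apply: measureU2.
  apply: le_trans; first by apply: leeD; [exact: PE1|exact: PE2].
  by rewrite -EFinD lee_fin; lra.
- move=> w /not_orP[/hE1 hw /negP]; rewrite -leNgt => hv.
  rewrite WE opprD addrA; apply: (le_trans (ler_normB _ _)).
  have : `|Res u (Z v w - Z t w)| <= eps / 2.
    apply: (le_trans (leRes _ uT)).
    apply: (@le_trans _ _ ((M + 1) * (eps / 2 / (M + 1)))); last by rewrite mulrC divfK ?gt_eqF.
    by apply: ler_pM => //; rewrite lerDl.
  lra.
Qed.

Lemma mesh_small (e : R) : 0 < e -> exists m0, forall m, (m0 <= m)%N -> 2 * mesh m <= e.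
Proof.
move=> e0; exists (Num.truncn (2 * Tm / e)) => m mm.
rewrite /mesh mulrA ler_pdivrMr// [leRHS]mulrC -ler_pdivrMr//.
apply: (le_trans (ltW (truncnS_gt _))); by rewrite ler_nat.
Qed.

Lemma conv_approx_cauchy (eps eta : R) : 0 < eps -> 0 < eta ->
  exists m0, forall m m' t, (m0 <= m)%N -> (m0 <= m')%N -> 0 <= t <= T ->
    exists E, [/\ measurable E, (P E <= eta%:E)%E & forall w, ~ E w ->
      `|conv_approx m t w - conv_approx m' t w| <= eps].
Proof.
move=> eps0 eta0.
have e2 : 0 < eps / 2 by rewrite divr_gt0.
have n2 : 0 < eta / 2 by rewrite divr_gt0.
have [del del0 h] := conv_approx_close e2 n2.
have [m0 hm0] := mesh_small del0; exists m0 => m m' t mm mm' tT.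
have [n [r [c [u [v [ts _ _ _]]]]]] := conv_approx_tagged m tT.
have ts' := tagged_subdivision_weaken (hm0 m mm) ts.
have [E [mE PE hE]] := h m t n r c (hm0 m mm) tT ts'.
have [E' [mE' PE' hE']] := h m' t n r c (hm0 m' mm') tT ts'.
exists (E `|` E'); split; first exact: measurableU.
- apply: le_trans; first by apply: measureU2.
  apply: le_trans; first by apply: leeD; [exact: PE|exact: PE'].
  by rewrite -EFinD lee_fin; lra.
- move=> w /not_orP[/hE h1 /hE' h2].
  have := ler_distD (tagged_sum Res (Z ^~ w) n r c) (conv_approx m t w) (conv_approx m' t w).
  rewrite (distrC _ (tagged_sum _ _ _ _ _)); lra.
Qed.

End approximation.

(** * Limits along a rapidly convergent subsequence *)

Section half_powers.
Context {R : realType}.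

Local Notation q j := ((2^-1 : R) ^+ j).

Lemma sum_half_powers J N : (J <= N)%N ->
  \sum_(J <= j < N) q j = 2 * q J - 2 * q N.
Proof.
elim: N => [|N ih]; first by rewrite leqn0 => /eqP ->; rewrite big_geq// subrr.
rewrite leq_eqVlt => /orP[/eqP ->|JN]; first by rewrite big_geq// subrr.
by rewrite big_nat_recr//= ih// exprS; lra.
Qed.

Lemma sum_half_powers_le J N : \sum_(J <= j < N) q j <= 2 * q J.
Proof.
have [JN|NJ] := leqP J N; last by rewrite big_geq ?(ltnW NJ)// mulr_ge0// exprn_ge0// invr_ge0.
by rewrite sum_half_powers// lerBlDr lerDl mulr_ge0// exprn_ge0// invr_ge0.
Qed.

Lemma half_powers_small (e : R) : 0 < e -> exists J, forall j, (J <= j)%N -> 2 * q j <= e.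
Proof.
move=> e0; have e2 : 0 < e / 2 by rewrite divr_gt0.
have : (fun j => q j) @ \oo --> (0 : R).
  by apply: cvg_expr; rewrite ger0_norm ?invr_ge0// invf_lt1// ltr1n.
move=> /cvgr0Pnorm_lt/(_ _ e2)[J _ hJ]; exists J => j Jj.
have := hJ j Jj; rewrite /= ger0_norm ?exprn_ge0 ?invr_ge0// => h; lra.
Qed.

Lemma prob_bigcup_half_powers {d : measure_display} {T : measurableType d}
    (P : probability T R) (E : nat -> set T) J :
  (forall j, measurable (E j)) -> (forall j, (P (E j) <= (q j)%:E)%E) ->
  (P (\bigcup_(j in [set j | (J <= j)%N]) E j) <= (2 * q J)%:E)%E.
Proof.
move=> mE PE.
pose U N := \bigcup_(j in [set j | (J <= j < N)%N]) E j.
have mU N : measurable (U N) by apply: bigcup_measurable => j _.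
have PU N : (P (U N) <= (\sum_(J <= j < N) q j)%:E)%E.
  elim: N => [|N ih].
    rewrite big_geq// /U (_ : [set j | _] = set0) ?bigcup_set0 ?measure0//.
    by apply/seteqP; split => // j /=; rewrite ltn0 andbF.
  have [JN|NJ] := leqP J N; last first.
    rewrite big_geq// /U (_ : [set j | _] = set0) ?bigcup_set0 ?measure0//.
    by apply/seteqP; split => // j /= /andP[]; lia.
  have -> : U N.+1 = U N `|` E N.
    apply/seteqP; split => w.
      move=> [j /= /andP[Jj]]; rewrite ltnS leq_eqVlt => /orP[/eqP ->|jN] Ej; first by right.
      by left; exists j => //=; rewrite Jj.
    move=> [[j /= /andP[Jj jN] Ej]|EN]; last by exists N => //=; rewrite JN leqnn.
    by exists j => //=; rewrite Jj ltnW.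
  apply: le_trans; first by apply: measureU2.
  by rewrite big_nat_recr//= EFinD; apply: leeD.
rewrite (_ : \bigcup_(j in _) _ = \bigcup_N U N); last first.
  apply/seteqP; split => w.
    by move=> [j /= Jj Ej]; exists j.+1 => //; exists j => //=; rewrite Jj leqnn.
  by move=> [N _ [j /= /andP[Jj _] Ej]]; exists j.
have ndU : nondecreasing_seq U.
  move=> n m nm; apply/subsetPset => w [j /= /andP[Jj jn] Ej]; exists j => //=.
  by rewrite Jj (leq_trans jn).
have cvU := nondecreasing_cvg_mu (mu := P) mU (bigcupT_measurable _ mU) ndU.
rewrite -(cvg_lim (@ereal_hausdorff R) cvU); apply: lime_le.
  by apply/cvg_ex; eexists; exact: cvU.
by apply: nearW => N /=; apply: (le_trans (PU N)); rewrite lee_fin sum_half_powers_le.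
Qed.

End half_powers.

Section fast_limit.
Context {R : realType} {H : completeNormedModType R} (ip : H -> H -> R).
Hypothesis hip : is_inner_product ip.
Context (x_ : nat -> H)
  (x_dense : forall y (e : R), 0 < e -> exists n, `|y - x_ n| < e).
Context {d : measure_display} {S : measurableType d}.
Variable V : nat -> S -> H.
Hypothesis mV : forall j, Hmeasurable (V j).

Local Notation q j := ((2^-1 : R) ^+ j).

Definition variation N z : R := \sum_(0 <= j < N) `|V j.+1 z - V j z|.

(** Summability of the successive differences serves as the convergence criterion: it is visibly
    measurable, and completeness then yields the limit. *)
Definition finite_variation : set S :=
  \bigcup_(K : nat) \bigcap_(N : nat) [set z | variation N z <= K%:R].

Lemma measurable_finite_variation : measurable finite_variation.
Proof.
apply: bigcupT_measurable => K; apply: bigcapT_measurable => N.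
have mvar : measurable_fun setT (variation N).
  apply: measurable_sum => j; apply: Hmeasurable_norm.
  exact: (Hmeasurable_sub hip x_dense).
rewrite (_ : mkset _ = setT `&` variation N @^-1` `]-oo, K%:R]); first exact: mvar.
by apply/seteqP; split => z /=; rewrite in_itv /=; [split|case].
Qed.

Lemma telescope_V N z : V N z = V 0%N z + \sum_(0 <= j < N) (V j.+1 z - V j z).
Proof. by rewrite telescope_sumr// addrC subrK. Qed.

Lemma finite_variation_cvg z : finite_variation z -> cvgn (V ^~ z).
Proof.
move=> [K _ hK].
have cs : cvgn (series (fun j => V j.+1 z - V j z)).
  apply: normed_cvg; apply: nondecreasing_is_cvgn.
    apply/nondecreasing_seqP => n.
    by rewrite /normed_series_of /series /= big_nat_recr//= lerDl.
  by exists K%:R => _ [N _ <-]; exact: (hK N Logic.I).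
have -> : V ^~ z = (fun N => V 0%N z + series (fun j => V j.+1 z - V j z) N).
  by apply/funext => N; rewrite [LHS]telescope_V.
by apply: is_cvgD => //; exact: is_cvg_cst.
Qed.

Definition fast_lim z : H := if z \in finite_variation then limn (V ^~ z) else 0.

Lemma fast_lim_cvg z :
  (fun j => if z \in finite_variation then V j z else 0) @ \oo --> fast_lim z.
Proof.
rewrite /fast_lim; case: ifPn => [/set_mem fz|_]; last exact: cvg_cst.
exact: finite_variation_cvg.
Qed.

Lemma Hmeasurable_fast_lim : Hmeasurable fast_lim.
Proof.
apply: (weakly_measurable_Hmeasurable hip x_dense) => y.
apply: (@measurable_fun_cvg _ _ _ _
  (fun j z => \1_finite_variation z * ip (V j z) y)).
  move=> j; apply: measurable_funM; last exact: (Hmeasurable_ip hip y (mV j)).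
  by apply: measurable_indic; exact: measurable_finite_variation.
move=> z _.
have -> : (fun j => \1_finite_variation z * ip (V j z) y) =
  (fun j => ip (if z \in finite_variation then V j z else 0) y).
  apply/funext => j; rewrite indicE; case: (_ \in _); first by rewrite mul1r.
  by rewrite mul0r (ip0l hip).
apply: (@cvg_comp _ _ _ (fun j => if z \in finite_variation then V j z else 0)
  (ip ^~ y)); [exact: fast_lim_cvg|exact: (ip_continuousl hip)].
Qed.

Lemma fast_lim_close z J : (forall j, (J <= j)%N -> `|V j.+1 z - V j z| <= q j) ->
  V ^~ z @ \oo --> fast_lim z /\ `|V J z - fast_lim z| <= 2 * q J.
Proof.
move=> hV.
have fz : finite_variation z.
  exists (Num.truncn (variation J z + 2 * q J)).+1 => // N _ /=.
  apply: (le_trans _ (ltW (truncnS_gt _))).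
  have v0 (a b : nat) : 0 <= \sum_(a <= j < b) `|V j.+1 z - V j z|.
    by apply: sumr_ge0.
  have [NJ|JN] := leqP N J.
    rewrite /variation [in leRHS](big_cat_nat (leq0n N) NJ)//= -addrA lerDl.
    apply: addr_ge0; first exact: v0.
    by rewrite mulr_ge0// exprn_ge0// invr_ge0.
  rewrite /variation (big_cat_nat (leq0n J) (ltnW JN))//= lerD2l.
  apply: le_trans (sum_half_powers_le J N).
  by rewrite ler_sum_nat// => j /andP[Jj _]; exact: hV.
have cv : V ^~ z @ \oo --> fast_lim z.
  by rewrite /fast_lim mem_set//; exact: finite_variation_cvg.
split => //.
have cn : (fun N => `|V J z - V N z|) @ \oo --> `|V J z - fast_lim z|.
  by apply: cvg_norm; apply: cvgB => //; exact: cvg_cst.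
rewrite -(cvg_lim (@Rhausdorff R) cn); apply: limr_le.
  by apply/cvg_ex; eexists; exact: cn.
near=> N; have JN : (J <= N)%N by near: N; exists J.
rewrite distrC -(telescope_sumr (fun j => V j z) JN).
apply: (le_trans (ler_norm_sum _ _ _)); apply: le_trans (sum_half_powers_le J N).
by rewrite ler_sum_nat// => j /andP[Jj _]; exact: hV.
Unshelve. all: by end_near. Qed.

End fast_limit.

(** * Joint measurability in time and chance *)

Section joint_measurability.
Context {R : realType} {H : normedModType R} (ip : H -> H -> R).
Hypothesis hip : is_inner_product ip.
Context (x_ : nat -> H)
  (x_dense : forall y (e : R), 0 < e -> exists n, `|y - x_ n| < e).
Context {d : measure_display} {Omega : measurableType d}.
Variable Res : R -> H -> H.
Hypothesis linRes : forall t c x y, Res t (c *: x + y) = c *: Res t x + Res t y.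
Hypothesis bRes : forall T, 0 <= T -> exists M : R, forall t x,
  0 <= t <= T -> `|Res t x| <= M * `|x|.
Hypothesis cRes : forall x, {within [set t : R | 0 <= t], continuous (fun t => Res t x)}.

Lemma resolvent_continuous u : 0 <= u -> continuous (Res u).
Proof.
move=> u0; have [M hM] := bRes u0.
by apply: (lin_bounded_continuous (linRes u)) => x; apply: hM; rewrite u0 lexx.
Qed.

(** Expanding [X] along the Gram-Schmidt vectors gives finite sums of products of a function of [w]
    and a continuous function of time. They converge because each [Res u] is bounded. *)
Lemma measurable_fun_resolvent (a : R) (X : Omega -> H) y : Hmeasurable X ->
  measurable_fun setT (fun z : R * Omega => ip (Res (Num.max (z.1 - a) 0) (X z.2)) y).
Proof.
move=> mX.
apply: (@measurable_fun_cvg _ _ _ _ (fun n (z : R * Omega) => \sum_(i < n)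
   ip (X z.2) (ortho_vec ip x_ i) * ip (Res (Num.max (z.1 - a) 0) (ortho_vec ip x_ i)) y)).
  move=> n; apply: measurable_sum => i; apply: measurable_funM.
    exact: (measurableT_comp (Hmeasurable_ip hip _ mX) measurable_snd).
  apply: (measurableT_comp (f := fun t : R => ip (Res (Num.max (t - a) 0) (ortho_vec ip x_ i)) y)
    _ measurable_fst).
  apply: continuous_measurable_fun => t.
  apply: (@cvg_comp _ _ _ (fun t : R => Res (Num.max (t - a) 0) (ortho_vec ip x_ i)) (ip ^~ y)).
    apply: (@cvg_comp _ _ _ (fun t : R => t - a)
      (fun u : R => Res (Num.max u 0) (ortho_vec ip x_ i)) _ (nbhs (t - a))).
      by apply: cvgB; [exact: cvg_id|exact: cvg_cst].
    exact: (continuous_max0 (cRes (x := ortho_vec ip x_ i))).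
  exact: (ip_continuousl hip).
move=> z _; set u := Num.max _ _.
have u0 : 0 <= u by rewrite /u le_max lexx orbT.
have -> : (fun n => \sum_(i < n) ip (X z.2) (ortho_vec ip x_ i) *
    ip (Res u (ortho_vec ip x_ i)) y) = (fun n => ip (Res u (ortho_proj ip x_ n (X z.2))) y).
  apply/funext => n; rewrite (ortho_projE ip) (lin_map_sum (linRes u)) (ip_suml hip).
  by apply: eq_bigr => i _; rewrite (lin_mapZ (linRes u) (ip (X z.2) _)) (ipZl hip).
apply: (@cvg_comp _ _ _ (fun n => Res u (ortho_proj ip x_ n (X z.2))) (ip ^~ y)).
  apply: (@cvg_comp _ _ _ (fun n => ortho_proj ip x_ n (X z.2)) (Res u)).
    exact: (cvg_ortho_proj hip).
  exact: resolvent_continuous.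
exact: (ip_continuousl hip).
Qed.

Variables (Z : R -> Omega -> H) (T : R).
Hypothesis T_ge0 : 0 <= T.
Hypothesis mZ : forall s t, 0 <= s -> 0 <= t -> Hmeasurable (fun w => Z t w - Z s w).

Lemma Hmeasurable_conv_approx m :
  Hmeasurable (fun z : R * Omega => conv_approx Z Res T m z.1 z.2).
Proof.
apply: (weakly_measurable_Hmeasurable hip x_dense) => y.
(* Where the indicator is 1 the clamp is inactive. *)
have -> : (fun z : R * Omega => ip (conv_approx Z Res T m z.1 z.2) y) = (fun z =>
    \sum_(k < m.+1) \1_[set t | grid T m k < t] z.1 *
      ip (Res (Num.max (z.1 - grid T m k) 0) (Z (grid T m k.+1) z.2 - Z (grid T m k) z.2)) y).
  apply/funext => z; rewrite /conv_approx (ip_suml hip); apply: eq_bigr => k _.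
  rewrite indicE; case: ifPn => kt.
    by rewrite mem_set// mul1r max_l// subr_ge0 ltW.
  by rewrite memNset ?mul0r ?(ip0l hip)//=; exact/negP.
apply: measurable_sum => k; apply: measurable_funM.
  have mI : measurable_fun setT (\1_[set t : R | grid T m k < t] : R -> R).
    apply: measurable_indic; rewrite (_ : mkset _ = `]grid T m k, +oo[%classic).
      exact: measurable_itv.
    by apply/seteqP; split => t /=; rewrite in_itv /= andbT.
  exact: (measurableT_comp mI measurable_fst).
exact: (measurable_fun_resolvent (grid T m k) y
  (mZ (grid_ge0 T_ge0 m k) (grid_ge0 T_ge0 m k.+1))).
Qed.

End joint_measurability.

Section joint_sections.
Context {R : realType} {H : normedModType R} {d : measure_display} {Omega : measurableType d}.
Variable Y : R * Omega -> H.
Hypothesis mY : Hmeasurable Y.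

Lemma Hmeasurable_section_omega t : Hmeasurable (fun w => Y (t, w)).
Proof.
move=> B bB; rewrite (_ : _ @^-1` _ = xsection (Y @^-1` B) t).
  by apply: measurable_xsection; exact: mY.
by apply/seteqP; split => w /=; rewrite /xsection /= inE.
Qed.

Lemma Hmeasurable_section_time w : Hmeasurable (fun t : R => Y (t, w)).
Proof.
move=> B bB; rewrite (_ : _ @^-1` _ = ysection (Y @^-1` B) w).
  by apply: measurable_ysection; exact: mY.
by apply/seteqP; split => t /=; rewrite /ysection /= inE.
Qed.

End joint_sections.

(** * Construction of the limit process *)

Section process.
Context {R : realType} {H : completeNormedModType R} (ip : H -> H -> R).
Hypothesis hip : is_inner_product ip.
Context (x_ : nat -> H)
  (x_dense : forall y (e : R), 0 < e -> exists n, `|y - x_ n| < e).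
Context {d : measure_display} {Omega : measurableType d} (P : probability Omega R).
Variables (Z : R -> Omega -> H) (Res : R -> H -> H) (T M : R).
Hypothesis levyZ : levy_process P Z.
Hypothesis T_ge0 : 0 <= T.
Hypothesis M_ge0 : 0 <= M.
Hypothesis linRes : forall t c x y, Res t (c *: x + y) = c *: Res t x + Res t y.
Hypothesis bRes : forall T, 0 <= T -> exists M : R, forall t x,
  0 <= t <= T -> `|Res t x| <= M * `|x|.
Hypothesis leRes : forall t x, 0 <= t <= T -> `|Res t x| <= M * `|x|.
Hypothesis cRes : forall x, {within [set t : R | 0 <= t], continuous (fun t => Res t x)}.

Local Notation W := (conv_approx Z Res T).
Local Notation q j := ((2^-1 : R) ^+ j).

(* [Y] is the a.s. limit, for each fixed time, of [W] along [sub]; [C] is a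
   measurable set outside which [Y] vanishes. *)
Definition approx_limit (sub : nat -> nat) (C : set (R * Omega)) (Y : R * Omega -> H) :=
  [/\ (forall j, (j <= sub j)%N), measurable C, Hmeasurable Y,
      (forall z, (fun j => if z \in C then W (sub j) z.1 z.2 else 0) @ \oo --> Y z)
    & (forall t J, 0 <= t <= T -> exists F, [/\ measurable F, (P F <= (2 * q J)%:E)%E
        & forall w, ~ F w -> (fun j => W (sub j) t w) @ \oo --> Y (t, w) /\
            `|W (sub J) t w - Y (t, w)| <= 2 * q J])].

Lemma approx_limit_exists : exists sub C Y, approx_limit sub C Y.
Proof.
have q0 j : 0 < q j by rewrite exprn_gt0// invr_gt0.
have /choice[f hf] : forall j, exists m0, forall m m' t, (m0 <= m)%N -> (m0 <= m')%N ->
    0 <= t <= T -> exists E, [/\ measurable E, (P E <= (q j)%:E)%E & forall w, ~ E w ->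
      `|W m t w - W m' t w| <= q j].
  move=> j.
  exact: (conv_approx_cauchy hip x_dense levyZ T_ge0 M_ge0 linRes leRes cRes (q0 j) (q0 j)).
(* Since [sub j] dominates [f 0], ..., [f j], both [sub j] and [sub j.+1] lie beyond [f j], which
   makes consecutive approximants close at rate [q j]. *)
pose sub j := (j + \sum_(i < j.+1) f i)%N.
have subj j : (j <= sub j)%N by rewrite leq_addr.
have fsub i j : (i <= j)%N -> (f i <= sub j)%N.
  move=> ij; apply: leq_trans (leq_addl j _).
  have ij' : (i < j.+1)%N by [].
  by rewrite (bigD1 (Ordinal ij'))//= leq_addr.
pose V j (z : R * Omega) := W (sub j) z.1 z.2.
have mV j : Hmeasurable (V j).
  apply: (Hmeasurable_conv_approx hip x_dense linRes bRes cRes T_ge0).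
  exact: (levy_incr_measurable hip x_dense levyZ).
exists sub, (finite_variation V), (fast_lim V); split => //.
- exact: (measurable_finite_variation hip x_dense).
- exact: (Hmeasurable_fast_lim hip x_dense).
- exact: fast_lim_cvg.
move=> t J tT.
have /choice[E hE] : forall j, exists E, [/\ measurable E, (P E <= (q j)%:E)%E & forall w, ~ E w ->
      `|W (sub j.+1) t w - W (sub j) t w| <= q j].
  by move=> j; apply: hf => //; exact: fsub.
exists (\bigcup_(j in [set j | (J <= j)%N]) E j); split.
- by apply: bigcup_measurable => j _; case: (hE j).
- by apply: prob_bigcup_half_powers => j; case: (hE j).
- move=> w nE; apply: (fast_lim_close (V := V) (z := (t, w)) (J := J)) => j Jj.
  case: (hE j) => _ _; apply => Ej; apply: nE; by exists j.
Qed.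

Variables (sub : nat -> nat) (C : set (R * Omega)) (Y : R * Omega -> H).
Hypothesis limY : approx_limit sub C Y.

Lemma Hmeasurable_riemann_sum t delta n p s : t <= T -> tagged_partition t delta n p s ->
  Hmeasurable (riemann_sum Res Z t n p s).
Proof.
move=> tT [p0 pn pS _ ps].
apply: (Hmeasurable_sum hip x_dense
  (X := fun k w => Res (s k.+1) (Z (t - p k) w - Z (t - p k.+1) w))) => k kn.
have pk (i : nat) : (i <= n)%N -> 0 <= t - p i.
  by move=> i_n; rewrite subr_ge0 -pn; exact: (incr_mono pS).
have sk : 0 <= s k.+1.
  have /andP[h _] := ps k kn; apply: le_trans h; rewrite -p0.
  by apply: (incr_mono pS) => //; exact: ltnW.
apply: Hmeasurable_comp; first exact: (resolvent_continuous linRes bRes).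
by apply: (levy_incr_measurable hip x_dense levyZ); apply: pk => //; exact: ltnW.
Qed.

Lemma approx_limit_stoch_conv t : 0 <= t <= T ->
  is_stoch_conv P Res Z t (fun w => Y (t, w)).
Proof.
move=> tT eps eta eps0 eta0; have [subj _ mY _ hY] := limY.
have e2 : 0 < eps / 2 by rewrite divr_gt0.
have n3 : 0 < eta / 3 by rewrite divr_gt0.
have [del del0 hdel] :=
  conv_approx_close hip x_dense levyZ T_ge0 M_ge0 linRes leRes cRes e2 n3.
exists del; split => // n p s tp.
have [ts rE] := riemann_sum_tagged Res Z tp.
have [J1 hJ1] := half_powers_small e2.
have [J2 hJ2] := half_powers_small n3.
have [m0 hm0] := mesh_small T del0.
pose J := maxn (maxn J1 J2) m0.
have mJ : 2 * mesh T (sub J) <= del by apply: hm0; apply: leq_trans (subj J); rewrite leq_maxr.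
have [E [mE PE hE]] := hdel (sub J) t _ _ _ mJ tT ts.
have [F [mF PF hF]] := hY t J tT.
have q1 : 2 * q J <= eps / 2 by apply: hJ1; rewrite /J !leq_max leqnn.
have q2 : 2 * q J <= eta / 3 by apply: hJ2; rewrite /J !leq_max leqnn orbT.
apply: (@le_lt_trans _ _ (P (E `|` F))); last first.
  apply: le_lt_trans; first by apply: measureU2.
  apply: le_lt_trans; first by apply: leeD; [exact: PE|exact: PF].
  by rewrite -EFinD lte_fin; lra.
have tT' : t <= T by case/andP: tT.
apply: le_measure; rewrite ?inE.
- apply: (measurable_gt_norm (X := fun w => riemann_sum Res Z t n p s w - Y (t, w))).
  apply: (Hmeasurable_sub hip x_dense); first exact: Hmeasurable_riemann_sum tp.
  exact: Hmeasurable_section_omega.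
- exact: measurableU.
move=> w /=; apply: contraPP => /not_orP[nE nF]; apply/negP; rewrite -leNgt.
have := hE w nE; rewrite -rE => h1; have [_ h2] := hF w nF.
have := ler_distD (W (sub J) t w) (riemann_sum Res Z t n p s w) (Y (t, w)); lra.
Qed.

Local Notation bounded_event lam := (path_event Z (T + 1) (fun x => `|x| - lam)).

(** The approximants cut off outside [C] converge everywhere, so Fatou's lemma applies without
    exceptional sets, and the cut-off can only decrease the norm. *)
Lemma approx_limit_second_moment (lam t : R) : 0 < lam ->
  ((7 / 8)%:E <= P (bounded_event lam))%E -> t <= T ->
  (\int[P]_(w in bounded_event lam) (`|Y (t, w)| ^+ 2)%:E <= (2624 * (M * lam) ^+ 2)%:E)%E.
Proof.
move=> l0 PG tT; have [subj mC mY cY hY] := limY.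
have [[Z0 mZ] _ _ _ cZ] := levyZ.
have mG : measurable (bounded_event lam).
  apply: measurable_path_event => //; first by have := T_ge0; lra.
  by move=> x; apply: cvgB; [exact: norm_continuous|exact: cvg_cst].
pose X j w := if (t, w) \in C then W (sub j) t w else 0.
have mW j : Hmeasurable (fun w => W (sub j) t w).
  apply: (Hmeasurable_section_omega (Y := fun z => W (sub j) z.1 z.2)).
  apply: (Hmeasurable_conv_approx hip x_dense linRes bRes cRes T_ge0).
  exact: (levy_incr_measurable hip x_dense levyZ).
have XE j : (fun w => (`|X j w| ^+ 2)%:E) =
    (fun w => (\1_(xsection C t) w * `|W (sub j) t w| ^+ 2)%:E).
  apply/funext => w; rewrite indicE /X mem_xsection; case: (_ \in C); rewrite ?mul1r//.
  by rewrite normr0 expr0n mul0r.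
have mX j : measurable_fun setT (fun w => \1_(xsection C t) w * `|W (sub j) t w| ^+ 2 : R).
  apply: measurable_funM; first by apply: measurable_indic; exact: measurable_xsection.
  by apply: measurable_funX; exact: (Hmeasurable_norm (mW j)).
apply: (fatou_cvg_le (f_ := fun j w => (`|X j w| ^+ 2)%:E)) => //.
- by move=> j; rewrite XE; apply/measurable_funTS/measurable_EFinP.
- move=> w _; apply: cvg_EFin; first exact: nearW.
  rewrite /comp /= expr2; under eq_fun do rewrite expr2.
  by apply: cvgM; apply: cvg_norm; exact: cY.
exists 0%N => j _.
apply: le_trans (conv_approx_second_moment hip x_dense levyZ T_ge0 M_ge0 linRes leRes
  (sub j) l0 PG tT).
apply: ge0_le_integral => //.
- by rewrite XE; apply/measurable_funTS/measurable_EFinP.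
- apply/measurable_funTS/measurable_EFinP.
  by apply: measurable_funX; exact: (Hmeasurable_norm (mW j)).
- move=> w _; rewrite lee_fin /X; case: ifP => // _.
  by rewrite normr0 expr0n sqr_ge0.
Qed.

End process.

Section exceptional_sets.
Context {R : realType} {d : measure_display} {Omega : measurableType d}
  (P : probability Omega R).

(** Borel-Cantelli along the powers of [1 / 2]: points lying in infinitely many of the sets [B j]
    form a null set. [Q] need not be monotone in [e], so it is obtained at some smaller [e']. *)
Lemma null_exception (Q : R -> Omega -> Prop) :
  (forall e, 0 < e -> exists B, [/\ measurable B, (P B <= e%:E)%E &
     forall w, ~ B w -> Q e w]) ->
  exists N, [/\ measurable N, P N = 0%E & forall w, ~ N w -> forall e, 0 < e ->
     exists e', [/\ 0 < e', e' <= e & Q e' w] ].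
Proof.
move=> h; have q0 j : 0 < (2^-1 : R) ^+ j by rewrite exprn_gt0// invr_gt0.
have /choice[B hB] := fun j => h _ (q0 j).
pose U J := \bigcup_(j in [set j | (J <= j)%N]) B j.
have mU J : measurable (U J) by apply: bigcup_measurable => j _; case: (hB j).
have PU J : (P (U J) <= (2 * (2^-1 : R) ^+ J)%:E)%E.
  by apply: prob_bigcup_half_powers => j; case: (hB j).
have mN : measurable (\bigcap_J U J) by exact: bigcapT_measurable.
exists (\bigcap_J U J); split => //.
  apply/eqP; rewrite eq_le measure_ge0 andbT; apply/lee_addgt0Pr => e e0.
  have [J hJ] := half_powers_small e0; rewrite add0e.
  apply: (@le_trans _ _ (P (U J))).
    by apply: le_measure; rewrite ?inE//; move=> w; exact.
  by apply: (le_trans (PU J)); rewrite lee_fin hJ.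
move=> w /existsNP[J /not_implyP[_ nU]] e e0.
have [K hK] := half_powers_small e0.
exists ((2^-1 : R) ^+ maxn J K); split => //.
- have := hK (maxn J K) (leq_maxr _ _); have := q0 (maxn J K); lra.
- case: (hB (maxn J K)) => _ _; apply => Bw; apply: nU.
  by exists (maxn J K) => //=; exact: leq_maxl.
Qed.

End exceptional_sets.

(** * Weighted time integrals and Tonelli's theorem *)

Section weighted_tonelli.
Context {R : realType} {d : measure_display} {Omega : measurableType d}
  (P : probability Omega R).
Local Notation mu := (@lebesgue_measure R).
Variables (I : set R) (rho : R -> R) (f : R * Omega -> R).
Hypotheses (mI : measurable I) (mrho : measurable_fun I rho)
  (rho0 : forall s, I s -> 0 <= rho s) (mf : measurable_fun setT f)
  (f0 : forall z, 0 <= f z).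

Let r := rho \_ I.

Let mr : measurable_fun setT r. Proof. exact/(measurable_restrictT _ _).1. Qed.

Let r0 s : 0 <= r s.
Proof. by rewrite /r /patch; case: ifPn => // /set_mem; exact: rho0. Qed.

Let weightedE w : (\int[mu]_(s in I) (rho s * f (s, w))%:E = \int[mu]_s (r s * f (s, w))%:E)%E.
Proof.
rewrite integral_mkcond; apply: eq_integral => s _.
by rewrite /r /patch; case: ifP => // _; rewrite mul0r.
Qed.

Lemma measurable_fun_weighted :
  measurable_fun setT (fun w => \int[mu]_(s in I) (rho s * f (s, w))%:E)%E.
Proof.
under eq_fun do rewrite weightedE.
apply: (measurable_fun_fubini_tonelli_G (m1 := mu) (fun z => (r z.1 * f z)%:E)).
  by apply/measurable_EFinP/measurable_funM => //; exact: (measurableT_comp mr).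
by move=> z; rewrite lee_fin mulr_ge0.
Qed.

Lemma weighted_tonelli (G : set Omega) (kappa A : R) :
  measurable G -> 0 <= kappa ->
  (forall s, I s -> (\int[P]_(w in G) (f (s, w))%:E <= kappa%:E)%E) ->
  (\int[mu]_(s in I) (rho s)%:E <= A%:E)%E ->
  (\int[P]_(w in G) \int[mu]_(s in I) (rho s * f (s, w))%:E <= (kappa * A)%:E)%E.
Proof.
move=> mG k0 fk rA.
pose h (z : R * Omega) := (r z.1 * (f z * \1_G z.2))%:E.
have mg : measurable_fun setT (fun z : R * Omega => f z * \1_G z.2).
  apply: measurable_funM => //.
  have m1 : measurable_fun setT (\1_G : Omega -> R) by exact: measurable_indic.
  exact: (measurableT_comp m1 measurable_snd).
have g0 z : 0 <= f z * \1_G z.2 by rewrite mulr_ge0.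
have mh : measurable_fun setT h.
  by apply/measurable_EFinP/measurable_funM => //; exact: (measurableT_comp mr).
have h0 z : (0 <= h z)%E by rewrite lee_fin mulr_ge0.
have -> : (\int[P]_(w in G) \int[mu]_(s in I) (rho s * f (s, w))%:E =
    \int[P]_w \int[mu]_s h (s, w))%E.
  rewrite integral_mkcond; apply: eq_integral => w _.
  rewrite /patch; case: ifPn => wG.
    rewrite weightedE; apply: eq_integral => s _.
    by rewrite /h /= indicE wG mulr1.
  rewrite -[LHS](@integral0 _ _ _ mu setT); apply: eq_integral => s _.
  by rewrite /h /= indicE (negbTE wG) !mulr0.
rewrite -(@fubini_tonelli _ _ _ _ R mu P h mh h0).
apply: (@le_trans _ _ (\int[mu]_s (kappa%:E * (r s)%:E))%E).
  apply: ge0_le_integral => //.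
  - by move=> s _; apply: integral_ge0 => w _; exact: h0.
  - exact: (measurable_fun_fubini_tonelli_F h).
  - by apply: measurable_funeM; exact/measurable_EFinP.
  move=> s _; rewrite /h /=.
  under eq_integral do rewrite EFinM.
  have mgs : measurable_fun setT (fun w => f (s, w) * \1_G w : R).
    exact: (measurableT_comp mg (pair1_measurable s)).
  rewrite ge0_integralZl//; last 3 first.
  - exact/measurable_EFinP.
  - by move=> w _; rewrite lee_fin; exact: (g0 (s, w)).
  - by rewrite lee_fin.
  rewrite muleC; have [Is|Is] := pselect (I s); last first.
    by rewrite /r patchE memNset// !mule0.
  apply: lee_wpmul2r; first by rewrite lee_fin.
  apply: le_trans (fk s Is); rewrite [leRHS]integral_mkcond le_eqVlt; apply/orP; left; apply/eqP.
  apply: eq_integral => w _; rewrite /patch indicE; case: ifP => _; first by rewrite mulr1.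
  by rewrite mulr0.
rewrite ge0_integralZl//; last 2 first.
- exact/measurable_EFinP.
- by move=> s _; rewrite lee_fin.
rewrite EFinM; apply: lee_wpmul2l; first by rewrite lee_fin.
apply: le_trans rA; rewrite [leRHS]integral_mkcond le_eqVlt; apply/orP; left; apply/eqP.
by apply: eq_integral => s _; rewrite /r /patch; case: ifP.
Qed.

End weighted_tonelli.

(** * Mean estimates for the limit process *)

Section limit_process.
Context {R : realType} {H : completeNormedModType R} (ip : H -> H -> R).
Hypothesis hip : is_inner_product ip.
Context (x_ : nat -> H)
  (x_dense : forall y (e : R), 0 < e -> exists n, `|y - x_ n| < e).
Context {d : measure_display} {Omega : measurableType d} (P : probability Omega R).
Variables (Z : R -> Omega -> H) (Res : R -> H -> H) (T M : R).
Hypothesis levyZ : levy_process P Z.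
Hypothesis T_ge0 : 0 <= T.
Hypothesis M_ge0 : 0 <= M.
Hypothesis linRes : forall t c x y, Res t (c *: x + y) = c *: Res t x + Res t y.
Hypothesis bRes : forall T, 0 <= T -> exists M : R, forall t x,
  0 <= t <= T -> `|Res t x| <= M * `|x|.
Hypothesis leRes : forall t x, 0 <= t <= T -> `|Res t x| <= M * `|x|.
Hypothesis cRes : forall x, {within [set t : R | 0 <= t], continuous (fun t => Res t x)}.
Variables (sub : nat -> nat) (C : set (R * Omega)) (Y : R * Omega -> H).
Hypothesis limY : approx_limit P Z Res T sub C Y.

Local Notation mu := (@lebesgue_measure R).
Local Notation W := (conv_approx Z Res T).
Local Notation q j := ((2^-1 : R) ^+ j).
Local Notation bounded_event lam := (path_event Z (T + 1) (fun x => `|x| - lam)).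

Lemma measurable_bounded_event lam : measurable (bounded_event lam).
Proof.
have [[Z0 mZ] _ _ _ cZ] := levyZ.
apply: measurable_path_event => //; first by have := T_ge0; lra.
by move=> x; apply: cvgB; [exact: norm_continuous|exact: cvg_cst].
Qed.

Lemma bounded_event_prob (e : R) : 0 < e -> exists lam : R, [/\ 0 < lam,
  ((7 / 8)%:E <= P (bounded_event lam))%E & (P (~` bounded_event lam) <= e%:E)%E].
Proof.
move=> e0; have [[Z0 mZ] _ _ _ cZ] := levyZ.
have c1 : Num.max (7 / 8) (1 - e) < 1 :> R by rewrite gt_max; apply/andP; split; lra.
have Tm0 : 0 <= T + 1 by have := T_ge0; lra.
have [N hN] := path_bounded_prob cZ Tm0 mZ P c1.
exists N.+1%:R; split; first by rewrite ltr0n.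
  by apply: le_trans (ltW (hN N.+1 (leqnSn N))); rewrite lee_fin le_max lexx.
have mE := measurable_bounded_event N.+1%:R.
have := hN N.+1 (leqnSn N); rewrite probability_setC//.
rewrite -(fineK (fin_num_measure P _ mE)) lte_fin gt_max => /andP[_ h].
by rewrite -EFinB lee_fin; lra.
Qed.

Lemma Hmeasurable_approx j t : Hmeasurable (fun w => W (sub j) t w).
Proof.
apply: (Hmeasurable_section_omega (Y := fun z => W (sub j) z.1 z.2)).
apply: (Hmeasurable_conv_approx hip x_dense linRes bRes cRes T_ge0).
exact: (levy_incr_measurable hip x_dense levyZ).
Qed.

Section on_bounded_event.
Variable lam : R.
Hypothesis lam_gt0 : 0 < lam.
Hypothesis PG : ((7 / 8)%:E <= P (bounded_event lam))%E.
Local Notation G := (bounded_event lam).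
Let mG : measurable G. Proof. exact: measurable_bounded_event. Qed.

Let PG1 : (P G <= 1)%E. Proof. exact: probability_le1. Qed.

Lemma second_moment_const : exists2 C2 : R, 0 <= C2 & forall t, t <= T ->
  (\int[P]_(w in G) (`|Y (t, w)| ^+ 2)%:E <= C2%:E)%E /\
  forall j, (\int[P]_(w in G) (`|W (sub j) t w| ^+ 2)%:E <= C2%:E)%E.
Proof.
exists (2624 * (M * lam) ^+ 2); first by apply: mulr_ge0; [exact: ler0n|exact: sqr_ge0].
move=> t tT; split.
  exact: (approx_limit_second_moment hip x_dense levyZ T_ge0 M_ge0 linRes bRes leRes cRes limY).
by move=> j; exact: (conv_approx_second_moment hip x_dense levyZ T_ge0 M_ge0 linRes leRes).
Qed.

Lemma limit_L1 : exists2 k : R, 0 <= k &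
  forall t, t <= T -> (\int[P]_(w in G) (`|Y (t, w)|)%:E <= k%:E)%E.
Proof.
have [C2 C20 hC2] := second_moment_const.
exists (1 + C2); first by rewrite addr_ge0.
move=> t tT; have [_ _ mY _ _] := limY.
have mYt := Hmeasurable_norm (Hmeasurable_section_omega mY t).
have mY2 : measurable_fun setT (fun w => `|Y (t, w)| ^+ 2) by exact: measurable_funX.
apply: (@le_trans _ _ (\int[P]_(w in G) ((cst 1%E) w + (`|Y (t, w)| ^+ 2)%:E))%E).
  apply: ge0_le_integral => //.
  - by apply/measurable_funTS/measurable_EFinP.
  - by apply: measurable_funTS; apply: emeasurable_funD => //; exact/measurable_EFinP.
  - move=> w _; rewrite -EFinD lee_fin.
    have := sqr_ge0 (`|Y (t, w)| - 1); rewrite sqrrB1; have := sqr_ge0 `|Y (t, w)|; lra.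
rewrite ge0_integralD//; last by apply/measurable_funTS/measurable_EFinP.
rewrite EFinD; apply: leeD; first by rewrite integral_cst// mul1e.
by have [] := hC2 t tT.
Qed.

(** Bounded second moments give uniform integrability, which upgrades closeness in probability to
    closeness in mean. No constant depends on [t], as integration in time will require. *)
Lemma limit_L1_close (e : R) : 0 < e -> exists J, forall j t, (J <= j)%N -> 0 <= t <= T ->
  (\int[P]_(w in G) (`|Y (t, w) - W (sub j) t w|)%:E <= e%:E)%E.
Proof.
move=> e0; have [_ _ mY _ hY] := limY.
have [C2 C0 hC2] := second_moment_const.
(* Chosen so that [4 * C2 / K <= e / 2]: on the exceptional set [F] the second moments of [Y] and
   [W] enter with factor [2 / K] each. [J] is chosen afterwards to make [K * P F] small. *)
pose K := 8 * C2 / e + 1.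
have K1 : 1 <= K by rewrite lerDr divr_ge0 ?mulr_ge0// ltW.
have K0 : 0 < K by exact: lt_le_trans K1.
have CK : 4 * C2 / K <= e / 2.
  rewrite ler_pdivrMr//; have : K * e = 8 * C2 + e by rewrite /K mulrDl divfK ?gt_eqF// mul1r.
  lra.
have e1 : 0 < e / (2 * (1 + K)) by rewrite divr_gt0// mulr_gt0//; lra.
have [J hJ] := half_powers_small e1; exists J => j t Jj tT.
have qe : 2 * q j * (1 + K) <= e / 2.
  have := hJ j Jj; rewrite ler_pdivlMr ?mulr_gt0//; lra.
have [F [mF PF hF]] := hY t j tT.
have q0 : 0 <= 2 * q j by rewrite mulr_ge0// exprn_ge0// invr_ge0.
have mYt := Hmeasurable_section_omega mY t.
have mWt := Hmeasurable_approx j t.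
have mY2 : measurable_fun setT (fun w => `|Y (t, w)| ^+ 2).
  by apply: measurable_funX; exact: Hmeasurable_norm.
have mW2 : measurable_fun setT (fun w => `|W (sub j) t w| ^+ 2).
  by apply: measurable_funX; exact: Hmeasurable_norm.
have m1F : measurable_fun setT (\1_F : Omega -> R) by exact: measurable_indic.
pose g1 w := (2 * q j + K * \1_F w)%:E.
pose g2 w := ((2 / K) * `|Y (t, w)| ^+ 2)%:E.
pose g3 w := ((2 / K) * `|W (sub j) t w| ^+ 2)%:E.
have K2 : 0 <= 2 / K by rewrite divr_ge0// ltW.
have mg1 : measurable_fun setT g1.
  by apply/measurable_EFinP; apply: measurable_funD => //; apply: measurable_funM.
have mg2 : measurable_fun setT g2 by apply/measurable_EFinP; apply: measurable_funM.
have mg3 : measurable_fun setT g3 by apply/measurable_EFinP; apply: measurable_funM.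
have g10 w : (0 <= g1 w)%E by rewrite lee_fin addr_ge0// mulr_ge0// ltW.
have g20 w : (0 <= g2 w)%E by rewrite lee_fin mulr_ge0// sqr_ge0.
have g30 w : (0 <= g3 w)%E by rewrite lee_fin mulr_ge0// sqr_ge0.
apply: (@le_trans _ _ (\int[P]_(w in G) (g1 w + (g2 w + g3 w)))%E).
  apply: ge0_le_integral => //.
  - apply/measurable_funTS/measurable_EFinP; apply: Hmeasurable_norm.
    exact: (Hmeasurable_sub hip x_dense).
  - by apply: measurable_funTS; apply: emeasurable_funD => //; exact: emeasurable_funD.
  move=> w _; rewrite -!EFinD lee_fin indicE.
  set y := `|Y (t, w)|; set v := `|W (sub j) t w|.
  have yv : `|Y (t, w) - W (sub j) t w| <= y + v by exact: ler_normB.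
  have s0 : 0 <= 2 / K * y ^+ 2 + 2 / K * v ^+ 2.
    by apply: addr_ge0; rewrite mulr_ge0// sqr_ge0.
  have [wF|wF] := boolP (w \in F); last first.
    have [_ h] := hF w (fun Fw => negP wF (mem_set Fw)).
    by rewrite distrC mulr0 addr0; lra.
  (* u <= K + u^2 / K with u = y + v *)
  rewrite mulr1; apply: (le_trans yv).
  have h1 : (y + v) * K <= K * K + (2 * y ^+ 2 + 2 * v ^+ 2).
    have := sqr_ge0 K; have := sqr_ge0 (y - v).
    have := sqr_ge0 (y + v - K); have := sqr_ge0 (y + v).
    rewrite !expr2; lra.
  rewrite -(ler_pM2r K0); apply: (le_trans h1).
  have -> : (2 * q j + K + (2 / K * y ^+ 2 + 2 / K * v ^+ 2)) * K =
    2 * q j * K + K * K + (2 * y ^+ 2 + 2 * v ^+ 2).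
    by field; rewrite gt_eqF.
  by rewrite -addrA lerDr mulr_ge0// ltW.
rewrite ge0_integralD//; last 3 first.
- exact: measurable_funTS.
- by move=> w _; exact: adde_ge0.
- by apply: measurable_funTS; exact: emeasurable_funD.
rewrite [X in (_ + X)%E]ge0_integralD//; last 2 first.
- exact: measurable_funTS.
- exact: measurable_funTS.
have i1 : (\int[P]_(w in G) g1 w <= (2 * q j * (1 + K))%:E)%E.
  rewrite /g1; under eq_integral do rewrite EFinD.
  rewrite ge0_integralD//; last 2 first.
  - by move=> w _; rewrite lee_fin mulr_ge0// ltW.
  - by apply/measurable_funTS/measurable_EFinP; exact: measurable_funM.
  rewrite mulrDr mulr1 EFinD; apply: leeD.
    rewrite (integral_cst P mG (2 * q j)%:E).
    by rewrite -[leRHS]mule1; apply: lee_wpmul2l; rewrite ?lee_fin.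
  under eq_integral do rewrite EFinM.
  rewrite ge0_integralZl//; last 2 first.
  - by apply/measurable_funTS/measurable_EFinP.
  - by rewrite lee_fin ltW.
  rewrite integral_indic// (mulrC _ K) EFinM; apply: lee_wpmul2l; first by rewrite lee_fin ltW.
  apply: le_trans PF; apply: le_measure; rewrite ?inE//; exact: measurableI.
have tT' : t <= T by case/andP: tT.
have i2 : (\int[P]_(w in G) g2 w <= (2 / K * C2)%:E)%E.
  rewrite /g2; under eq_integral do rewrite EFinM.
  rewrite ge0_integralZl//; last by apply/measurable_funTS/measurable_EFinP.
  rewrite [leRHS]EFinM; apply: lee_wpmul2l; first by rewrite lee_fin.
  by have [] := hC2 t tT'.
have i3 : (\int[P]_(w in G) g3 w <= (2 / K * C2)%:E)%E.
  rewrite /g3; under eq_integral do rewrite EFinM.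
  rewrite ge0_integralZl//; last by apply/measurable_funTS/measurable_EFinP.
  rewrite [leRHS]EFinM; apply: lee_wpmul2l; first by rewrite lee_fin.
  by have [_] := hC2 t tT'; apply.
apply: (le_trans (leeD i1 (leeD i2 i3))); rewrite -!EFinD lee_fin.
have : 2 / K * C2 + 2 / K * C2 = 4 * C2 / K by rewrite -mulrDl; ring.
lra.
Qed.

End on_bounded_event.

Lemma measurable_weighted_norm (rho : R -> R) (t : R) (V : R * Omega -> H) :
  measurable_fun `[0, t] rho -> (forall s, 0 <= s <= t -> 0 <= rho s) -> Hmeasurable V ->
  measurable_fun setT (fun w => \int[mu]_(s in `[0%R, t]) (rho s * `|V (s, w)|)%:E)%E.
Proof.
move=> mrho rho0 mV.
apply: (measurable_fun_weighted (f := fun z => `|V z|)) => //.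
exact: Hmeasurable_norm.
Qed.

(** Used with weight 1 for the integrability of trajectories, and with weight [|a (t - s)|] for the
    convolution in the equation. *)
Lemma limit_weighted_finite (rho : R -> R) (t e : R) : 0 <= t <= T -> 0 < e ->
  mu.-integrable `[0, t] (EFin \o rho) -> (forall s, 0 <= s <= t -> 0 <= rho s) ->
  exists B, [/\ measurable B, (P B <= e%:E)%E & forall w, ~ B w ->
    (\int[mu]_(s in `[0%R, t]) (rho s * `|Y (s, w)|)%:E < +oo)%E].
Proof.
move=> /andP[t0 tT] e0 irho rho0; have [_ _ mY _ _] := limY.
have mrho : measurable_fun `[0, t] rho by apply/measurable_EFinP; case/integrableP: irho.
have e2 : 0 < e / 2 by rewrite divr_gt0.
have [lam [l0 PG PGC]] := bounded_event_prob e2.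
have mG := measurable_bounded_event lam.
have [kappa k0 hk] := limit_L1 l0 PG.
pose A := Rintegral mu `[0, t] rho.
have AE : (\int[mu]_(s in `[0%R, t]) (rho s)%:E <= A%:E)%E.
  by rewrite /A /Rintegral fineK//; exact: integrable_fin_num.
have A0 : 0 <= A.
  by apply: Rintegral_ge0 => s; rewrite /= in_itv /=; exact: rho0.
have mPhi := measurable_weighted_norm mrho rho0 mY.
pose b := (kappa * A + 1) / (e / 2).
have b0 : 0 < b by rewrite divr_gt0// ltr_wpDl// mulr_ge0.
have tont : (\int[P]_(w in bounded_event lam)
    \int[mu]_(s in `[0%R, t]) (rho s * `|Y (s, w)|)%:E <= (kappa * A)%:E)%E.
  apply: (weighted_tonelli (f := fun z => `|Y z|)) => //.
  - exact: Hmeasurable_norm.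
  - move=> s /=; rewrite in_itv /= => /andP[_ st].
    by apply: hk; exact: le_trans tT.
have Phi0 w : (0 <= \int[mu]_(s in `[0%R, t]) (rho s * `|Y (s, w)|)%:E)%E.
  apply: integral_ge0 => s /=; rewrite in_itv /= => hs.
  by rewrite lee_fin mulr_ge0// rho0.
have [mB PB] := echebyshev_on mG mPhi Phi0 b0 tont.
set B := (_ `&` _) in mB PB.
exists (~` bounded_event lam `|` B); split.
- by apply: measurableU => //; exact: measurableC.
- apply: le_trans; first by apply: measureU2 => //; exact: measurableC.
  apply: (@le_trans _ _ ((e / 2)%:E + (e / 2)%:E)%E); last by rewrite -EFinD lee_fin; lra.
  apply: leeD => //; apply: (le_trans PB); rewrite lee_fin ler_pdivrMr//.
  have -> : e / 2 * b = kappa * A + 1 by rewrite /b mulrC divfK ?gt_eqF.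
  by rewrite lerDl.
- move=> w /not_orP[/contrapT Gw nB].
  apply: (@le_lt_trans _ _ b%:E); last exact: ltry.
  by rewrite leNgt; apply/negP => h; apply: nB.
Qed.

End limit_process.

(** * Reflection of time and shifted convolutions *)

Section reflection.
Context {R : realType}.
Local Notation mu := (@lebesgue_measure R).

Definition reflect_about (t x : R) : measurableTypeR R := t - x.

Lemma measurable_reflect_about t : measurable_fun setT (reflect_about t).
Proof. by apply: measurable_funB; [exact: measurable_cst|exact: measurable_id]. Qed.

Lemma lebesgue_measure_reflect t (A : set R) : measurable A ->
  pushforward mu (reflect_about t) A = mu A.
Proof.
move=> mA; apply/esym/lebesgue_measure_unique => //=.
  exact: measurable_reflect_about.
move=> mphi _ [[a b]] _ <-.
rewrite /pushforward (_ : reflect_about t @^-1` _ = `[t - b, t - a[%classic).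
  rewrite !lebesgue_measure_itv/= !lte_fin ltrD2l ltrN2.
  by case: ifP => // _; rewrite -!EFinB; congr EFin; lra.
by apply/seteqP; split => x /=; rewrite /reflect_about !in_itv /=; lra.
Qed.

Lemma reflect_preimage t : reflect_about t @^-1` `[0, t] = `[0, t]%classic.
Proof. by apply/seteqP; split => x /=; rewrite /reflect_about !in_itv /=; lra. Qed.

Lemma measurable_fun_reflect d' (T' : measurableType d') (t : R) (f : R -> T') :
  measurable_fun `[0, t] f -> measurable_fun `[0, t] (f \o reflect_about t).
Proof.
move=> mf; apply: (measurable_comp (F := `[0, t]%classic)) => //.
- by rewrite -{1}reflect_preimage => _ [x xt <-].
- by apply: measurable_funTS; exact: measurable_reflect_about.
Qed.

Lemma ge0_integral_reflect (t : R) (f : R -> \bar R) :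
  measurable_fun `[0, t] f -> (forall x, (0 <= f x)%E) ->
  (\int[mu]_(x in `[0%R, t]) f x = \int[mu]_(x in `[0%R, t]) f (t - x)%R)%E.
Proof.
move=> mf f0; rewrite -[X in (\int[mu]_(x in X) f (t - x)%R)%E]reflect_preimage.
transitivity (\int[pushforward mu (reflect_about t)]_(x in `[0%R, t]) f x)%E.
  apply: eq_measure_integral => [|mphi A mA _]; first exact: measurable_reflect_about.
  by apply/esym; exact: lebesgue_measure_reflect.
apply: ge0_integral_pushforward => //; exact: measurable_reflect_about.
Qed.

Lemma integral_reflect (t : R) (f : R -> \bar R) : measurable_fun `[0, t] f ->
  (\int[mu]_(x in `[0%R, t]) f x = \int[mu]_(x in `[0%R, t]) f (t - x)%R)%E.
Proof.
move=> mf; rewrite integralE [RHS]integralE; congr (_ - _)%E.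
  have := @ge0_integral_reflect t f^\+%E (measurable_funepos mf).
  by move=> -> //; apply: eq_integral => x _; rewrite !funeposE.
have := @ge0_integral_reflect t f^\-%E (measurable_funeneg mf).
by move=> -> //; apply: eq_integral => x _; rewrite !funenegE.
Qed.

Lemma integrable_reflect (t : R) (f : R -> R) :
  mu.-integrable `[0, t] (EFin \o f) ->
  mu.-integrable `[0, t] (EFin \o (fun x => f (t - x))).
Proof.
move=> /integrableP[mf foo]; apply/integrableP; split.
  exact: (measurable_fun_reflect mf).
apply: le_lt_trans foo; rewrite le_eqVlt; apply/orP; left; apply/eqP.
rewrite [RHS]ge0_integral_reflect//.
exact: measurableT_comp.
Qed.

Lemma Rintegral_reflect (t : R) (f : R -> R) : measurable_fun `[0, t] f ->
  Rintegral mu `[0, t] f = Rintegral mu `[0, t] (fun x => f (t - x)).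
Proof.
by move=> mf; rewrite /Rintegral (@integral_reflect t (EFin \o f))//; exact/measurable_EFinP.
Qed.

(** Delaying [g] by [r] delays its convolution with [a] by [r]: after reflection both integrals are
    that of [h] from 0 to [t - r], because the delayed function vanishes up to time [r]. *)
Lemma convolution_shift (a g : R -> R) (r t : R) : 0 <= r -> r < t ->
  mu.-integrable `[0, t - r] (fun s => (a (t - r - s) * g s)%:E) ->
  mu.-integrable `[0, t] (fun s => (a (t - s) * (if r < s then g (s - r) else 0))%:E) /\
  Rintegral mu `[0, t] (fun s => a (t - s) * (if r < s then g (s - r) else 0)) =
  Rintegral mu `[0, t - r] (fun s => a (t - r - s) * g s).
Proof.
move=> r0 rt; set u := t - r => ig.
pose h s := a s * g (u - s).
have u0 : 0 < u by rewrite subr_gt0.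
have hE : (fun x : R => a (u - (u - x)) * g (u - x)) = h.
  by apply/funext => x; rewrite /h opprB addrC subrK.
have ih : mu.-integrable `[0, u] (EFin \o h).
  have := @integrable_reflect u (fun s => a (u - s) * g s) ig.
  by rewrite hE.
have Ih : Rintegral mu `[0, u] (fun s => a (u - s) * g s) = Rintegral mu `[0, u] h.
  rewrite Rintegral_reflect ?hE//; apply/measurable_EFinP; by case/integrableP: ig.
(* The interval is open on the right to match the strict condition [r < s]; the missing endpoint is
   a null set. *)
pose k := h \_ `[0, u[.
have ih' : mu.-integrable `[0, u[ (EFin \o h).
  by apply: integrableS ih => //; apply: subset_itvl; rewrite bnd_simp.
have kE : EFin \o k = (EFin \o h) \_ `[0, u[.
  by apply/funext => s; rewrite /k /= /patch; case: ifP.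
have ik : mu.-integrable `[0, t] (EFin \o k).
  apply: (@integrableS _ _ _ mu setT) => //.
  by rewrite kE; apply/(integrable_mkcond _ _).1.
have fE : {in `[0, t]%classic, (fun x : R => k (t - x)) =1
   (fun s => a (t - s) * (if r < s then g (s - r) else 0))}.
  move=> s; rewrite inE /= in_itv /= => /andP[s0 st].
  rewrite /k /patch; case: ifPn => [/set_mem /=|/negP nm]; rewrite ?in_itv /=.
    move=> /andP[ts tsu]; have -> : r < s by move: tsu; rewrite /u; lra.
    by rewrite /h; congr (a _ * g _); rewrite /u; lra.
  case: ifPn => rs; last by rewrite mulr0.
  by exfalso; apply: nm; apply/mem_set; rewrite /= in_itv /= /u; lra.
have i1 : mu.-integrable `[0, t] (fun s => (a (t - s) * (if r < s then g (s - r) else 0))%:E).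
  have := integrable_reflect ik; apply: eq_integrable => // s hs.
  by rewrite /= fE.
split => //.
transitivity (Rintegral mu `[0, t] (fun x => k (t - x))).
  by apply: eq_Rintegral => s hs; rewrite fE.
rewrite -Rintegral_reflect; last first.
  by apply/measurable_EFinP; case/integrableP: ik.
rewrite Ih -[RHS]Rintegral_itv_bndo_bndc//.
transitivity (Rintegral mu (`[0, t] `&` `[0, u[) h); first by rewrite Rintegral_mkcondr.
congr (Rintegral _ _ _).
apply/seteqP; split => s /=; rewrite !in_itv /= /u; first by case.
by move=> h1; split; lra.
Qed.

End reflection.

Section integrable_tools.
Context {R : realType} {d : measure_display} {T : measurableType d}
  (mu : {measure set T -> \bar R}) (D : set T).
Hypothesis mD : measurable D.

Lemma integrable_mul_bounded (f g : T -> R) (K : R) :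
  mu.-integrable D (EFin \o f) -> measurable_fun D g ->
  (forall x, D x -> `|g x| <= K) -> mu.-integrable D (EFin \o (fun x => f x * g x)).
Proof.
move=> intf mg gK; have mf : measurable_fun D f by apply/measurable_EFinP; case/integrableP: intf.
apply: (le_integrable mD _ _ (integrableZl mD K intf)).
  by apply/measurable_EFinP; exact: measurable_funM.
move=> x Dx /=; rewrite lee_fin !normrM mulrC ler_wpM2r//.
by apply: le_trans (gK x Dx) _; exact: ler_norm.
Qed.

Lemma integrable_sum_Rintegral n (f : nat -> T -> R) :
  (forall k, (k < n)%N -> mu.-integrable D (EFin \o f k)) ->
  mu.-integrable D (EFin \o (fun x => \sum_(k < n) f k x)) /\
  Rintegral mu D (fun x => \sum_(k < n) f k x) = \sum_(k < n) Rintegral mu D (f k).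
Proof.
elim: n => [|n ih] intf.
  rewrite big_ord0; split.
    apply: (eq_integrable mD (cst 0%E)); last exact: integrable0.
    by move=> x _; rewrite /= big_ord0.
  rewrite (_ : (fun x => _) = cst 0); last by apply/funext => x; rewrite big_ord0.
  by rewrite Rintegral_cst// mul0r.
have [i1 e1] := ih (fun k kn => intf k (ltnW kn)).
have i2 := intf n (ltnSn n).
split.
  apply: (eq_integrable mD (fun x => (\sum_(k < n) f k x)%:E + (f n x)%:E)%E).
    by move=> x _; rewrite /= big_ord_recr.
  exact: integrableD.
rewrite big_ord_recr /= -e1 -RintegralD//; apply: eq_Rintegral => x _.
by rewrite big_ord_recr.
Qed.

End integrable_tools.

(** * The resolvent equation in weak form *)

Section resolvent_equation.
Context {R : realType} {H : normedModType R} (ip : H -> H -> R).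
Hypothesis hip : is_inner_product ip.
Variables (D : set H) (A : H -> H) (a : R -> R) (Res : R -> H -> H).
Hypothesis cdd : closed_densely_defined D A.
Hypothesis inta : locally_integrable_Rplus a.
Hypothesis resF : resolvent_family ip D A a Res.
Variables (xi eta : H).
Hypothesis adj : adjoint_rel ip D A xi eta.

Local Notation mu := (@lebesgue_measure R).

Lemma integrable_kernel (u : R) : 0 <= u -> mu.-integrable `[0, u] (EFin \o (fun s => a (u - s))).
Proof. by move=> u0; apply: integrable_reflect; exact: inta. Qed.

Lemma measurable_fun_ip_resolvent (x y : H) (u : R) :
  measurable_fun `[0, u] (fun s => ip (Res s x) y).
Proof.
case: resF => _ _ cRes _ _.
have cm : continuous (fun s : R => ip (Res (Num.max s 0) x) y).
  move=> s; apply: (@cvg_comp _ _ _ (fun s : R => Res (Num.max s 0) x) (ip ^~ y)).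
    exact: (continuous_max0 (cRes x)).
  exact: (ip_continuousl hip).
apply: (eq_measurable_fun (fun s : R => ip (Res (Num.max s 0) x) y)).
  by move=> s; rewrite inE /= in_itv /= => /andP[s0 _]; rewrite max_l.
by apply: measurable_funTS; exact: continuous_measurable_fun.
Qed.

Lemma integrable_convolution (u : R) x : 0 <= u ->
  mu.-integrable `[0, u] (EFin \o (fun s => a (u - s) * ip (Res s x) eta)).
Proof.
move=> u0; case: (resF) => _ bRes _ _ _; have [M hM] := bRes u u0.
apply: (@integrable_mul_bounded R _ _ mu `[0, u] (measurable_itv _) (fun s => a (u - s))
  (fun s => ip (Res s x) eta) (M * `|x| * `|eta|)).
- exact: integrable_kernel.
- exact: measurable_fun_ip_resolvent.
- move=> s /=; rewrite in_itv /= => su.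
  apply: (le_trans (Cauchy_Schwarz_ip hip _ _)).
  by apply: ler_wpM2r => //; exact: hM.
Qed.

(** Moving [A] onto [xi] makes both sides meaningful for every [x], as is needed for the values of
    [Z], which may lie outside [D]. The defect [L] is additive and bounded and vanishes on [D],
    hence vanishes by density. *)
Lemma weak_resolvent_equation (u : R) x : 0 <= u ->
  ip (Res u x) xi = ip x xi + Rintegral mu `[0, u] (fun s => a (u - s) * ip (Res s x) eta).
Proof.
move=> u0; case: (resF) => linRes bRes cRes [Res0 ResD] reseq.
have [M hM] := bRes u u0.
pose I x := Rintegral mu `[0, u] (fun s => a (u - s) * ip (Res s x) eta).
pose L x := ip (Res u x) xi - ip x xi - I x.
have LD z : D z -> L z = 0.
  move=> Dz; have [_ eq] := reseq u z u0 Dz xi.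
  rewrite /L eq (_ : I z = Rintegral mu `[0, u] (fun s => a (u - s) * ip (A (Res s z)) xi)).
    by ring.
  apply: eq_Rintegral => s; rewrite inE /= in_itv /= => /andP[s0 _].
  (* The adjoint relation applies at [Res s z] because the resolvent preserves [D]. *)
  by have [DR _] := ResD s z s0 Dz; rewrite (adj DR).
have IB z z' : I (z - z') = I z - I z'.
  rewrite /I -RintegralB//; try exact: integrable_convolution.
  by apply: eq_Rintegral => s _; rewrite (lin_mapB (linRes s)) (ipBl hip) mulrBr.
have LB z z' : L (z - z') = L z - L z'.
  by rewrite /L IB (lin_mapB (linRes u)) !(ipBl hip); ring.
pose J := Rintegral mu `[0, u] (fun s => `|a (u - s)|).
have ik := integrable_kernel u0.
have ink : mu.-integrable `[0, u] (EFin \o (fun s => `|a (u - s)|)).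
  by have := integrable_norm ik.
have leI z : `|I z| <= J * (M * `|z| * `|eta|).
  apply: (le_trans (le_normr_Rintegral _ (integrable_convolution z u0))) => //.
  rewrite /J -RintegralZr//; apply: le_Rintegral => //.
  - by have := integrable_norm (integrable_convolution z u0).
  - by apply: (@integrable_mul_bounded R _ _ mu `[0, u] (measurable_itv _)
      (fun s => `|a (u - s)|) (fun=> M * `|z| * `|eta|) `|M * `|z| * `|eta| |).
  move=> s /=; rewrite in_itv /= => su; rewrite normrM ler_wpM2l//.
  apply: (le_trans (Cauchy_Schwarz_ip hip _ _)).
  by apply: ler_wpM2r => //; exact: hM.
have [K leL] : exists K, forall z, `|L z| <= K * `|z|.
  exists (M * `|xi| + `|xi| + J * M * `|eta|) => z.
  apply: (le_trans (ler_normB _ _)); apply: (le_trans (lerD (ler_normB _ _) (leI z))).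
  have h1 : `|ip (Res u z) xi| <= M * `|z| * `|xi|.
    apply: (le_trans (Cauchy_Schwarz_ip hip _ _)); apply: ler_wpM2r => //.
    by apply: hM; rewrite u0 lexx.
  have h2 := Cauchy_Schwarz_ip hip z xi.
  lra.
suff : L x = 0 by rewrite /L -/(I x); lra.
apply/eqP; rewrite -normr_eq0; apply/negPn/negP => Lx0.
have {}Lx0 : 0 < `|L x| by rewrite lt_neqAle eq_sym Lx0 normr_ge0.
have K0 : 0 < `|K| + 1 by rewrite ltr_pwDr.
have e0 : 0 < `|L x| / (`|K| + 1) by rewrite divr_gt0.
case: cdd => _ _ clD _.
have : closure D x by rewrite clD.
move=> /(_ (ball x (`|L x| / (`|K| + 1))) (nbhsx_ballx _ _ e0)) [z [Dz]].
rewrite -ball_normE /= ltr_pdivlMr// => xz.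
have := leL (x - z); rewrite LB (LD z Dz) subr0 => h.
have : K * `|x - z| <= `|K| * `|x - z| by apply: ler_wpM2r => //; exact: ler_norm.
have := normr_ge0 (x - z); lra.
Qed.

End resolvent_equation.

(** * The exact equation for grid sums *)

Section approximate_equation.
Context {R : realType} {H : normedModType R} (ip : H -> H -> R).
Hypothesis hip : is_inner_product ip.
Variables (D : set H) (A : H -> H) (a : R -> R) (Res : R -> H -> H).
Hypothesis cdd : closed_densely_defined D A.
Hypothesis inta : locally_integrable_Rplus a.
Hypothesis resF : resolvent_family ip D A a Res.
Variables (xi eta : H).
Hypothesis adj : adjoint_rel ip D A xi eta.
Context {d : measure_display} {Omega : measurableType d} (Z : R -> Omega -> H) (T : R).
Hypothesis T_ge0 : 0 <= T.
Hypothesis Z0 : forall w, Z 0 w = 0.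

Local Notation mu := (@lebesgue_measure R).
Local Notation W := (conv_approx Z Res T).

(* The resolvent equation, shifted to start at each grid point and summed, is
   an exact equation for [W]; only the endpoint [t] is replaced by [v]. *)
Lemma conv_approx_equation m (t : R) : 0 <= t <= T ->
  exists2 v, t <= v <= t + mesh T m & forall w,
    mu.-integrable `[0, t] (EFin \o (fun s => a (t - s) * ip (W m s w) eta)) /\
    ip (W m t w) xi =
    Rintegral mu `[0, t] (fun s => a (t - s) * ip (W m s w) eta) + ip (Z v w) xi.
Proof.
move=> /andP[t0 tT].
pose Dk w k := Z (grid T m k.+1) w - Z (grid T m k) w.
have h0 := mesh_gt0 T_ge0 m.
(* The increments over cells starting before [t] telescope to [Z v], where [v] is the first grid
   point not before [t]. *)
have [v tv vE] : exists2 v, t <= v <= t + mesh T m & forall w,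
    \sum_(k < m.+1) (if grid T m k < t then ip (Dk w k) xi else 0) = ip (Z v w) xi.
  have [tz|tnz] := eqVneq t 0.
    exists 0; first by rewrite tz lexx add0r ltW.
    by move=> w; rewrite Z0 (ip0l hip) big1// => k _; rewrite tz ltNge grid_ge0.
  have [K Km /andP[Kt tK]] : exists2 K, (K < m.+1)%N & grid T m K < t <= grid T m K.+1.
    by apply: grid_ceil => //; rewrite tT lt_neqAle eq_sym tnz t0.
  exists (grid T m K.+1); first by move: tK; rewrite gridS; lra.
  move=> w; transitivity (\sum_(k < K.+1) ip (Dk w k) xi).
    rewrite (big_ord_widen m.+1 (fun k => ip (Dk w k) xi))// [RHS]big_mkcond /=.
    apply: eq_bigr => k _; congr (if _ then _ else _).
    rewrite ltnS; apply/idP/idP => [h|h].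
      by rewrite -ltnS -(grid_lt T_ge0 m); exact: lt_le_trans h tK.
    by apply: le_lt_trans Kt; rewrite grid_le.
  rewrite -(ip_suml hip); congr (ip _ _).
  rewrite -(big_mkord predT (Dk w)) /Dk (telescope_sumr (fun k => Z (grid T m k) w))//.
  by rewrite grid0 Z0 subr0.
exists v => // w.
(* Contribution of one increment, delayed to the start of its cell; for a cell that starts at or
   after [t] it vanishes on [[0, t]]. *)
pose f k s := a (t - s) *
  (if grid T m k < s then ip (Res (s - grid T m k) (Dk w k)) eta else 0).
have fP k : mu.-integrable `[0, t] (EFin \o f k) /\
    Rintegral mu `[0, t] (f k) =
    if grid T m k < t then ip (Res (t - grid T m k) (Dk w k)) xi - ip (Dk w k) xi else 0.
  case: ifPn => kt.
    have u0 : 0 <= t - grid T m k by rewrite subr_ge0 ltW.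
    have ic := integrable_convolution hip inta resF eta (Dk w k) u0.
    have [i1 e1] := @convolution_shift R a (fun s => ip (Res s (Dk w k)) eta) (grid T m k) t
      (grid_ge0 T_ge0 m k) kt ic.
    split => //; rewrite e1 (weak_resolvent_equation hip cdd inta resF adj (Dk w k) u0); ring.
  have fE s : s \in `[0, t]%classic -> f k s = 0.
    rewrite inE /= in_itv /= => /andP[_ st]; rewrite /f; case: ifPn => ks; last by rewrite mulr0.
    by exfalso; move: kt; rewrite -leNgt; lra.
  split.
    apply: (eq_integrable _ (cst 0%E)) => //; last exact: integrable0.
    by move=> s /fE /= ->.
  transitivity (Rintegral mu `[0, t] (cst 0)); first exact: eq_Rintegral.
  by rewrite Rintegral_cst// mul0r.
have WE : (fun s => a (t - s) * ip (W m s w) eta) = (fun s => \sum_(k < m.+1) f k s).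
  apply/funext => s; rewrite /conv_approx (ip_suml hip) mulr_sumr.
  apply: eq_bigr => k _; rewrite /f; case: ifP => // _.
  by rewrite (ip0l hip).
have [i1 e1] := @integrable_sum_Rintegral R _ _ mu `[0, t] (measurable_itv _) m.+1 f
  (fun k _ => (fP k).1).
rewrite WE; split => //.
have sumE : ip (W m t w) xi = \sum_(k < m.+1) Rintegral mu `[0, t] (f k) +
    \sum_(k < m.+1) (if grid T m k < t then ip (Dk w k) xi else 0).
  rewrite /conv_approx (ip_suml hip) -big_split; apply: eq_bigr => k _ /=.
  by rewrite (fP k).2; case: ifP => _; [rewrite subrK|rewrite (ip0l hip) addr0].
by rewrite sumE e1 vE.
Qed.

End approximate_equation.

(** * Passage to the limit in the equation *)

Section limit_equation.
Context {R : realType} {H : completeNormedModType R} (ip : H -> H -> R).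
Hypothesis hip : is_inner_product ip.
Context (x_ : nat -> H)
  (x_dense : forall y (e : R), 0 < e -> exists n, `|y - x_ n| < e).
Context {d : measure_display} {Omega : measurableType d} (P : probability Omega R).
Variables (D : set H) (A : H -> H) (a : R -> R) (Res : R -> H -> H).
Hypothesis cdd : closed_densely_defined D A.
Hypothesis inta : locally_integrable_Rplus a.
Hypothesis resF : resolvent_family ip D A a Res.
Variables (Z : R -> Omega -> H) (T M : R).
Hypothesis levyZ : levy_process P Z.
Hypothesis T_ge0 : 0 <= T.
Hypothesis M_ge0 : 0 <= M.
Hypothesis leRes : forall t x, 0 <= t <= T -> `|Res t x| <= M * `|x|.
Variables (sub : nat -> nat) (C : set (R * Omega)) (Y : R * Omega -> H).
Hypothesis limY : approx_limit P Z Res T sub C Y.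

Local Notation mu := (@lebesgue_measure R).
Local Notation W := (conv_approx Z Res T).

Let linRes : forall t c x y, Res t (c *: x + y) = c *: Res t x + Res t y.
Proof. by case: resF. Qed.
Let bRes : forall T, 0 <= T -> exists M : R, forall t x,
  0 <= t <= T -> `|Res t x| <= M * `|x|.
Proof. by case: resF. Qed.
Let cRes : forall x, {within [set t : R | 0 <= t], continuous (fun t => Res t x)}.
Proof. by case: resF. Qed.

Variables (xi eta : H).
Hypothesis adj : adjoint_rel ip D A xi eta.

Lemma integrable_limit (t : R) w : 0 <= t ->
  (\int[mu]_(s in `[0%R, t]) (`|a (t - s)| * `|Y (s, w)|)%:E < +oo)%E ->
  mu.-integrable `[0, t] (EFin \o (fun s => a (t - s) * ip (Y (s, w)) eta)).
Proof.
move=> t0 Phi; have [_ _ mY _ _] := limY.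
have ma : measurable_fun `[0, t] (fun s => a (t - s)).
  by apply/measurable_EFinP; have /integrableP[] := integrable_kernel inta t0.
have mYw : measurable_fun `[0, t] (fun s => ip (Y (s, w)) eta).
  by apply: measurable_funTS; exact: (Hmeasurable_ip hip eta (Hmeasurable_section_time mY w)).
have mn : measurable_fun `[0, t] (fun s => `|Y (s, w)|).
  by apply: measurable_funTS; exact: (Hmeasurable_norm (Hmeasurable_section_time mY w)).
apply/integrableP; split.
  by apply/measurable_EFinP; exact: measurable_funM.
apply: (@le_lt_trans _ _ (\int[mu]_(s in `[0%R, t])
    (`|eta|%:E * (`|a (t - s)| * `|Y (s, w)|)%:E))%E).
  apply: ge0_le_integral => //.
  - by do 2!apply: measurableT_comp => //; exact: measurable_funM.
  - apply: measurable_funeM; apply/measurable_EFinP; apply: measurable_funM => //.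
    exact: measurableT_comp.
  - move=> s _ /=; rewrite -EFinM lee_fin normrM (mulrC `|eta|) -mulrA ler_wpM2l//.
    exact: (Cauchy_Schwarz_ip hip).
rewrite ge0_integralZl//; last first.
  by apply/measurable_EFinP; apply: measurable_funM => //; exact: measurableT_comp.
by rewrite lte_mul_pinfty.
Qed.

(** Three errors of size [e / 3] are compared with the exact equation: in the value at [t], in the
    time integral, and in the endpoint of [Z]. Five exceptional events of probability at most
    [e / 5] cover an infinite weighted norm, an unbounded path, a large integral error, slow
    convergence at [t], and a large increment of [Z] from [t] to [v]. *)
Lemma limit_equation_close (t e : R) : 0 <= t <= T -> 0 < e ->
  exists B, [/\ measurable B, (P B <= e%:E)%E & forall w, ~ B w ->
    (\int[mu]_(s in `[0%R, t]) (`|a (t - s)| * `|Y (s, w)|)%:E < +oo)%E /\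
    `|ip (Y (t, w)) xi - Rintegral mu `[0, t] (fun s => a (t - s) * ip (Y (s, w)) eta)
      - ip (Z t w) xi| <= e].
Proof.
move=> tT e0; have [subj _ mY _ hY] := limY; have [[Z0 mZ] _ _ _ _] := levyZ.
have /andP[t0 tT'] := tT.
have e5 : 0 < e / 5 by rewrite divr_gt0.
have ik := integrable_kernel inta t0.
have irho : mu.-integrable `[0, t] (EFin \o (fun s => `|a (t - s)|)).
  by have := integrable_norm ik.
have mrho : measurable_fun `[0, t] (fun s => `|a (t - s)|).
  by apply/measurable_EFinP; case/integrableP: irho.
pose Aa := Rintegral mu `[0, t] (fun s => `|a (t - s)|).
have Aa0 : 0 <= Aa by apply: Rintegral_ge0.
have AaE : (\int[mu]_(s in `[0%R, t]) (`|a (t - s)|)%:E <= Aa%:E)%E.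
  by rewrite /Aa /Rintegral fineK//; exact: integrable_fin_num.
have [B1 [mB1 PB1 hB1]] := limit_weighted_finite hip x_dense levyZ T_ge0 M_ge0
  linRes bRes leRes cRes limY tT e5 irho (fun s _ => normr_ge0 (a (t - s))).
have [lam [l0 PG PGC]] := bounded_event_prob levyZ T_ge0 e5.
have mG := measurable_bounded_event levyZ T_ge0 lam.
set G := path_event _ _ _ in PG PGC mG.
have n0 : 0 < `|eta| + 1 by rewrite ltr_wpDl.
have x0 : 0 < `|xi| + 1 by rewrite ltr_wpDl.
pose e2 := e / 3 / (`|eta| + 1).
have e20 : 0 < e2 by rewrite !divr_gt0.
pose e3 := e / 3 / (`|xi| + 1).
have e30 : 0 < e3 by rewrite !divr_gt0.
have Aa1 : 0 < Aa + 1 by rewrite ltr_wpDl.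
(* Tonelli's theorem bounds the mean of [Del] on [G] by [e1 * Aa], so Chebyshev's inequality at
   level [e2] gives probability at most [e / 5]. *)
pose e1 := e2 * (e / 5) / (Aa + 1).
have e10 : 0 < e1 by rewrite !divr_gt0// mulr_gt0.
have [J1 hJ1] := limit_L1_close hip x_dense levyZ T_ge0 M_ge0 linRes bRes leRes cRes limY
  l0 PG e10.
have [J2 hJ2] := half_powers_small e5.
have [J3 hJ3] := half_powers_small e30.
have [del del0 hdel] := levy_unif_cont_prob levyZ e30 e5.
have [J4 hJ4] := mesh_small T del0.
pose j := maxn (maxn J1 J2) (maxn J3 J4).
have j1 : (J1 <= j)%N by rewrite /j !leq_max leqnn ?orbT.
have j2 : (J2 <= j)%N by rewrite /j !leq_max leqnn ?orbT.
have j3 : (J3 <= j)%N by rewrite /j !leq_max leqnn ?orbT.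
have j4 : (J4 <= sub j)%N by apply: leq_trans (subj j); rewrite /j !leq_max leqnn !orbT.
have [F [mF PF hF]] := hY t j tT.
(* [v] does not depend on [w], so continuity in probability applies to the increment from [t] to
   [v]. *)
have [v /andP[tv vt] Weq] :=
  conv_approx_equation hip cdd inta resF adj T_ge0 Z0 (sub j) tT.
pose Ev := [set w | e3 < `|Z v w - Z t w|].
have PEv : (P Ev <= (e / 5)%:E)%E.
  apply: hdel => //; rewrite tv (le_trans vt)// lerD2l.
  by have := hJ4 _ j4; have := mesh_gt0 T_ge0 (sub j); lra.
have mEv : measurable Ev.
  apply: measurable_gt_norm; apply: (levy_incr_measurable hip x_dense levyZ) => //.
  exact: le_trans tv.
pose V (z : R * Omega) := Y z - W (sub j) z.1 z.2.
have mV : Hmeasurable V.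
  apply: (Hmeasurable_sub hip x_dense) => //.
  apply: (Hmeasurable_conv_approx hip x_dense linRes bRes cRes T_ge0).
  exact: (levy_incr_measurable hip x_dense levyZ).
pose Del w := (\int[mu]_(s in `[0%R, t]) (`|a (t - s)| * `|V (s, w)|)%:E)%E.
have mDel : measurable_fun setT Del.
  exact: (measurable_weighted_norm mrho (fun s _ => normr_ge0 (a (t - s))) mV).
have Del0 w : (0 <= Del w)%E.
  by apply: integral_ge0 => s _; rewrite lee_fin mulr_ge0.
have iDel : (\int[P]_(w in G) Del w <= (e1 * Aa)%:E)%E.
  apply: (weighted_tonelli (f := fun z => `|V z|)) => //.
  - exact: Hmeasurable_norm.
  - exact: ltW.
  - move=> s /=; rewrite in_itv /= => /andP[s0 st].
    by apply: hJ1 => //; rewrite s0 (le_trans st).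
have [mB2 PB2] := echebyshev_on mG mDel Del0 e20 iDel.
set B2 := (_ `&` _) in mB2 PB2.
have PB2' : (P B2 <= (e / 5)%:E)%E.
  apply: (le_trans PB2); rewrite lee_fin ler_pdivrMr// /e1 mulrAC ler_pdivrMr//.
  by rewrite (mulrC e2) ler_pM2l ?mulr_gt0// lerDl.
have mGC := measurableC mG.
have mU (E1 E2 : set Omega) (c1 c2 : R) : measurable E1 -> measurable E2 ->
    (P E1 <= c1%:E)%E -> (P E2 <= c2%:E)%E ->
    measurable (E1 `|` E2) /\ (P (E1 `|` E2) <= (c1 + c2)%:E)%E.
  move=> m1 m2 p1 p2; split; first exact: measurableU.
  apply: le_trans; first by apply: measureU2.
  by rewrite EFinD; exact: leeD.
have [m12 p12] := mU _ _ _ _ mB1 mGC PB1 PGC.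
have [m34 p34] := mU _ _ _ _ mB2 mF PB2' PF.
have [m345 p345] := mU _ _ _ _ m34 mEv p34 PEv.
have [mB PB] := mU _ _ _ _ m12 m345 p12 p345.
exists ((B1 `|` ~` G) `|` ((B2 `|` F) `|` Ev)); split => //.
  by apply: (le_trans PB); rewrite lee_fin; have h := hJ2 j j2; lra.
move=> w /not_orP[/not_orP[nB1 /contrapT Gw] /not_orP[/not_orP[nB2 nF] /negP]].
rewrite -leNgt => Zv; split; first exact: hB1.
have [_ YW] := hF w nF.
have [iW eqW] := Weq w.
have iY := integrable_limit t0 (hB1 w nB1).
have Delw : (Del w <= e2%:E)%E.
  by rewrite leNgt; apply/negP => h; apply: nB2.
set IY := Rintegral _ _ _; set IW := Rintegral _ _ _ in eqW.
have IYW : `|IY - IW| <= e / 3.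
  rewrite /IY /IW -RintegralB//.
  have iB : mu.-integrable `[0, t] (EFin \o (fun s => a (t - s) * ip (Y (s, w)) eta -
      a (t - s) * ip (W (sub j) s w) eta)).
    by apply: (integrableB _ iY iW).
  apply: (le_trans (le_normr_Rintegral _ iB)) => //.
  have iBn := integrable_norm iB.
  rewrite -lee_fin /Rintegral fineK; last exact: integrable_fin_num.
  apply: (@le_trans _ _ (`|eta|%:E * Del w)%E); last first.
    apply: (@le_trans _ _ ((`|eta| + 1)%:E * e2%:E)%E); last first.
      by rewrite -EFinM lee_fin /e2 mulrC divfK ?gt_eqF.
    by apply: lee_pmul => //; rewrite lee_fin lerDl.
  have mVw : measurable_fun `[0, t] (fun s => `|a (t - s)| * `|V (s, w)|).
    apply: measurable_funM => //; apply: measurable_funTS.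
    exact: (Hmeasurable_norm (Hmeasurable_section_time mV w)).
  rewrite /Del -ge0_integralZl//; last exact/measurable_EFinP.
  apply: ge0_le_integral => //.
  - by case/integrableP: iBn.
  - by apply: measurable_funeM; exact/measurable_EFinP.
  move=> s _ /=; rewrite -EFinM lee_fin -mulrBr -(ipBl hip) normrM.
  rewrite (mulrC `|eta|) -mulrA ler_wpM2l//.
  exact: (Cauchy_Schwarz_ip hip).
have xi3 u : `|u| <= e3 -> `|ip u xi| <= e / 3.
  move=> ue; apply: (le_trans (Cauchy_Schwarz_ip hip _ _)).
  apply: (@le_trans _ _ (e3 * (`|xi| + 1))); last by rewrite /e3 divfK ?gt_eqF.
  by apply: ler_pM => //; rewrite lerDl.
have h1 : `|ip (Y (t, w)) xi - ip (W (sub j) t w) xi| <= e / 3.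
  rewrite -(ipBl hip); apply: xi3; rewrite distrC.
  exact: le_trans YW (hJ3 j j3).
have h2 : `|ip (Z v w) xi - ip (Z t w) xi| <= e / 3.
  by rewrite -(ipBl hip); exact: xi3.
have -> : ip (Y (t, w)) xi - IY - ip (Z t w) xi =
  (ip (Y (t, w)) xi - ip (W (sub j) t w) xi) - (IY - IW) + (ip (Z v w) xi - ip (Z t w) xi).
  by rewrite eqW; ring.
apply: (le_trans (ler_normD _ _)); apply: (le_trans (lerD (ler_normB _ _) (lexx _))).
by lra.
Qed.

Lemma limit_equation (t : R) : 0 <= t <= T ->
  exists N, [/\ measurable N, P N = 0%E & forall w, ~ N w ->
    mu.-integrable `[0, t] (EFin \o (fun s => a (t - s) * ip (Y (s, w)) eta)) /\
    ip (Y (t, w)) xi =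
    Rintegral mu `[0, t] (fun s => a (t - s) * ip (Y (s, w)) eta) + ip (Z t w) xi].
Proof.
move=> tT; have /andP[t0 _] := tT.
have [N [mN PN hN]] := null_exception (fun e e0 => limit_equation_close tT e0).
exists N; split => // w /hN {}hN; split.
  by have [e [_ _ [Phi _]]] := hN 1 ltr01; exact: integrable_limit.
set I := Rintegral _ _ _.
suff : `|ip (Y (t, w)) xi - I - ip (Z t w) xi| <= 0.
  by rewrite normr_le0 => /eqP; lra.
apply/ler_addgt0Pr => e e0; rewrite add0r.
have [e' [_ e'e [_ h]]] := hN e e0; exact: le_trans h e'e.
Qed.

End limit_equation.

Lemma Rintegrable_cst1 {R : realType} (T : R) :
  (@lebesgue_measure R).-integrable `[0, T] (EFin \o (fun=> 1)).
Proof.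
apply: continuous_compact_integrable; first exact: segment_compact.
by move=> x; exact: cvg_cst.
Qed.

Theorem theorem7 (R : realType) (H : completeNormedModType R)
  (ip : H -> H -> R) (D : set H) (A : H -> H) (a : R -> R)
  (Res : R -> H -> H)
  (d : measure_display) (Omega : measurableType d) (P : probability Omega R)
  (Z : R -> Omega -> H) (T : R) :
  is_inner_product ip -> @separable_space R H ->
  closed_densely_defined D A ->
  locally_integrable_Rplus a ->
  resolvent_family ip D A a Res ->
  levy_process P Z ->
  exists Y : R -> Omega -> H,
    [/\ (* Y(t) = int_0^t Res(t - tau) dZ(tau) for t in [0,T] *)
        (forall t, 0 <= t <= T -> Hmeasurable (Y t) /\ is_stoch_conv P Res Z t (Y t)),
        (* integrable trajectories *)
        (forall w, bochner_integrable_on T (fun tau => Y tau w))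
      & (forall t, 0 <= t <= T -> forall xi Astar_xi : H,
          adjoint_rel ip D A xi Astar_xi ->
          {ae P, forall w,
             (@lebesgue_measure R).-integrable `[0, t]%classic
               (fun tau => (ip (a (t - tau) *: Y tau w) Astar_xi)%:E) /\
             ip (Y t w) xi =
               Rintegral (@lebesgue_measure R) `[0, t]%classic
                 (fun tau => ip (a (t - tau) *: Y tau w) Astar_xi)
               + ip (Z t w) xi})].
Proof.
move=> hip sepH cdd inta resF levyZ.
have [T0|T_ge0] := ltP T 0.
  (* No time satisfies [0 <= t <= T], and the trajectory integral runs over the empty set. *)
  exists (fun _ _ => 0); split => [t|w|t]; [by move=> /andP[]; lra| |by move=> /andP[]; lra].
  rewrite /bochner_integrable_on.
  have -> : `[0, T]%classic = set0 :> set R by rewrite set_itv_ge// bnd_simp -ltNge.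
  by split; [move=> B _; rewrite set0I; exact: measurable0|rewrite integral_set0].
have [x_ x_dense] := separable_dense_seq sepH.
have [linRes bRes cRes _ _] := resF.
have [M0 hM0] := bRes T T_ge0.
(* In a trivial space the given bound might be negative. *)
pose M := Num.max M0 0.
have M_ge0 : 0 <= M by rewrite le_max lexx orbT.
have leRes t x : 0 <= t <= T -> `|Res t x| <= M * `|x|.
  move=> tT; apply: le_trans (hM0 t x tT) _; apply: ler_wpM2r => //.
  by rewrite le_max lexx.
have [sub [C [Y limY]]] :=
  approx_limit_exists hip x_dense levyZ T_ge0 M_ge0 linRes bRes leRes cRes.
have [_ _ mY _ _] := limY.
have TT : 0 <= T <= T by rewrite T_ge0 lexx.
pose Phi w := (\int[@lebesgue_measure R]_(s in `[0%R, T]) (1 * `|Y (s, w)|)%:E)%E.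
have m1 : measurable_fun `[0, T] (fun=> 1 : R) by exact: measurable_cst.
have mPhi : measurable_fun setT Phi.
  exact: (measurable_weighted_norm m1 (fun _ _ => ler01) mY).
(* Integrability is claimed for every [w], but [Y] has it only almost surely. Resetting whole
   trajectories to 0 on this measurable null set repairs this while preserving measurability and the
   limits in probability. *)
pose N0 := [set w | Phi w = +oo%E].
have mN0 : measurable N0.
  rewrite (_ : N0 = setT `&` Phi @^-1` [set +oo%E]); last by rewrite setTI.
  by apply: mPhi => //; exact: emeasurable_set1.
have PN0 : P N0 = 0%E.
  have [N [mN PN hN]] := null_exception (Q := fun _ w => (Phi w < +oo)%E) (fun e e0 =>
    limit_weighted_finite hip x_dense levyZ T_ge0 M_ge0 linRes bRes leRes cRes limY TT e0
      (Rintegrable_cst1 T) (fun _ _ => ler01)).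
  apply/eqP; rewrite eq_le measure_ge0 andbT -PN; apply: le_measure; rewrite ?inE//.
  move=> w wN0; apply: contrapT => /hN/(_ 1 ltr01)[e [_ _]].
  by rewrite wN0 ltxx.
pose Yt t w := if w \in N0 then 0 else Y (t, w).
have YtE t w : ~ N0 w -> Yt t w = Y (t, w) by move=> nw; rewrite /Yt memNset.
have mYt t : Hmeasurable (Yt t).
  apply: (weakly_measurable_Hmeasurable hip x_dense) => y.
  have -> : (fun w => ip (Yt t w) y) = (fun w => \1_(~` N0) w * ip (Y (t, w)) y).
    apply/funext => w; rewrite /Yt indicE in_setC; case: (w \in N0) => /=.
      by rewrite mul0r (ip0l hip).
    by rewrite mul1r.
  apply: measurable_funM; first by apply: measurable_indic; exact: measurableC.
  exact: (Hmeasurable_ip hip y (Hmeasurable_section_omega mY t)).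
have PU (E : set Omega) : measurable E -> (P (E `|` N0) <= P E)%E.
  move=> mE; have : (P (E `|` N0) <= P E + P N0)%E by exact: measureU2.
  by rewrite PN0 adde0.
exists Yt; split.
- move=> t tT; split; first exact: mYt.
  move=> eps eta eps0 eta0.
  have [del [del0 hdel]] := approx_limit_stoch_conv hip x_dense levyZ T_ge0 M_ge0
    linRes bRes leRes cRes limY tT eps0 eta0.
  exists del; split => // n p s tp; apply: le_lt_trans (hdel n p s tp).
  have tT' : t <= T by case/andP: tT.
  have mr := Hmeasurable_riemann_sum hip x_dense levyZ linRes bRes tT' tp.
  have mS (X : Omega -> H) : Hmeasurable X ->
      measurable [set w | eps < `|riemann_sum Res Z t n p s w - X w|].
    move=> mX.
    apply: (measurable_gt_norm (X := fun w => riemann_sum Res Z t n p s w - X w)).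
    exact: (Hmeasurable_sub hip x_dense).
  have mSY := mS _ (Hmeasurable_section_omega mY t).
  apply: (@le_trans _ _
    (P ([set w | (eps < `|riemann_sum Res Z t n p s w - Y (t, w)|)%R] `|` N0))).
    apply: le_measure; rewrite ?inE; [exact: mS|exact: measurableU|].
    by move=> w /= h; have [wN|wN] := pselect (N0 w); [right|left; rewrite -YtE].
  exact: PU.
- move=> w; have [wN|wN] := pselect (N0 w).
    have -> : (fun tau => Yt tau w) = cst 0 by apply/funext => tau; rewrite /Yt mem_set.
    split; last first.
      rewrite (_ : (\int[_]_(x in _) _ = 0)%E) ?ltry//.
      by apply: integral0_eq => x _; rewrite normr0.
    move=> B _; apply: measurableI => //.
    by rewrite preimage_cst; case: ifP => _; [exact: measurableT|exact: measurable0].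
  have -> : (fun tau => Yt tau w) = (fun tau => Y (tau, w)).
    by apply/funext => tau; rewrite YtE.
  split.
    by move=> B bB; apply: measurableI => //; exact: (Hmeasurable_section_time mY w).
  rewrite ltey; apply/eqP => h; apply: wN; rewrite /N0 /= /Phi.
  by under eq_integral do rewrite mul1r.
- move=> t tT xi eta adj.
  have [N [mN PN hN]] := limit_equation hip x_dense cdd inta resF levyZ T_ge0 M_ge0 leRes
    limY adj tT.
  exists (N `|` N0); split; first exact: measurableU.
    by apply/eqP; rewrite eq_le measure_ge0 andbT -[leRHS]PN; exact: PU.
  move=> w /= nh; apply: contrapT => /not_orP[wN wN0]; apply: nh.
  have [iY eqY] := hN w wN.
  have E : (fun tau => ip (a (t - tau) *: Yt tau w) eta) =
      (fun tau => a (t - tau) * ip (Y (tau, w)) eta).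
    by apply/funext => tau; rewrite YtE// (ipZl hip).
  have E' : (fun tau => (ip (a (t - tau) *: Yt tau w) eta)%:E) =
      EFin \o (fun tau => a (t - tau) * ip (Y (tau, w)) eta).
    by rewrite -E.
  by rewrite E E' YtE.
Qed.
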